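(* Let $n\ge 1$ be an integer. The $\Gamma$-limit, as $\varepsilon\to 0^+$, of the functionals $\mathsf K_\varepsilon:L^1_{\mathrm{loc}}(\mathbb R^n)\to[0,\infty]$ with respect to the $L^1_{\mathrm{loc}}(\mathbb R^n)$ topology exists and is given by $$\Gamma\text{-}\lim_{\varepsilon\to 0}\mathsf K_\varepsilon(f)=\frac14|Df|(\mathbb R^n),\qquad f\in L^1_{\mathrm{loc}}(\mathbb R^n).$$ Explicitly, for every $f\in L^1_{\mathrm{loc}}(\mathbb R^n)$: (i) for every family $(f_\varepsilon)_{\varepsilon>0}\subset L^1_{\mathrm{loc}}(\mathbb R^n)$ such that $f_\varepsilon\to f$ in $L^1_{\mathrm{loc}}(\mathbb R^n)$ as $\varepsilon\to0$, one has $\frac14|Df|(\mathbb R^n)\le\liminf_{\varepsilon\to0}\mathsf K_\varepsilon(f_\varepsilon)$; (ii) there exists a family $(f_\varepsilon)_{\varepsilon>0}\subset L^1_{\mathrm{loc}}(\mathbb R^n)$ such that $f_\varepsilon\to f$ in $L^1_{\mathrm{loc}}(\mathbb R^n)$ as $\varepsilon\to0$ and $\limsup_{\varepsilon\to0}\mathsf K_\varepsilon(f_\varepsilon)\le\frac14|Df|(\mathbb R^n)$.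
   Context: For $\varepsilon>0$, an $\varepsilon$-cube is an open cube in $\mathbb R^n$ of side-length $\varepsilon$, with arbitrary orientation (edges not necessarily parallel to the coordinate axes). For $f\in L^1_{\mathrm{loc}}(\mathbb R^n)$, $$\mathsf K_\varepsilon(f):=\sup_{\mathcal H_\varepsilon}\ \varepsilon^{n-1}\sum_{Q\in\mathcal H_\varepsilon}\frac1{|Q|}\int_Q\Big|f(x)-\frac1{|Q|}\int_Q f\Big|\,dx\in[0,\infty],$$ where the supremum runs over all families $\mathcal H_\varepsilon$ (of arbitrary cardinality) of pairwise disjoint $\varepsilon$-cubes $Q\subset\mathbb R^n$. The extended total variation of $f\in L^1_{\mathrm{loc}}(\mathbb R^n)$ is $$|Df|(\mathbb R^n):=\sup\Big\{\int_{\mathbb R^n} f\,\mathrm{div}\,\phi\,dx:\ \phi\in C^1_c(\mathbb R^n,\mathbb R^n),\ \sup_{x}|\phi(x)|\le1\Big\}\in[0,\infty].$$ Both quantities may equal $\infty$. Convergence in $L^1_{\mathrm{loc}}(\mathbb R^n)$ means convergence in $L^1(K)$ for every compact $K\subset\mathbb R^n$. *)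

(* Defs.v *)
From HB Require Import structures.
From mathcomp Require Import all_boot all_order all_algebra.
From mathcomp Require Import all_classical all_reals all_analysis.

Set Implicit Arguments.
Unset Strict Implicit.
Unset Printing Implicit Defensive.

Import Order.TTheory GRing.Theory Num.Theory.
Import numFieldNormedType.Exports.

Local Open Scope classical_set_scope.
Local Open Scope ring_scope.

(* The product sigma-algebra on row vectors, generated by the coordinate
   projections exactly as the library does for n.-tuple T; over the reals it is
   the Borel sigma-algebra of 'rV[R]_n. *)
Definition measure_rV_display : measure_display -> measure_display.
Proof. exact. Qed.

Section measurable_rV.
Context {d} {T : sigmaRingType d}.
Variable n : nat.

Let coord : 'I_n -> 'rV[T]_n -> T := fun i x => x ord0 i.

Let rV_set0 : g_sigma_preimage coord set0.
Proof. exact: sigma_algebra0. Qed.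

Let rV_setC A : g_sigma_preimage coord A -> g_sigma_preimage coord (~` A).
Proof. exact: sigma_algebraC. Qed.

Let rV_bigcup (F : _^nat) : (forall i, g_sigma_preimage coord (F i)) ->
  g_sigma_preimage coord (\bigcup_i (F i)).
Proof. exact: sigma_algebra_bigcup. Qed.

HB.instance Definition _ := @isMeasurable.Build (measure_rV_display d)
  'rV[T]_n (g_sigma_preimage coord) rV_set0 rV_setC rV_bigcup.

End measurable_rV.

Lemma measurable_coord (R : realType) m (i : 'I_m) :
  measurable_fun [set: 'rV[R]_m] (fun x => x ord0 i).
Proof.
move=> _ Y mY; rewrite setTI; apply: sub_sigma_algebra => /=.
rewrite -bigcup_seq/=; exists i => /=; first by rewrite mem_index_enum.
by exists Y => //; rewrite setTI.
Qed.

Lemma measurable_fun_rV (R : realType) d (T : measurableType d) m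
    (f : T -> 'rV[R]_m) :
  (forall i, measurable_fun setT (fun t => f t ord0 i)) ->
  measurable_fun setT f.
Proof.
move=> mf _ Y mY; rewrite setTI.
suff H : measurable `<=` image_set_system setT f measurable.
  by have := H _ mY; rewrite /image_set_system/= setTI.
apply: smallest_sub; first exact/sigma_algebra_image/sigma_algebra_measurable.
rewrite -bigcup_seq; apply: bigcup_sub => i _ A [B mB <-].
by rewrite /image_set_system/= setTI setTI; have := mf i _ _ mB; rewrite setTI; exact.
Qed.

Section lebesgue_rV_step.
Context {R : realType} (n : nat).

Definition rV_cons (p : measurableTypeR R * 'rV[R]_n) : 'rV[R]_n.+1 :=
  row_mx (p.1 : R)%:M p.2.

Definition rV_behead (x : 'rV[R]_n.+1) : 'rV[R]_n :=
  \row_j x ord0 (lift ord0 j).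

Lemma rV_cons0 p : rV_cons p ord0 ord0 = p.1.
Proof.
rewrite mxE; case: splitP => [j _|k /eqP]; last by rewrite eq_sym addn_eq0.
by rewrite mxE !ord1 mulr1n.
Qed.

Lemma rV_consS p (i : 'I_n) : rV_cons p ord0 (lift ord0 i) = p.2 ord0 i.
Proof.
rewrite mxE; case: splitP => [j /=|k /= /eqP]; first by rewrite ord1.
by rewrite /bump/= !add1n eqSS => /eqP ik; congr (p.2 _ _); exact/val_inj.
Qed.

Lemma rV_consK p : rV_behead (rV_cons p) = p.2.
Proof. by apply/rowP => i; rewrite mxE rV_consS. Qed.

Lemma measurable_rV_cons : measurable_fun setT rV_cons.
Proof.
apply: measurable_fun_rV => i.
have [->|[j ->]] : i = ord0 \/ exists j, i = lift ord0 j.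
  by case: (unliftP ord0 i) => [j ->|->]; [right; exists j|left].
  rewrite (_ : (fun _ => _) = fst); first exact: measurable_fst.
  by apply/funext => p /=; rewrite rV_cons0.
rewrite (_ : (fun _ => _) = (fun x : 'rV[R]_n => x ord0 j) \o snd).
  by apply: measurableT_comp => //; exact: measurable_coord.
by apply/funext => p /=; rewrite rV_consS.
Qed.

Lemma measurable_rV_behead : measurable_fun setT rV_behead.
Proof.
apply: measurable_fun_rV => i.
rewrite [X in measurable_fun _ X](_ : _ =
    fun x : 'rV[R]_n.+1 => x ord0 (lift ord0 i)); first exact: measurable_coord.
by apply/funext => x; rewrite mxE.
Qed.

Variable mu : {sigma_finite_measure set 'rV[R]_n -> \bar R}.

Definition lebesgue_rV_succ : set 'rV[R]_n.+1 -> \bar R :=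
  pushforward ((@lebesgue_measure R) \x mu)%E rV_cons.

HB.instance Definition _ := Measure.copy lebesgue_rV_succ
  (measure_function_pushforward__canonical__measure_function_Measure
    ((@lebesgue_measure R) \x mu)%E measurable_rV_cons).

Let lebesgue_rV_succ_sigma_finite : sigma_finite setT lebesgue_rV_succ.
Proof.
have /sigma_finiteP[F [TF ndF Foo]] := sigma_finiteT (@lebesgue_measure R).
have /sigma_finiteP[G [TG ndG Goo]] := sigma_finiteT mu.
exists (fun k => [set x : 'rV[R]_n.+1 | F k (x ord0 ord0)] `&` rV_behead @^-1` (G k)).
  apply/seteqP; split=> // x _.
  have [i _ Fi] : (\bigcup_i F i) (x ord0 ord0) by rewrite -TF.
  have [j _ Gj] : (\bigcup_i G i) (rV_behead x) by rewrite -TG.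
  exists (maxn i j) => //; split.
    by apply: (subsetPset _ _ (ndF _ _ (leq_maxl i j))).
  by apply: (subsetPset _ _ (ndG _ _ (leq_maxr i j))).
move=> k; have [mF Fk] := Foo k; have [mG Gk] := Goo k; split.
  apply: measurableI.
    by rewrite -[X in measurable X]setTI; exact: measurable_coord.
  by rewrite -[X in measurable X]setTI; exact: measurable_rV_behead.
rewrite /lebesgue_rV_succ /pushforward.
rewrite (_ : _ @^-1` _ = F k `*` G k).
  by rewrite product_measure1E// lte_mul_pinfty// ge0_fin_numE.
by apply/seteqP; split => p /=; rewrite rV_cons0 rV_consK.
Qed.

HB.instance Definition _ := Measure_isSigmaFinite.Build _ _ _
  lebesgue_rV_succ lebesgue_rV_succ_sigma_finite.

End lebesgue_rV_step.

Lemma measurable_rV_box (R : realType) n (A : 'I_n -> set R) :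
  (forall i, measurable (A i)) ->
  measurable [set x : 'rV[R]_n | forall i, A i (x ord0 i)].
Proof.
move=> mA; rewrite [X in measurable X](_ : _ = \bigcap_(i in [set: 'I_n])
    ((fun x : 'rV[R]_n => x ord0 i) @^-1` A i)).
  apply: fin_bigcap_measurable => // i _.
  by rewrite -[X in measurable X]setTI; exact: measurable_coord.
by apply/seteqP; split => x /= h i; [move=> _; exact: h|exact: h].
Qed.

(* n-dimensional Lebesgue measure, as an iterated product; the zero-dimensional
   space is a point of mass 1. *)
Fixpoint lebesgue_rV (R : realType) (n : nat) :
    {sigma_finite_measure set 'rV[R]_n -> \bar R} :=
  match n with
  | 0 => \d_(0 : 'rV[R]_0)
  | m.+1 => lebesgue_rV_succ (lebesgue_rV R m)
  end.

Lemma lebesgue_rV_box (R : realType) n (A : 'I_n -> set R) :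
  (forall i, measurable (A i)) ->
  lebesgue_rV R n [set x | forall i, A i (x ord0 i)] =
  (\prod_(i < n) lebesgue_measure (A i))%E.
Proof.
elim: n A => [|n IH] A mA.
  rewrite big_ord0 /= diracE mem_set//=; by case.
rewrite big_ord_recl -IH; last by move=> i; exact: mA.
rewrite -product_measure1E; last 2 first.
- exact: mA.
- exact: (@measurable_rV_box R n (fun i => A (lift ord0 i)) (fun i => mA _)).
rewrite /= /lebesgue_rV_succ /pushforward; congr (product_measure1 _ _ _).
apply/seteqP; split => p /= h.
  split; first by have := h ord0; rewrite rV_cons0.
  by move=> i; have := h (lift ord0 i); rewrite rV_consS.
move=> i; case: (unliftP ord0 i) => [j ->|->].
  by rewrite rV_consS; exact: h.2.
by rewrite rV_cons0; exact: h.1.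
Qed.

Section functionals.
Context {R : realType} {n : nat}.
Implicit Types (f : 'rV[R]_n -> R) (Q : set 'rV[R]_n) (x : 'rV[R]_n).

Local Notation mu := (lebesgue_rV R n).

(* Borel representatives of the classes in L^1_loc; every Lebesgue-measurable
   function agrees almost everywhere with a Borel one. *)
Definition L1loc f : Prop :=
  measurable_fun setT f /\
  forall K : set 'rV[R]_n, compact K -> (\int[mu]_(x in K) `|f x|%:E < +oo)%E.

(* Convergence in L^1_loc of a family indexed by eps > 0, as eps tends to 0. *)
Definition cvg_L1loc (F : R -> 'rV[R]_n -> R) f : Prop :=
  forall K : set 'rV[R]_n, compact K ->
    (\int[mu]_(x in K) `|F eps x - f x|%:E)%E @[eps --> 0^'+] --> 0%E.

(* Open cubes of side eps and arbitrary orientation: isometric images of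
   the cube ]0, eps[^n. *)
Definition cube (eps : R) Q : Prop :=
  exists (c : 'rV[R]_n) (O : 'M[R]_n), O *m O^T = 1%:M /\
    Q = [set c + u *m O | u in [set u : 'rV[R]_n | forall i, 0 < u ord0 i < eps]].

Definition average f Q : R :=
  (fine (mu Q))^-1 * (\int[mu]_(x in Q) f x)%R.

Definition mean_osc f Q : \bar R :=
  ((fine (mu Q))^-1%:E * \int[mu]_(x in Q) `|f x - average f Q|%:E)%E.

Definition Kfun (eps : R) f : \bar R :=
  ereal_sup [set ((eps ^+ n.-1)%:E * \esum_(Q in H) mean_osc f Q)%E |
    H in [set H : set (set 'rV[R]_n) |
            (forall Q, H Q -> cube eps Q) /\ trivIset H id]].

Definition enorm x : R := Num.sqrt (\sum_(i < n) x ord0 i ^+ 2).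

Definition C1c (phi : 'rV[R]_n -> 'rV[R]_n) : Prop :=
  [/\ forall x, differentiable phi x,
      forall v, continuous ('D_v phi)
    & compact (closure [set x | phi x != 0])].

Definition divergence (phi : 'rV[R]_n -> 'rV[R]_n) x : R :=
  \sum_(i < n) ('D_(delta_mx ord0 i) phi x) ord0 i.

Definition ext_total_variation f : \bar R :=
  ereal_sup [set (\int[mu]_x (f x * divergence phi x)%:E)%E |
    phi in [set phi | C1c phi /\ forall x, enorm (phi x) <= 1]].

End functionals.

(* Main.v *)
Require Import Defs.
From mathcomp Require Import all_boot all_order all_algebra.
From mathcomp Require Import all_classical all_reals all_analysis.
From mathcomp Require Import measurable_realfun ring lra.

Set Implicit Arguments.
Unset Strict Implicit.
Unset Printing Implicit Defensive.

Import Order.TTheory GRing.Theory Num.Theory.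
Import numFieldNormedType.Exports.

Local Open Scope classical_set_scope.
Local Open Scope ring_scope.

(* Upper bound.  Let V be the total variation of f, and let F = rho_d * f with
   d = sqrt eps, rho_d being an explicit C^1 mollifier supported in the ball of
   radius d.  For disjoint eps-cubes Q with centres z, let psi_Q be the sign of
   F minus its average over Q, recentred to have mean zero on Q.  Then
     eps^-1 sum_Q int_Q psi_Q F = int f div Phi,
   where Phi x is
     - eps^-1 sum_Q int_Q int_0^1 psi_Q(w) rho_d(x - z - t (w - z)) (w - z) dt dw.
   Since int_Q |(w - z).e| dw <= |Q| (eps/4) |e| whatever the orientation of Q,
   |Phi| <= 1/4 + O(eps/d), so the energy of F is at most (1/4 + o(1)) V.

   Lower bound.  Translating a family of disjoint cubes Q and averaging over the
   translations with weight rho_d shows that K_eps(F) >=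
   eps^-1 sum_Q int_Q psi_Q (rho_d * F) whenever |psi_Q| <= 1 and psi_Q has mean
   zero on Q.  Given a test field phi, cut its support into small boxes, fill
   each box with eps-cubes having an edge along the value p of phi at the centre
   of the box, and let psi_Q be -|p| times the sign of the coordinate along that
   edge: the sum tends to - 1/4 int phi.grad (rho_d * f), which is
   1/4 int (rho_d * f) div phi.  Finally let d tend to 0. *)

(** * Invariance of Lebesgue measure *)

(** The family [f_eps = f] is not a recovery family: for [n = 1] and the indicator of a half-line,
    one interval centred at the jump already gives the value 1/2, twice what is allowed. Smoothing
    at a scale d much larger than eps makes the function nearly affine on each cube. For an affine
    function of gradient p the mean oscillation on a cube is the mean of |p.(w - z)|, which depends
    on the orientation: it is largest when an edge is parallel to p, and then equals eps |p| / 4.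
    Both halves rest on this extremal fact. The upper bound needs the inequality in every direction,
    where Cauchy-Schwarz gives too large a constant; the lower bound needs the equality case, hence
    the cubes aligned with the test field. The families in the lower bound converge only in L^1_loc,
    with no bound on gradients. The mollification is therefore transferred from the function to the
    family of cubes, and every error is controlled by L^1 norms on one fixed ball; d stays fixed
    while eps tends to 0. Neither half uses the structure theory of BV functions: the variation
    enters only as a supremum over test fields. *)

Section rV_measurability.
Context {R : realType} {n : nat}.
Implicit Types (x y : 'rV[R]_n) (A B : set 'rV[R]_n).

Lemma rV_normP x (e : R) : 0 <= e ->
  (`|x| <= e) = [forall i, `|x ord0 i| <= e].
Proof.
move=> e0; apply/idP/forallP => [xe i|xe].
  by apply: le_trans xe; rewrite /Num.norm/= mx_normrE; apply: (le_bigmax _ _ (ord0, i)).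
rewrite /Num.norm/= mx_normrE; apply/bigmax_leP; split => //= -[a i] _ /=.
by rewrite ord1.
Qed.

Lemma rV_norm_coord x i : `|x ord0 i| <= `|x|.
Proof. by have := rV_normP x (normr_ge0 x); rewrite lexx => /esym/forallP. Qed.

Lemma rV_norm_lt x (e : R) : 0 < e -> (forall i, `|x ord0 i| < e) -> `|x| < e.
Proof.
move=> e0 xe; rewrite /Num.norm/= mx_normrE; apply/bigmax_ltP; split => //= -[a i] _ /=.
by rewrite ord1.
Qed.

(** The sigma-algebra is generated by the coordinates, so openness is reduced to countably many
    boxes: those with rational centre and radius [1/(k+1)] that lie in [A] already cover it. *)
Lemma open_measurable_rV A : open A -> measurable A.
Proof.
move=> oA.
pose I := ('rV[rat]_n * nat)%type.
pose bx (p : I) := [set x : 'rV[R]_n | forall i, `|x ord0 i - ratr (p.1 ord0 i)| < p.2.+1%:R^-1].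
have mbx p : measurable (bx p).
  rewrite (_ : bx p = [set x : 'rV[R]_n | forall i,
      (`](ratr (p.1 ord0 i) - p.2.+1%:R^-1), (ratr (p.1 ord0 i) + p.2.+1%:R^-1)[%classic
        : set R) (x ord0 i)]).
    exact: (@measurable_rV_box R n (fun i => `](ratr (p.1 ord0 i) - p.2.+1%:R^-1), (ratr (p.1 ord0 i) + p.2.+1%:R^-1)[%classic)).
  by apply/seteqP; split => x /= h i; have := h i; rewrite in_itv/= ltr_distl.
rewrite (_ : A = \bigcup_(p : I) (if `[< bx p `<=` A >] then bx p else set0)).
  apply: countable_bigcupT_measurable; first exact: countableP.
  by move=> p; case: ifP => // _; exact: mbx.
apply/seteqP; split => [x Ax|x [p _]]; last by case: asboolP => // h /h.
have := oA; rewrite openE => /(_ _ Ax); rewrite /interior => /nbhs_ballP[e /= e0 he].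
have [k ke] : exists k : nat, k.+1%:R^-1 < e / 2.
  have [k _ kP] := near_infty_natSinv_lt (PosNum (divr_gt0 e0 (ltr0n R 2))).
  by exists k; apply: kP => /=.
have /choice[q qP] : forall i, exists q : rat, `|x ord0 i - ratr q| < k.+1%:R^-1.
  move=> i; have h : x ord0 i - k.+1%:R^-1 < x ord0 i + k.+1%:R^-1.
    by rewrite ltrD2l gtrN ?invr_gt0.
  have [q] := rat_in_itvoo h; rewrite in_itv/= => hq.
  by exists q; rewrite distrC ltr_distl.
exists (\row_i q i, k) => //=.
have bA : bx (\row_i q i, k) `<=` A.
  move=> y yb; apply: he; rewrite -ball_normE /ball_/=.
  apply: rV_norm_lt => // i; rewrite !mxE.
  have := yb i; have := qP i; rewrite /= mxE => h1; rewrite distrC => h2.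
  apply: (le_lt_trans (ler_distD (ratr (q i)) _ _)).
  by rewrite (splitr e) ltrD// (lt_trans _ ke).
rewrite asboolT// => i /=; rewrite mxE; exact: qP.
Qed.

Lemma closed_measurable_rV A : closed A -> measurable A.
Proof.
move=> cA; rewrite -(setCK A); apply: measurableC; apply: open_measurable_rV.
exact: closed_openC.
Qed.

Lemma continuous_measurable_rV (f : 'rV[R]_n -> R) : continuous f -> measurable_fun setT f.
Proof.
move=> /continuousP cf; apply: (measurability _ (RGenOpens.measurableE R)).
move=> _ [_ [a [b ->] <-]]; rewrite setTI; apply: open_measurable_rV.
exact/cf/interval_open.
Qed.

Lemma measurable_addrV y : measurable_fun setT (fun x => x + y).
Proof.
apply: measurable_fun_rV => i.
under eq_fun do rewrite mxE.
exact: measurable_funD (measurable_coord _) (measurable_cst _).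
Qed.

Lemma measurable_mulmx (O : 'M[R]_n) : measurable_fun setT (fun x => x *m O).
Proof.
apply: measurable_fun_rV => i.
under eq_fun do rewrite mxE.
apply: measurable_sum => j.
exact: measurable_funM (measurable_coord _) (measurable_cst _).
Qed.

Lemma measurable_opprV : measurable_fun setT (fun x => - x).
Proof.
apply: measurable_fun_rV => i.
under eq_fun do rewrite mxE.
exact: measurableT_comp (measurable_coord _).
Qed.

Lemma measurable_preimage d d' (X : measurableType d) (Y : measurableType d')
  (f : X -> Y) (B : set Y) : measurable_fun setT f -> measurable B -> measurable (f @^-1` B).
Proof. by move=> mf mB; rewrite -[X in measurable X]setTI; exact: mf. Qed.

End rV_measurability.

Lemma measurable_addrV2 (R : realType) n d (T : measurableType d) (f g : T -> 'rV[R]_n) :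
  measurable_fun setT f -> measurable_fun setT g ->
  measurable_fun setT (fun t => f t + g t).
Proof.
move=> mf mg; apply: measurable_fun_rV => i.
under eq_fun do rewrite mxE.
exact: measurable_funD (measurableT_comp (measurable_coord i) mf)
  (measurableT_comp (measurable_coord i) mg).
Qed.

Lemma measurable_subrV2 (R : realType) n d (T : measurableType d) (f g : T -> 'rV[R]_n) :
  measurable_fun setT f -> measurable_fun setT g ->
  measurable_fun setT (fun t => f t - g t).
Proof.
move=> mf mg; apply: measurable_addrV2 => //.
exact: measurableT_comp (@measurable_opprV R n) mg.
Qed.

Section invariance.
Context {R : realType}.

Lemma lebesgue_measure_shift (y : R) (A : set R) : measurable A ->
  lebesgue_measure [set x | A (x + y)] = lebesgue_measure A.
Proof.
move=> mA; apply/esym.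
have mf : measurable_fun setT (fun x : measurableTypeR R => (x + y : measurableTypeR R)).
  exact: (@measurable_funD _ _ _ _ id (cst y)).
pose M := measure_function_pushforward__canonical__measure_function_Measure (@lebesgue_measure R) mf.
rewrite -[RHS]/(M A).
apply: (lebesgue_measure_unique (mu := M)) => // _ [[a b] _ <-] /=.
rewrite /M/= /pushforward.
rewrite (_ : _ @^-1` _ = `](a - y), (b - y)]%classic).
  rewrite !lebesgue_measure_itv/= !lte_fin ltrD2r.
  by case: ifP => // _; rewrite -!EFinD; congr EFin; ring.
by apply/seteqP; split => x /=; rewrite !in_itv/= ltrBlDr lerBrDr.
Qed.

Lemma lebesgue_measure_bounded (k : R) : (lebesgue_measure `[(- k)%R, k]%classic < +oo)%E.
Proof. by rewrite lebesgue_measure_itv/=; case: ifP => _; rewrite ?ltry. Qed.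

Variable n : nat.
Local Notation mu := (lebesgue_rV R n).
Local Notation V := ('rV[R]_n).

(** The measurable boxes form a pi-system, exhausted by the cubes [[-k, k]^n] of finite measure.
    This settles translations, which carry boxes to boxes, but not rotations. *)
Lemma lebesgue_rV_unique (m : {measure set 'rV[R]_n -> \bar R}) :
  (forall A : 'I_n -> set R, (forall i, measurable (A i)) ->
    m [set x | forall i, A i (x ord0 i)] = (\prod_(i < n) lebesgue_measure (A i))%E) ->
  forall A, measurable A -> m A = mu A.
Proof.
move=> hm A mA.
pose G : set (set 'rV[R]_n) := [set B | exists2 A : 'I_n -> set R, (forall i, measurable (A i)) &
  B = [set x : 'rV[R]_n | forall i, A i (x ord0 i)]].
apply: (measure_unique G (fun k : nat => [set x : 'rV[R]_n | forall i, `[- k%:R, k%:R]%classic (x ord0 i)])) => //.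
- apply/seteqP; split.
    apply: smallest_sub; first exact: smallest_sigma_algebra.
    rewrite -bigcup_seq; apply: bigcup_sub => i _ _ [B mB <-].
    apply: sub_sigma_algebra; exists (fun j => if j == i then B else setT).
      by move=> j; case: ifP.
    rewrite setTI; apply/seteqP; split => x /=.
      by move=> Bx j; case: eqP => // ->.
    by move/(_ i); rewrite eqxx.
  apply: smallest_sub; first exact: sigma_algebra_measurable.
  by move=> _ [B mB ->]; exact: measurable_rV_box.
- move=> _ _ [B1 mB1 ->] [B2 mB2 ->]; exists (fun i => B1 i `&` B2 i).
    by move=> i; exact: measurableI.
  apply/seteqP; split => x /=; first by move=> [h1 h2] i.
  by move=> h; split=> i; have [] := h i.
- by move=> k; exists (fun=> `[- k%:R, k%:R]%classic).
- apply/seteqP; split => // x _.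
  have [k kx] : exists k : nat, `|x| <= k%:R.
    by exists (Num.truncn `|x|).+1; apply/ltW/truncnS_gt.
  exists k => //= i; rewrite in_itv/= -ler_norml.
  exact: le_trans (rV_norm_coord x i) kx.
- by move=> _ [B mB ->]; rewrite hm// -lebesgue_rV_box.
- move=> k /=; rewrite (hm (fun=> `[- k%:R, k%:R]%classic))//.
  rewrite ltey_eq prode_fin_num// => i _.
  by rewrite ge0_fin_numE// lebesgue_measure_bounded.
Qed.

Lemma lebesgue_rV_pow (A : set R) (r : R) : measurable A -> lebesgue_measure A = r%:E ->
  mu [set x | forall i, A (x ord0 i)] = (r ^+ n)%:E.
Proof.
move=> mA Ar; rewrite (lebesgue_rV_box (A := fun=> A))//.
under eq_bigr do rewrite Ar.
by rewrite prodEFin prodr_const card_ord.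
Qed.

Implicit Types (x y : V).

Lemma lebesgue_rV_shift y (A : set V) : measurable A -> mu [set x | A (x + y)] = mu A.
Proof.
move=> mA; have mf := @measurable_addrV R n y.
pose M := measure_function_pushforward__canonical__measure_function_Measure mu mf.
rewrite -[LHS]/(M A); apply: lebesgue_rV_unique => // B mB.
rewrite /M/= /pushforward.
transitivity (mu [set x : V | forall i, [set t | B i (t + y ord0 i)] (x ord0 i)]).
  by congr (mu _); apply/seteqP; split => x /= h i; have := h i; rewrite mxE.
rewrite (lebesgue_rV_box (A := fun i => [set t | B i (t + y ord0 i)])) => [|i]; last first.
  apply: (@measurable_preimage _ _ (measurableTypeR R) (measurableTypeR R) (fun t => t + y ord0 i)) => //.
    exact: (@measurable_funD _ _ _ _ id (cst (y ord0 i))).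
  exact: mB.
by apply: eq_bigr => i _; rewrite lebesgue_measure_shift.
Qed.

Definition dot (x y : V) : R := \sum_(i < n) x ord0 i * y ord0 i.

Lemma dotE x y : dot x y = (x *m y^T) ord0 ord0.
Proof. by rewrite mxE; apply: eq_bigr => i _; rewrite mxE. Qed.

Lemma dot_mulmx x y (O : 'M[R]_n) : dot x (y *m O) = dot (x *m O^T) y.
Proof. by rewrite !dotE trmx_mul mulmxA. Qed.

Lemma dot_orth x y (O : 'M[R]_n) : O *m O^T = 1%:M -> dot (x *m O) (y *m O) = dot x y.
Proof. by move=> OO; rewrite dot_mulmx -mulmxA OO mulmx1. Qed.

Let measure_sections (E : set (V * V)) : measurable E ->
  (\int[mu]_x mu (xsection E x) = \int[mu]_y mu (ysection E y))%E.
Proof.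
move=> mE; have := indic_fubini_tonelli mu mu mE.
by rewrite (indic_fubini_tonelli_FE mu mE) (indic_fubini_tonelli_GE mu mE).
Qed.

Let unit_ball : set V := [set x | dot x x < 1].

Lemma continuous_coordV (T : topologicalType) (f : T -> V) i :
  continuous f -> continuous (fun t => f t ord0 i).
Proof. by move=> cf t; exact: (continuous_comp (cf t) (@coord_continuous R 1 n ord0 i (f t))). Qed.

Lemma continuous_dot (T : topologicalType) (f g : T -> V) : continuous f -> continuous g ->
  continuous (fun t => dot (f t) (g t)).
Proof.
move=> cf cg; rewrite /dot; apply: continuous_big => [|i _ x]; first exact: add_continuous.
by apply: cvgM; [exact: (continuous_coordV cf)|exact: (continuous_coordV cg)].
Qed.

Let measurable_unit_ball : measurable unit_ball.
Proof.
have mf : measurable_fun setT (fun x : V => dot x x).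
  by apply: continuous_measurable_rV; apply: continuous_dot => z; exact: cvg_id.
rewrite (_ : unit_ball = (fun x : V => dot x x) @^-1` `]-oo, 1[%classic).
  exact: measurable_preimage.
by apply/seteqP; split => x /=; rewrite in_itv/=.
Qed.

Let unit_ball_fin : exists2 r : R, 0 < r & mu unit_ball = r%:E.
Proof.
have le1 : (mu unit_ball <= (2 ^+ n)%:E)%E.
  rewrite -(@lebesgue_rV_pow `[(-1)%R, 1%R]%classic 2)//; last first.
    rewrite lebesgue_measure_itv/= lte_fin (_ : (-1 < 1 :> R)) -?EFinD.
      by congr EFin; ring.
    lra.
  apply: le_measure; rewrite ?inE//.
    exact: (@measurable_rV_box R n (fun=> `[(-1)%R, 1%R]%classic)).
  move=> x xB i /=; rewrite in_itv/= -ler_norml -(@ler_pXn2r _ 2)// ?nnegrE//.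
  rewrite expr1n real_normK ?num_real// (le_trans _ (ltW xB))//.
  rewrite /dot (bigD1 i)//= expr2 lerDl; apply: sumr_ge0 => j _.
  by rewrite -expr2 sqr_ge0.
(* On the cube of half-side [c] the squared norm is at most [n c^2 <= n c < 1], so the cube lies in
   the ball and the mass of the ball is positive. *)
pose c : R := n.+1%:R^-1.
have c0 : 0 < c by rewrite invr_gt0.
have ge : (((2 * c) ^+ n)%:E <= mu unit_ball)%E.
  rewrite -(@lebesgue_rV_pow `[- c, c]%classic (2 * c))//; last first.
    rewrite lebesgue_measure_itv/= lte_fin (_ : (- c < c :> R)) -?EFinD.
      by congr EFin; ring.
    lra.
  apply: le_measure; rewrite ?inE//.
    exact: (@measurable_rV_box R n (fun=> `[- c, c]%classic)).
  move=> x xB; rewrite /unit_ball/= /dot.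
  apply: (@le_lt_trans _ _ (\sum_(i < n) c)).
    apply: ler_sum => i _; have := xB i; rewrite /= in_itv/= -ler_norml => h.
    rewrite -expr2 -real_normK ?num_real// expr2 -[leRHS]mulr1.
    apply: ler_pM => //; rewrite (le_trans h)// invf_le1// ler1n//.
  by rewrite sumr_const card_ord /c -[X in X < _]mulr_natr mulrC ltr_pdivrMr// mul1r ltr_nat.
have r0 : 0 < (2 * c) ^+ n :> R by rewrite exprn_gt0// mulr_gt0.
exists (fine (mu unit_ball)).
  apply: fine_gt0; rewrite (lt_le_trans _ ge) ?lte_fin//=.
  by rewrite (le_lt_trans le1) ?ltry.
rewrite fineK// ge0_fin_numE//.
by rewrite (le_lt_trans le1) ?ltry.
Qed.

(** The uniqueness argument for Haar measure: [E] and [E'] have sections that are translates of each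
    other in one variable, and integrating in the other variable gives the two sides times the mass
    of the unit ball. Only translations, Tonelli and the invariance of the ball under [O] are used;
    no determinant appears. *)
Let orth_formula (O : 'M[R]_n) (A : set V) : O *m O^T = 1%:M -> measurable A ->
  mu [set x | A (x *m O)] = mu [set x | A (- x)].
Proof.
move=> OO mA.
have mT := @measurable_mulmx R n O.
have mTA : measurable [set x | A (x *m O)] by exact: measurable_preimage.
have [r r0 Br] := unit_ball_fin.
have TB : [set x | unit_ball (x *m O)] = unit_ball.
  by apply/seteqP; split => x /=; rewrite /unit_ball/= dot_orth.
pose E : set (V * V) := [set p | A (p.1 *m O) /\ unit_ball (p.1 *m O + p.2)].
pose E' : set (V * V) := [set p | A (p.1 *m O - p.2) /\ unit_ball (p.1 *m O)].
have m1 : measurable_fun setT (fun p : V * V => p.1 *m O).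
  exact: measurableT_comp mT measurable_fst.
have mE : measurable E.
  apply: measurableI.
    exact: (measurable_preimage m1).
  apply: (measurable_preimage (f := fun p : V * V => p.1 *m O + p.2)) => //.
  by apply: measurable_addrV2 => //; exact: measurable_snd.
have mE' : measurable E'.
  apply: measurableI; last exact: (measurable_preimage m1).
  apply: (measurable_preimage (f := fun p : V * V => p.1 *m O - p.2)) => //.
  by apply: measurable_subrV2 => //; exact: measurable_snd.
have mNA : measurable [set x | A (- x)] by apply: (measurable_preimage (@measurable_opprV R n)).
have h1 : (\int[mu]_x mu (xsection E x) = r%:E * mu [set x | A (x *m O)])%E.
  rewrite -(integral_cst mu mTA r%:E) [RHS]integral_mkcond.
  apply: eq_integral => x _.
  rewrite patchE; case: ifPn; rewrite ?inE ?notin_setE /= => hx.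
    rewrite (_ : xsection E x = [set y | unit_ball (y + x *m O)]).
      by rewrite lebesgue_rV_shift.
    by apply/seteqP; split => y /=; rewrite /xsection/= inE/= addrC => // -[].
  rewrite (_ : xsection E x = set0) ?measure0//.
  by apply/seteqP; split => y //=; rewrite /xsection/= inE/= => -[].
have h2 : (\int[mu]_x mu (xsection E' x) = mu [set x | A (- x)%R] * r%:E)%E.
  rewrite -Br -(integral_cst mu measurable_unit_ball) [RHS]integral_mkcond.
  rewrite -TB; apply: eq_integral => x _.
  rewrite patchE; case: ifPn; rewrite ?inE ?notin_setE /= => hx.
    rewrite -(lebesgue_rV_shift (- (x *m O)) mNA); congr (mu _).
    apply/seteqP; split => y /=; rewrite /xsection/= inE/= opprD opprK addrC => // -[]//.
  rewrite (_ : xsection E' x = set0) ?measure0//.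
  by apply/seteqP; split => y //=; rewrite /xsection/= inE/= => -[].
(* The substitution of [x + y *m O^T] for [x] carries one section to the other. *)
have h3 : (\int[mu]_y mu (ysection E y) = \int[mu]_y mu (ysection E' y))%E.
  apply: eq_integral => y _.
  rewrite -[RHS](lebesgue_rV_shift (y *m O^T)); last exact: measurable_ysection.
  have hO x : (x + y *m O^T) *m O = x *m O + y.
    by rewrite mulmxDl -mulmxA (mulmx1C OO) mulmx1.
  by congr (mu _); apply/seteqP; split => x; rewrite /ysection /E /E' /= !inE/= ?hO ?addrK.
move: h1; rewrite measure_sections// h3 -measure_sections// h2 muleC.
move/esym; move/(congr1 (mule (r^-1)%:E)).
by rewrite !muleA -EFinM mulVf ?gt_eqF// !mul1e.
Qed.

(** The case [O = 1] of [orth_formula], whose left-hand side is then [mu A]. Once reflections are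
    known, that formula gives the invariance under every orthogonal map. *)
Lemma lebesgue_rV_opp (A : set V) : measurable A -> mu [set x | A (- x)] = mu A.
Proof.
move=> mA; rewrite -(@orth_formula 1%:M)//; last by rewrite trmx1 mulmx1.
by congr (mu _); apply/seteqP; split => x /=; rewrite mulmx1.
Qed.

Lemma lebesgue_rV_orth (O : 'M[R]_n) (A : set V) : O *m O^T = 1%:M -> measurable A ->
  mu [set x | A (x *m O)] = mu A.
Proof. by move=> OO mA; rewrite orth_formula// lebesgue_rV_opp. Qed.

Lemma lebesgue_rV_affine (z : V) (O : 'M[R]_n) (A : set V) : O *m O^T = 1%:M -> measurable A ->
  mu [set x | A (z + x *m O)] = mu A.
Proof.
move=> OO mA; have mA' : measurable [set x | A (x + z)].
  exact: (measurable_preimage (@measurable_addrV R n z)).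
rewrite -(lebesgue_rV_shift z mA) -(lebesgue_rV_orth OO mA').
by congr (mu _); apply/seteqP; split => x /=; rewrite addrC.
Qed.

End invariance.

(** * Change of variables along a measure-preserving map *)

Section measure_preserving.
Context d (T : measurableType d) (R : realType) (mu : {measure set T -> \bar R}).
Variables (phi : T -> T) (mphi : measurable_fun setT phi).
Hypothesis phi_mu : forall A, measurable A -> mu (phi @^-1` A) = mu A.
Variables (D : set T) (mD : measurable D).

Lemma ge0_integral_preserving (f : T -> \bar R) :
  measurable_fun D f -> (forall x, D x -> 0 <= f x)%E ->
  (\int[mu]_(x in phi @^-1` D) f (phi x) = \int[mu]_(x in D) f x)%E.
Proof.
move=> mf f0; rewrite -[LHS]/(\int[mu]_(x in phi @^-1` D) (f \o phi) x)%E.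
rewrite -ge0_integral_pushforward//; last by move=> x /[!inE]; exact: f0.
by apply: eq_measure_integral => A mA _; exact: phi_mu.
Qed.

Lemma integrable_preserving (f : T -> R) : mu.-integrable D (EFin \o f) ->
  mu.-integrable (phi @^-1` D) (EFin \o (f \o phi)).
Proof.
move=> /integrableP[mf fi].
have mpD : measurable (phi @^-1` D) by exact: measurable_preimage.
apply/integrableP; split.
  apply: (measurable_comp mD _ mf (measurable_funTS mphi)).
  by move=> _ [x h <-].
rewrite (ge0_integral_preserving (f := fun x => `|(f x)%:E|%E))//.
exact: measurableT_comp.
Qed.

Lemma Rintegral_preserving (f : T -> R) : measurable_fun D f ->
  \int[mu]_(x in phi @^-1` D) f (phi x) = \int[mu]_(x in D) f x.
Proof.
move=> mf; rewrite /Rintegral; congr fine; rewrite [LHS]integralE [RHS]integralE.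
have mfE : measurable_fun D (EFin \o f) by exact/measurable_EFinP.
congr (_ - _)%E.
  rewrite -(ge0_integral_preserving (f := (EFin \o f)^\+%E))//.
    by apply: eq_integral => x _; rewrite !unlock.
  exact: measurable_funepos.
rewrite -(ge0_integral_preserving (f := (EFin \o f)^\-%E))//.
  by apply: eq_integral => x _; rewrite !unlock.
exact: measurable_funeneg.
Qed.

End measure_preserving.

(** * Integrability and bounds for real-valued integrals *)

Section integral_toolkit.
Context d (T : measurableType d) (R : realType) (mu : {measure set T -> \bar R}).
Implicit Types (D : set T) (f g : T -> R).

Lemma bounded_integrable D f (C : R) : measurable D -> (mu D < +oo)%E ->
  measurable_fun D f -> (forall x, D x -> `|f x| <= C) ->
  mu.-integrable D (EFin \o f).
Proof.
move=> mD Doo mf fC; apply: measurable_bounded_integrable => //.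
exists C; split; first exact: num_real.
by move=> M CM x Dx /=; rewrite (le_trans (fC x Dx))// ltW.
Qed.

Lemma integrableZlR (c : R) D f : measurable D -> mu.-integrable D (EFin \o f) ->
  mu.-integrable D (EFin \o (fun x => c * f x)).
Proof. by move=> mD fi; exact: (integrableZl mD c fi). Qed.

Lemma integrableDR D f g : measurable D -> mu.-integrable D (EFin \o f) ->
  mu.-integrable D (EFin \o g) -> mu.-integrable D (EFin \o (fun x => f x + g x)).
Proof. by move=> mD fi gi; exact: (integrableD mD fi gi). Qed.

Lemma integrableBR D f g : measurable D -> mu.-integrable D (EFin \o f) ->
  mu.-integrable D (EFin \o g) -> mu.-integrable D (EFin \o (fun x => f x - g x)).
Proof. by move=> mD fi gi; exact: (integrableB mD fi gi). Qed.

Lemma integrableM_bounded D f g (C : R) : measurable D ->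
  mu.-integrable D (EFin \o f) -> measurable_fun D g ->
  (forall x, D x -> `|g x| <= C) ->
  mu.-integrable D (EFin \o (fun x => f x * g x)).
Proof.
move=> mD fi mg gC.
apply: (@le_integrable _ _ _ mu D mD _ (fun x => C%:E * (f x)%:E)%E).
- by apply/measurable_EFinP; apply: measurable_funM => //; apply/measurable_EFinP; exact: measurable_int fi.
- move=> x Dx /=; rewrite lee_fin normrM [leRHS]normrM mulrC ler_wpM2r//.
  by rewrite (le_trans (gC _ Dx))// ler_norm.
- exact: integrableZl.
Qed.

Lemma Rintegral_sum D (I : Type) (s : seq I) (P : pred I) (F : I -> T -> R) :
  measurable D -> (forall i, P i -> mu.-integrable D (EFin \o F i)) ->
  \int[mu]_(x in D) (\sum_(i <- s | P i) F i x) =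
  \sum_(i <- s | P i) \int[mu]_(x in D) F i x.
Proof.
move=> mD Fi; elim: s => [|i s IH].
  by under eq_Rintegral do rewrite big_nil; rewrite big_nil Rintegral_cst// mul0r.
rewrite big_cons -IH; case: ifPn => Pi; last first.
  by apply: eq_Rintegral => x _; rewrite big_cons (negbTE Pi).
under eq_Rintegral do rewrite big_cons Pi.
rewrite RintegralD//; first exact: Fi.
rewrite (_ : _ \o _ = fun x => \sum_(j <- s | P j) (EFin \o F j) x)%E.
  exact: integrable_sum.
by apply/funext => x /=; rewrite sumEFin.
Qed.

Lemma integrable_sumR D (I : Type) (s : seq I) (P : pred I) (F : I -> T -> R) :
  measurable D -> (forall i, P i -> mu.-integrable D (EFin \o F i)) ->
  mu.-integrable D (EFin \o (fun x => \sum_(i <- s | P i) F i x)).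
Proof.
move=> mD Fi; rewrite (_ : _ \o _ = fun x => \sum_(j <- s | P j) (EFin \o F j) x)%E.
  exact: integrable_sum.
by apply/funext => x /=; rewrite sumEFin.
Qed.

Lemma normr_Rintegral_le D f (C : R) : measurable D -> (mu D < +oo)%E ->
  mu.-integrable D (EFin \o f) ->
  (forall x, D x -> `|f x| <= C) -> `|\int[mu]_(x in D) f x| <= C * fine (mu D).
Proof.
move=> mD Doo mf fC; apply: (le_trans (le_normr_Rintegral mD mf)).
rewrite -Rintegral_cst//; apply: le_Rintegral => //.
- exact: (integrable_norm mf).
- by apply: (@bounded_integrable _ _ `|C|).
Qed.

End integral_toolkit.

(** * Fubini with integrable weights and a bounded kernel *)

Section weighted_fubini.
Context d1 d2 (X : measurableType d1) (Y : measurableType d2) (R : realType).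
Variables (m1 : {sigma_finite_measure set X -> \bar R}) (m2 : {sigma_finite_measure set Y -> \bar R}).
Variables (A : set X) (B : set Y) (mA : measurable A) (mB : measurable B).
Variables (a : X -> R) (b : Y -> R) (K : X * Y -> R) (C : R).
Hypotheses (ia : m1.-integrable A (EFin \o a)) (ib : m2.-integrable B (EFin \o b)).
Hypotheses (mK : measurable_fun setT K) (KC : forall p, `|K p| <= C).

Let iaA : m1.-integrable setT (EFin \o (a \_ A)).
Proof. by rewrite -restrict_EFin -integrable_mkcond. Qed.

Let ibB : m2.-integrable setT (EFin \o (b \_ B)).
Proof. by rewrite -restrict_EFin -integrable_mkcond. Qed.

Let maA : measurable_fun setT (a \_ A).
Proof. by apply/measurable_EFinP; exact: measurable_int iaA. Qed.

Let mbB : measurable_fun setT (b \_ B).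
Proof. by apply/measurable_EFinP; exact: measurable_int ibB. Qed.

Let G (p : X * Y) : R := (a \_ A) p.1 * (b \_ B) p.2.

Let mG : measurable_fun setT G.
Proof.
by apply: measurable_funM;
  [exact: (measurableT_comp maA measurable_fst)|exact: (measurableT_comp mbB measurable_snd)].
Qed.

Let iG : (m1 \x m2)%E.-integrable setT (EFin \o G).
Proof.
apply/integrable12ltyP; first exact/measurable_EFinP.
have /integrableP[_] := ibB; set c := (\int[m2]_x _)%E => coo.
have c0 : (0 <= c)%E by exact: integral_ge0.
have /integrableP[ma' aoo] := iaA.
rewrite (_ : (fun x => _) = (fun x => `|(EFin \o (a \_ A)) x| * c)%E); last first.
  apply/funext => x; rewrite /c -ge0_integralZl//; last first.
    by apply: measurableT_comp => //; exact: measurable_int ibB.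
  by apply: eq_integral => y _; rewrite /= -EFinM normrM.
rewrite ge0_integralZr//; last exact: measurableT_comp.
by rewrite lte_mul_pinfty// ?integral_ge0// ge0_fin_numE// integral_ge0.
Qed.

Let F (p : X * Y) : R := G p * K p.

Let iF : (m1 \x m2)%E.-integrable setT (EFin \o F).
Proof. exact: (integrableM_bounded (C := C)). Qed.

Let innerY x : \int[m2]_(y in B) (b y * K (x, y)) = \int[m2]_y ((b \_ B) y * K (x, y)).
Proof.
rewrite Rintegral_mkcond; apply: eq_Rintegral => y _.
by rewrite !patchE; case: ifPn; rewrite ?mul0r.
Qed.

Let innerX y : \int[m1]_(x in A) (a x * K (x, y)) = \int[m1]_x ((a \_ A) x * K (x, y)).
Proof.
rewrite Rintegral_mkcond; apply: eq_Rintegral => x _.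
by rewrite !patchE; case: ifPn; rewrite ?mul0r.
Qed.

Let ibK x : m2.-integrable setT (EFin \o (fun y => (b \_ B) y * K (x, y))).
Proof.
apply: (integrableM_bounded (C := C)) => //.
exact: (measurableT_comp mK (pair1_measurable x)).
Qed.

Let iaK y : m1.-integrable setT (EFin \o (fun x => (a \_ A) x * K (x, y))).
Proof.
apply: (integrableM_bounded (C := C)) => //.
exact: (measurableT_comp mK (pair2_measurable y)).
Qed.

Let FxE x : (\int[m2]_y (F (x, y))%:E)%E = ((a \_ A) x * \int[m2]_(y in B) (b y * K (x, y)))%:E.
Proof.
rewrite innerY -RintegralZl// /Rintegral fineK; last first.
  apply: integrable_fin_num => //; exact: (integrableZlR _ measurableT (ibK x)).
by apply: eq_integral => y _; rewrite /F /G/= mulrA.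
Qed.

Let FyE y : (\int[m1]_x (F (x, y))%:E)%E = ((b \_ B) y * \int[m1]_(x in A) (a x * K (x, y)))%:E.
Proof.
rewrite innerX -RintegralZl// /Rintegral fineK; last first.
  apply: integrable_fin_num => //; exact: (integrableZlR _ measurableT (iaK y)).
by apply: eq_integral => x _; rewrite /F /G/= -mulrA mulrCA.
Qed.

(** [a(x) b(y)] is integrable on the product and a bounded [K] preserves this. In most later uses
    one weight is a locally integrable function on a ball and [K] is a mollifier or a truncated sign
    at a sum or difference of the variables. *)
Lemma weighted_fubini :
  \int[m1]_(x in A) (a x * \int[m2]_(y in B) (b y * K (x, y))) =
  \int[m2]_(y in B) (b y * \int[m1]_(x in A) (a x * K (x, y))).
Proof.
rewrite [LHS]Rintegral_mkcond [RHS]Rintegral_mkcond.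
have := Fubini iF => /(congr1 fine).
under [in X in X -> _]eq_integral do rewrite FxE.
under [in X in _ = X -> _]eq_integral do rewrite FyE.
move=> h; transitivity (\int[m1]_x ((a \_ A) x * \int[m2]_(y in B) (b y * K (x, y)))).
  by apply: eq_Rintegral => x _; rewrite !patchE; case: ifPn; rewrite ?mul0r.
rewrite [LHS]h; apply: eq_Rintegral => y _.
by rewrite !patchE; case: ifPn; rewrite ?mul0r.
Qed.

Lemma integrable_weighted_inner :
  m1.-integrable A (EFin \o (fun x => a x * \int[m2]_(y in B) (b y * K (x, y)))).
Proof.
rewrite integrable_mkcond// restrict_EFin.
have := integrable_fubini_F iF; apply: eq_integrable => // x _.
rewrite /fubini_F FxE /= !patchE; case: ifPn; rewrite ?mul0r//.
Qed.

End weighted_fubini.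

(** * The Euclidean structure *)

(** The functions differentiated through this criterion are piecewise polynomial or integrals of
    such, and an explicit second-order remainder is at hand for each of them. *)
Lemma is_derive_quadratic (R : realType) (V W : normedModType R) (f : V -> W)
    (x v : V) (l : W) (C : R) :
  (forall t : R, `|f (t *: v + x) - f x - t *: l| <= C * t ^+ 2) ->
  is_derive x v f l.
Proof.
move=> fC.
have h : ((fun h : R => h^-1 *: ((f \o shift x) (h *: v) - f x)) @ 0^') --> l.
  have C1 : 0 < `|C| + 1 by rewrite ltr_wpDl.
  apply/cvgrPdist_le => e e0; have eC := divr_gt0 e0 C1; near=> t.
  have t0 : t != 0 by near: t; exact: nbhs_dnbhs_neq.
  rewrite distrC -[X in _ - X](scale1r l) -(mulVf t0) -scalerA -scalerBr normrZ normfV.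
  rewrite ler_pdivrMl ?normr_gt0// (le_trans (fC t))//.
  rewrite -real_normK ?num_real// expr2 mulrA mulrC ler_wpM2l//.
  apply: (@le_trans _ _ ((`|C| + 1) * `|t|)).
    by rewrite ler_wpM2r// (le_trans (ler_norm _))// lerDl.
  rewrite -ler_pdivlMl// mulrC; apply: ltW.
  by near: t; apply: dnbhs0_lt.
by apply: DeriveDef; [apply/cvg_ex; exists l|exact: cvg_lim].
Unshelve. all: by end_near. Qed.

(** * Calculus on an interval *)

Section one_dimensional.
Context {R : realType}.
Local Notation lam := (@lebesgue_measure R).

Lemma FTC_everywhere (F f : R -> R) (a b : R) : a < b -> continuous f ->
  (forall x : R, is_derive (x : R^o) (1 : R^o) (F : R -> R^o) (f x)) ->
  \int[lam]_(x in `[a, b]) f x = F b - F a.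
Proof.
move=> ab cf dF; rewrite /Rintegral.
have cF : continuous F.
  by move=> x; apply: differentiable_continuous; apply/derivable1_diffP; have [] := dF x.
rewrite (@continuous_FTC2 _ f F)//.
- exact: continuous_subspaceT.
- split.
  + by move=> x _; have [] := dF x.
  + by apply: cvg_at_right_filter; exact: cF.
  + by apply: cvg_at_left_filter; exact: cF.
- by move=> x _; rewrite derive1E; apply: derive_val.
Qed.

Lemma lebesgue_measure_itvoo (h : R) : 0 < h -> lam `]- h, h[%classic = (2 * h)%:E.
Proof.
move=> h0; rewrite lebesgue_measure_itv/= lte_fin (_ : - h < h); last lra.
by rewrite -EFinD; congr EFin; ring.
Qed.

Lemma integrable_continuous_itvoo (h : R) (f : R -> R) : continuous f ->
  lam.-integrable `]- h, h[ (EFin \o f).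
Proof.
move=> cf.
apply: (@integrableS _ _ _ lam `[- h, h]%classic) => //.
  by apply: subset_itvW.
apply: continuous_compact_integrable; first exact: segment_compact.
exact: continuous_subspaceT.
Qed.

Lemma FTC_itvoo (F f : R -> R) (h : R) : 0 < h -> continuous f ->
  (forall x : R, is_derive (x : R^o) (1 : R^o) (F : R -> R^o) (f x)) ->
  \int[lam]_(x in `]- h, h[) f x = F h - F (- h).
Proof.
move=> h0 cf dF; rewrite -(FTC_everywhere _ cf dF); last lra.
rewrite Rintegral_itv_obnd_cbnd; last exact: integrable_continuous_itvoo.
rewrite Rintegral_itv_bndo_bndc//.
have := @integrable_continuous_itvoo (h + 1) f cf.
apply: integrableS => //; apply: subset_itv; rewrite bnd_simp; lra.
Qed.

Lemma is_derive_mul_norm (x : R) : is_derive (x : R^o) (1 : R^o) (fun y : R => y * `|y| : R^o) (2 * `|x|).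
Proof.
apply: (@is_derive_quadratic _ _ _ _ _ _ _ 1) => t; rewrite /GRing.scale/= mulr1 mul1r (addrC t x).
have [x0|x0] := leP 0 x; have [y0|y0] := leP 0 (x + t);
  rewrite ?(ger0_norm x0) ?(ger0_norm y0) ?(ltr0_norm x0) ?(ltr0_norm y0) ler_norml; apply/andP; split; nra.
Qed.

End one_dimensional.

Section dot_theory.
Context {R : realType} {n : nat}.
Implicit Types x y z : 'rV[R]_n.

Lemma dotC x y : dot x y = dot y x.
Proof. by apply: eq_bigr => i _; rewrite mulrC. Qed.

Lemma dotDl x y z : dot (x + y) z = dot x z + dot y z.
Proof. by rewrite /dot -big_split/=; apply: eq_bigr => i _; rewrite mxE mulrDl. Qed.

Lemma dotDr x y z : dot x (y + z) = dot x y + dot x z.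
Proof. by rewrite dotC dotDl !(dotC x). Qed.

Lemma dotZl c x y : dot (c *: x) y = c * dot x y.
Proof. by rewrite /dot mulr_sumr; apply: eq_bigr => i _; rewrite mxE mulrA. Qed.

Lemma dotZr c x y : dot x (c *: y) = c * dot x y.
Proof. by rewrite dotC dotZl dotC. Qed.

Lemma dotNl x y : dot (- x) y = - dot x y.
Proof. by rewrite -scaleN1r dotZl mulN1r. Qed.

Lemma dotNr x y : dot x (- y) = - dot x y.
Proof. by rewrite dotC dotNl dotC. Qed.

Lemma dotBl x y z : dot (x - y) z = dot x z - dot y z.
Proof. by rewrite dotDl dotNl. Qed.

Lemma dotBr x y z : dot x (y - z) = dot x y - dot x z.
Proof. by rewrite dotDr dotNr. Qed.

Lemma dot0l x : dot 0 x = 0.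
Proof. by rewrite -(scale0r 0) dotZl mul0r. Qed.

Lemma dot0r x : dot x 0 = 0. Proof. by rewrite dotC dot0l. Qed.

Lemma dot_ge0 x : 0 <= dot x x.
Proof. by apply: sumr_ge0 => i _; rewrite -expr2 sqr_ge0. Qed.

Lemma enormE x : enorm x = Num.sqrt (dot x x).
Proof. by rewrite /enorm; congr Num.sqrt; apply: eq_bigr => i _; rewrite expr2. Qed.

Lemma enorm_ge0 x : 0 <= enorm x. Proof. by rewrite sqrtr_ge0. Qed.

Lemma sqr_enorm x : enorm x ^+ 2 = dot x x.
Proof. by rewrite enormE sqr_sqrtr// dot_ge0. Qed.

Lemma dot_eq0 x : (dot x x == 0) = (x == 0).
Proof.
apply/idP/eqP => [|->]; last by rewrite dot0l.
rewrite /dot psumr_eq0 => [/allP h|i _]; last by rewrite -expr2 sqr_ge0.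
apply/rowP => i; rewrite mxE; have := h i (mem_index_enum _).
by rewrite /= mulf_eq0 orbb => /eqP.
Qed.

Lemma enorm_eq0 x : (enorm x == 0) = (x == 0).
Proof. by rewrite enormE sqrtr_eq0 le_eqVlt ltNge dot_ge0 orbF dot_eq0. Qed.

Lemma sqr_dot_le x y : dot x y ^+ 2 <= dot x x * dot y y.
Proof.
have [->|y0] := eqVneq y 0; first by rewrite !dot0r expr0n/= mulr0.
have dy : 0 < dot y y by rewrite lt_neqAle eq_sym dot_eq0 y0 dot_ge0.
have := dot_ge0 (dot y y *: x - dot x y *: y).
rewrite !(dotBl, dotBr, dotZl, dotZr) (dotC y x) => h; nra.
Qed.

Lemma normr_dot_le x y : `|dot x y| <= enorm x * enorm y.
Proof.
rewrite -(@ler_pXn2r _ 2)// ?nnegrE ?mulr_ge0 ?enorm_ge0//.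
by rewrite exprMn !sqr_enorm real_normK ?num_real// sqr_dot_le.
Qed.

Lemma enormZ c x : enorm (c *: x) = `|c| * enorm x.
Proof. by rewrite !enormE dotZl dotZr mulrA -expr2 sqrtrM ?sqr_ge0// sqrtr_sqr. Qed.

Lemma enormN x : enorm (- x) = enorm x.
Proof. by rewrite -scaleN1r enormZ normrN1 mul1r. Qed.

Lemma enormD x y : enorm (x + y) <= enorm x + enorm y.
Proof.
rewrite -(@ler_pXn2r _ 2)// ?nnegrE ?addr_ge0 ?enorm_ge0//.
rewrite sqrrD !sqr_enorm !(dotDl, dotDr) (dotC y x).
have := le_trans (ler_norm _) (normr_dot_le x y); lra.
Qed.

Lemma enorm_orth x (O : 'M[R]_n) : O *m O^T = 1%:M -> enorm (x *m O) = enorm x.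
Proof. by move=> OO; rewrite !enormE dot_orth. Qed.

Lemma coord_le_enorm x i : `|x ord0 i| <= enorm x.
Proof.
rewrite -(@ler_pXn2r _ 2)// ?nnegrE ?enorm_ge0// real_normK ?num_real//.
rewrite sqr_enorm /dot (bigD1 i)//= expr2 lerDl sumr_ge0// => j _.
by rewrite -expr2 sqr_ge0.
Qed.

Lemma norm_le_enorm x : `|x| <= enorm x.
Proof. by rewrite rV_normP ?enorm_ge0//; apply/forallP => i; exact: coord_le_enorm. Qed.

(** Matrices carry the sup norm, so compactness and differentiability refer to it, while the
    variation is Euclidean. The factor [n] in place of its square root is harmless, since it enters
    error terms only. *)
Lemma enorm_le_norm x : enorm x <= n%:R * `|x|.
Proof.
rewrite -(@ler_pXn2r _ 2)// ?nnegrE ?enorm_ge0 ?mulr_ge0//.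
rewrite sqr_enorm exprMn (@le_trans _ _ (\sum_(i < n) `|x| ^+ 2))//.
  apply: ler_sum => i _; rewrite -expr2 -real_normK ?num_real//.
  by rewrite ler_pXn2r ?nnegrE// rV_norm_coord.
rewrite sumr_const card_ord -[leLHS]mulr_natl ler_wpM2r ?sqr_ge0//.
by rewrite -natrX ler_nat -{1}(expn1 n); case: (n) => // m; rewrite leq_pexp2l.
Qed.

End dot_theory.

Lemma measurable_patch d (T : measurableType d) (R : realType) (D : set T) (f : T -> R) :
  measurable D -> measurable_fun D f -> measurable_fun setT (f \_ D).
Proof. by move=> mD mf; apply: (proj1 (measurable_restrictT _ mD)). Qed.

(** * A reflection inequality on an interval *)

Section reflection.
Context {R : realType}.
Local Notation lam := (@lebesgue_measure R).

Lemma measurable_reflection (c : R) :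
  measurable_fun setT (fun t : measurableTypeR R => (c - t : measurableTypeR R)).
Proof. exact: (@measurable_funB _ _ _ _ (cst c) id). Qed.

Lemma lebesgue_measure_reflection (c : R) (A : set R) : measurable A ->
  lam [set t | A (c - t)] = lam A.
Proof.
move=> mA; apply/esym.
pose M := measure_function_pushforward__canonical__measure_function_Measure lam (measurable_reflection c).
rewrite -[RHS]/(M A).
apply: (lebesgue_measure_unique (mu := M)) => // _ [[a b] _ <-] /=.
rewrite /M/= /pushforward.
rewrite (_ : _ @^-1` _ = `[(c - b), (c - a)[%classic).
  rewrite !lebesgue_measure_itv/= !lte_fin ltrD2l ltrN2.
  by case: ifP => // _; rewrite -!EFinD; congr EFin; ring.
by apply/seteqP; split => x /=; rewrite !in_itv/= => /andP[? ?]; apply/andP; split; lra.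
Qed.

(* Reflecting in the zero of A + b t pairs each point of negativity with a point
   of positivity that lies closer to the centre of the interval. *)
Lemma Rintegral_odd_shift_ge0 (q : R -> R) (A b h : R) : 0 < h -> 0 <= A ->
  (forall x, q (- x) = - q x) -> (forall x, 0 <= x -> 0 <= q x) ->
  lam.-integrable `]- h, h[ (EFin \o (fun t => q (A + b * t))) ->
  0 <= \int[lam]_(t in `]- h, h[) q (A + b * t).
Proof.
move=> h0 A0 qN q0 qi.
have [->|b0] := eqVneq b 0.
  by apply: Rintegral_ge0 => t _; rewrite mul0r addr0 q0.
pose t0 := - A / b; pose r t := q (A + b * t).
pose I : set R := `]- h, h[%classic.
pose r1 := r \_ I.
have ir1 : lam.-integrable setT (EFin \o r1).
  by rewrite /r1 -restrict_EFin -integrable_mkcond//; exact: measurable_itv.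
have mr1 : measurable_fun setT r1 by apply/measurable_EFinP; exact: measurable_int ir1.
rewrite Rintegral_mkcond -/I -/r -/r1.
have ir2 : lam.-integrable setT (EFin \o (r1 \o (fun t => 2 * t0 - t))).
  have := integrable_preserving (measurable_reflection (2 * t0)) (lebesgue_measure_reflection (2 * t0)) measurableT ir1.
  by rewrite preimage_setT.
have e2 : \int[lam]_t r1 (2 * t0 - t) = \int[lam]_t r1 t.
  rewrite -[RHS](Rintegral_preserving (measurable_reflection (2 * t0)) (lebesgue_measure_reflection (2 * t0)) measurableT mr1).
  by rewrite preimage_setT.
(* The reflection preserves the integral, so twice the integral is that of the symmetrised function,
   which turns out to be nonnegative pointwise. *)
suff : 0 <= \int[lam]_t (r1 t + r1 (2 * t0 - t)).
  by rewrite RintegralD// e2 -mulr2n pmulrn_lge0.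
apply: Rintegral_ge0 => t _.
have rphi : r (2 * t0 - t) = - r t.
  by rewrite /r -qN; congr q; rewrite /t0; field.
have At : A + b * t = b * (t - t0) by rewrite /t0; field.
have inI s : (s \in I) = (s ^+ 2 < h ^+ 2).
  rewrite (_ : s \in I = (`|s| < h)); last first.
    by apply/idP/idP; rewrite inE /I/= in_itv/= ltr_norml.
  by rewrite -[LHS](@ltr_pXn2r _ 2)// ?nnegrE// ?ltW// real_normK ?num_real.
(* As [A >= 0], this says that a point with positive argument is at least as close to the origin as
   its reflection. Hence the interval can contain a negative point only together with its positive
   partner. *)
have key : b ^+ 2 * ((2 * t0 - t) ^+ 2 - t ^+ 2) = 4 * A * (A + b * t).
  by rewrite /t0; field.
have b2 : 0 < b ^+ 2 by rewrite exprn_even_gt0.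
rewrite /r1 !patchE !inI rphi; case: ifPn => h1; case: ifPn => h2.
- by rewrite subrr.
- rewrite addr0; apply: q0.
  have [//|At0] := leP 0 (A + b * t).
  exfalso; move: h2; rewrite -leNgt => h2; nra.
- rewrite add0r -qN; apply: q0; rewrite oppr_ge0.
  have [//|At0] := leP (A + b * t) 0.
  exfalso; move: h1; rewrite -leNgt => h1; nra.
- by rewrite addr0.
Qed.

End reflection.

(** Described by its half-side and centred at 0, so that [v -> - v] preserves it and odd integrals
    vanish. For the cubes of [Kfun], [h] is [eps / 2]. *)
Definition ucube {R : realType} n (h : R) : set 'rV[R]_n :=
  [set v | forall i, - h < v ord0 i < h].
Arguments ucube {R} n h.

(** * Centred cubes and iterated integrals *)

Section centred_cubes.
Context {R : realType}.
Local Notation lam := (@lebesgue_measure R).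

Lemma ucubeE n (h : R) : ucube n h = [set v | forall i, `]- h, h[%classic (v ord0 i)].
Proof. by apply/seteqP; split => v /= H i; have := H i; rewrite in_itv. Qed.

Lemma measurable_ucube n (h : R) : measurable (ucube n h).
Proof. by rewrite ucubeE; exact: (@measurable_rV_box R n (fun=> `]- h, h[%classic)). Qed.

Lemma lebesgue_ucube n (h : R) : 0 < h -> lebesgue_rV R n (ucube n h) = ((2 * h) ^+ n)%:E.
Proof.
by move=> h0; rewrite ucubeE (lebesgue_rV_pow _ (r := 2 * h))// lebesgue_measure_itvoo.
Qed.

Lemma lebesgue_ucube_lty n (h : R) : 0 < h -> (lebesgue_rV R n (ucube n h) < +oo)%E.
Proof. by move=> h0; rewrite lebesgue_ucube// ltry. Qed.

Lemma ucube_norm n (h : R) v : 0 <= h -> ucube n h v -> `|v| <= h.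
Proof.
move=> h0 uv; rewrite rV_normP//; apply/forallP => i.
by rewrite ler_norml; have /andP[/ltW -> /ltW ->] := uv i.
Qed.

Lemma ucubeN n (h : R) v : ucube n h (- v) <-> ucube n h v.
Proof. by split => H i; have := H i; rewrite mxE => /andP[? ?]; apply/andP; split; lra. Qed.

Lemma dot_cons n (a : 'rV[R]_n.+1) t (v : 'rV[R]_n) :
  dot a (rV_cons (t, v)) = a ord0 ord0 * t + dot (rV_behead a) v.
Proof.
rewrite /dot big_ord_recl rV_cons0; congr (_ + _); apply: eq_bigr => i _.
by rewrite rV_consS mxE.
Qed.

Lemma ucube_cons n (h : R) t (v : 'rV[R]_n) :
  ucube n.+1 h (rV_cons (t, v)) <-> (`]- h, h[%classic t /\ ucube n h v).
Proof.
split => [H|[Ht Hv] i].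
  split; first by have := H ord0; rewrite rV_cons0 /= in_itv.
  by move=> i; have := H (lift ord0 i); rewrite rV_consS.
case: (unliftP ord0 i) => [j ->|->]; first by rewrite rV_consS.
by rewrite rV_cons0; move: Ht; rewrite /= in_itv.
Qed.

Section iterated.
Variables (n : nat) (h : R) (f : 'rV[R]_n.+1 -> R) (C : R).
Hypotheses (h0 : 0 < h) (mf : measurable_fun setT f).
Hypothesis fC : forall v, ucube n.+1 h v -> `|f v| <= C.
Local Notation I := (`]- h, h[%classic : set R).
Local Notation U := (ucube n h).

Let K (p : measurableTypeR R * 'rV[R]_n) : R := (f \_ (ucube n.+1 h)) (rV_cons p).

Let mK : measurable_fun setT K.
Proof.
apply: (measurableT_comp _ (@measurable_rV_cons R n)).
by apply: measurable_patch; [exact: measurable_ucube|exact: measurable_funTS].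
Qed.

Let KC p : `|K p| <= `|C|.
Proof.
rewrite /K patchE; case: ifPn => [|_]; last by rewrite normr0.
by rewrite inE => /fC H; rewrite (le_trans H)// ler_norm.
Qed.

Let KE t v : I t -> U v -> K (t, v) = f (rV_cons (t, v)).
Proof. by move=> It Uv; rewrite /K patchE mem_set//; apply/ucube_cons. Qed.

Let mI : measurable (I : set (measurableTypeR R)). Proof. exact: measurable_itv. Qed.

Let i1 : lam.-integrable I (EFin \o (cst 1)).
Proof.
by apply: (@bounded_integrable _ _ _ _ _ _ 1) => //= [|x _];
  [rewrite lebesgue_measure_itvoo// ltry|rewrite normr1].
Qed.

Let i2 : (lebesgue_rV R n).-integrable U (EFin \o (cst 1)).
Proof.
apply: (@bounded_integrable _ _ _ _ _ _ 1) => //= [||x _]; last by rewrite normr1.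
  exact: measurable_ucube.
exact: lebesgue_ucube_lty.
Qed.

Let inner t : \int[lebesgue_rV R n]_(v in U) (1 * K (t, v)) = \int[lebesgue_rV R n]_v K (t, v).
Proof.
rewrite Rintegral_mkcond; apply: eq_Rintegral => v _; rewrite patchE mul1r.
case: ifPn => //; rewrite notin_setE => Uv; rewrite /K patchE memNset//.
by move/ucube_cons => [].
Qed.

Lemma integrable_ucube_inner :
  lam.-integrable I (EFin \o (fun t => \int[lebesgue_rV R n]_(v in U) f (rV_cons (t, v)))).
Proof.
have := integrable_weighted_inner mI (measurable_ucube h) i1 i2 mK KC.
apply: eq_integrable => // t /[!inE] It /=; rewrite mul1r; congr EFin.
by apply: eq_Rintegral => v /[!inE] Uv; rewrite mul1r KE.
Qed.

(** The measure in dimension [n.+1] is the image of a product under [rV_cons]; peeling off the first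
    coordinate in this way drives the inductions on the dimension below. *)
Lemma Rintegral_ucube :
  \int[lebesgue_rV R n.+1]_(v in ucube n.+1 h) f v =
  \int[lam]_(t in I) \int[lebesgue_rV R n]_(v in U) f (rV_cons (t, v)).
Proof.
have pI : @rV_cons R n @^-1` (ucube n.+1 h) = I `*` U.
  by apply/seteqP; split => -[t v] /= /ucube_cons.
have mIU : measurable ((I : set (measurableTypeR R)) `*` U) by apply: measurableX => //; exact: measurable_ucube.
have IUoo : ((lam \x lebesgue_rV R n) (I `*` U) < +oo)%E.
  rewrite product_measure1E//; last exact: measurable_ucube.
  by rewrite lebesgue_ucube//= lebesgue_measure_itvoo// -EFinM ltry.
have iK : (lam \x lebesgue_rV R n)%E.-integrable setT (EFin \o K).
  have -> : K = ((f \o @rV_cons R n) \_ (I `*` U)).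
    by apply/funext => p; rewrite /K !patchE -pI.
  rewrite -restrict_EFin -integrable_mkcond//.
  apply: (@bounded_integrable _ _ _ _ _ _ C) => //.
    by apply: measurable_funTS; exact: (measurableT_comp mf (@measurable_rV_cons R n)).
  by move=> p; rewrite -pI => /fC.
transitivity (fine (\int[lam \x lebesgue_rV R n]_p (K p)%:E)).
  rewrite /Rintegral; congr fine.
  rewrite integral_mkcond restrict_EFin.
  rewrite (integral_pushforward (@measurable_rV_cons R n))//.
    apply/measurable_EFinP.
    by apply: measurable_patch; [exact: measurable_ucube|exact: measurable_funTS].
rewrite -integral12_prod_meas1// /fubini_F.
rewrite [RHS]Rintegral_mkcond; congr fine; apply: eq_integral => t _.
have iKt : (lebesgue_rV R n).-integrable setT (EFin \o (fun v => K (t, v))).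
  have -> : (fun v => K (t, v)) = (fun v => K (t, v)) \_ U.
    apply/funext => v; rewrite patchE; case: ifPn => //; rewrite notin_setE => Uv.
    by rewrite /K patchE memNset//; move/ucube_cons => [].
  rewrite -restrict_EFin -integrable_mkcond; last exact: measurable_ucube.
  apply: (@bounded_integrable _ _ _ _ _ _ `|C|) => //.
  - exact: measurable_ucube.
  - exact: lebesgue_ucube_lty.
  - by apply: measurable_funTS; exact: (measurableT_comp mK (pair1_measurable t)).
rewrite -[LHS]fineK; last exact: integrable_fin_num.
congr EFin; rewrite -/(Rintegral _ _ _) -inner patchE; case: ifPn => [/[!inE] It|].
  by apply: eq_Rintegral => v /[!inE] Uv; rewrite mul1r KE.
rewrite notin_setE => It; rewrite (_ : (fun v => _) = cst 0) ?Rintegral_cst ?mul0r//.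
  exact: measurable_ucube.
by apply/funext => v; rewrite mul1r /K patchE memNset//; move/ucube_cons => [].
Qed.

Lemma Rintegral_ucube_swap :
  \int[lebesgue_rV R n.+1]_(v in ucube n.+1 h) f v =
  \int[lebesgue_rV R n]_(v in U) \int[lam]_(t in I) f (rV_cons (t, v)).
Proof.
rewrite Rintegral_ucube.
have := weighted_fubini mI (measurable_ucube h) i1 i2 mK KC.
set L := (X in X = _); set L' := (X in _ = X).
have -> : L = \int[lam]_(t in I) \int[lebesgue_rV R n]_(v in U) f (rV_cons (t, v)).
  apply: eq_Rintegral => t /[!inE] It; rewrite mul1r.
  by apply: eq_Rintegral => v /[!inE] Uv; rewrite mul1r KE.
move=> ->; apply: eq_Rintegral => v /[!inE] Uv; rewrite mul1r.
by apply: eq_Rintegral => t /[!inE] It; rewrite mul1r KE.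
Qed.

End iterated.

End centred_cubes.

(** * Oriented cubes *)

Lemma continuous_compose (T U W : topologicalType) (f : T -> U) (g : U -> W) :
  continuous f -> continuous g -> continuous (fun x => g (f x)).
Proof. by move=> cf cg x; exact: (continuous_comp (cf x) (cg (f x))). Qed.

Section oriented_cubes.
Context {R : realType} {n : nat}.
Local Notation mu := (lebesgue_rV R n).
Local Notation V := ('rV[R]_n).
Implicit Types (z : V) (O : 'M[R]_n).

(** Inequalities in the rotated coordinates instead of an image: measurability, membership and
    translates become immediate. [cubeP] links this form to [cube]. *)
Definition ocube z O (h : R) : set V := [set x | ucube n h ((x - z) *m O^T)].

Definition affine z O (v : V) : V := z + v *m O.

Lemma measurable_affine z O : measurable_fun setT (affine z O).
Proof.
by apply: (@measurable_addrV2 R n _ _ (cst z)) => //; exact: measurable_mulmx.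
Qed.

Lemma affine_ocube z O h : O *m O^T = 1%:M -> affine z O @^-1` ocube z O h = ucube n h.
Proof.
by move=> OO; apply/seteqP; split => v; rewrite /= /ocube /affine /= (addrC z) addrK -mulmxA OO mulmx1.
Qed.

Lemma measurable_ocube z O h : measurable (ocube z O h).
Proof.
apply: (measurable_preimage (f := fun x : V => (x - z) *m O^T) (B := ucube n h)); last exact: measurable_ucube.
apply: (measurableT_comp (@measurable_mulmx R n O^T)); exact: measurable_addrV.
Qed.

Lemma lebesgue_ocube z O h : O *m O^T = 1%:M -> 0 < h -> mu (ocube z O h) = ((2 * h) ^+ n)%:E.
Proof.
move=> OO h0; rewrite -lebesgue_ucube// -(@affine_ocube z O h)//.
by rewrite -(lebesgue_rV_affine z OO (measurable_ocube z O h)).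
Qed.

Lemma Rintegral_ocube z O h (f : V -> R) : O *m O^T = 1%:M -> measurable_fun (ocube z O h) f ->
  \int[mu]_(x in ocube z O h) f x = \int[mu]_(v in ucube n h) f (z + v *m O).
Proof.
move=> OO mf.
rewrite -(Rintegral_preserving (measurable_affine z O)) ?affine_ocube//.
  by move=> A mA; exact: (lebesgue_rV_affine z OO mA).
exact: measurable_ocube.
Qed.

Lemma ocube_dist z O h x : O *m O^T = 1%:M -> 0 <= h -> ocube z O h x -> enorm (x - z) <= n%:R * h.
Proof.
move=> OO h0 /(ucube_norm h0) xh.
have OtO : O^T *m O^T^T = 1%:M by rewrite trmxK (mulmx1C OO).
by rewrite -(enorm_orth _ OtO) (le_trans (enorm_le_norm _))// ler_wpM2l.
Qed.

Lemma ocubeP z O h x : O *m O^T = 1%:M ->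
  ocube z O h x <-> exists2 v, ucube n h v & x = z + v *m O.
Proof.
move=> OO; split => [xz|[v uv ->]].
  exists ((x - z) *m O^T) => //.
  by rewrite -mulmxA (mulmx1C OO) mulmx1 addrC subrK.
by move: uv; rewrite -(@affine_ocube z O).
Qed.

Lemma cubeP (eps : R) (Q : set V) :
  cube eps Q <-> exists z O, O *m O^T = 1%:M /\ Q = ocube z O (eps / 2).
Proof.
(* [cube] is based at a corner and [ocube] at its centre; [s] is the vector from one to the other in
   the coordinates of the cube. *)
pose s : V := const_mx (eps / 2).
have su (v : V) : (forall i, 0 < v ord0 i < eps) <-> ucube n (eps / 2) (v - s).
  by split => H i; have := H i; rewrite !mxE => /andP[? ?]; apply/andP; split; lra.
split => [[w [ O [ OO ->]]]|[z [ O [ OO ->]]]].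
  exists (w + s *m O), O; split => //; apply/seteqP; split => x.
    move=> [u /= /su uu <-]; apply/(ocubeP _ _ _ OO); exists (u - s) => //.
    by rewrite mulmxBl addrA addrAC addrK.
  move=> /(ocubeP _ _ _ OO)[v uv ->]; exists (v + s) => /=.
    by apply/su; rewrite addrK.
  by rewrite mulmxDl addrA addrAC.
exists (z - s *m O), O; split => //; apply/seteqP; split => x.
  move=> /(ocubeP _ _ _ OO)[v uv ->]; exists (v + s) => /=.
    by apply/su; rewrite addrK.
  by rewrite mulmxDl (addrC (v *m O)) addrA subrK.
move=> [u /= /su uu <-]; apply/(ocubeP _ _ _ OO); exists (u - s) => //.
by rewrite mulmxBl (addrC (u *m O)) addrA.
Qed.

End oriented_cubes.

(** * Moments of a cube in an arbitrary direction *)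

Section cube_moments.
Context {R : realType}.
Local Notation lam := (@lebesgue_measure R).

Lemma continuous_dotl n (a : 'rV[R]_n) : continuous (dot a).
Proof.
move=> x; apply: (@continuous_dot R n _ (cst a) id) => y; [exact: cst_continuous|exact: cvg_id].
Qed.

Lemma measurable_comp_dot n (a : 'rV[R]_n) (g : R -> R) : continuous g ->
  measurable_fun setT (fun v => g (dot a v)).
Proof.
move=> cg; apply: (measurableT_comp (continuous_measurable_fun cg)).
apply: continuous_measurable_rV; exact: continuous_dotl.
Qed.

Lemma continuous_bounded_itv (g : R -> R) (M : R) : continuous g ->
  exists C, forall x, `|x| <= M -> `|g x| <= C.
Proof.
move=> cg; have [M0|M0] := leP 0 M; last first.
  by exists 0 => x xM; have := le_lt_trans xM M0; rewrite normr_lt0.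
have := @compact_bounded _ _ (g @` `[- M, M]%classic).
case.
  apply: continuous_compact; last exact: segment_compact.
  exact: continuous_subspaceT.
move=> C [_ hC]; exists (C + 1) => x xM; apply: hC; first by rewrite ltrDl.
by exists x => //=; rewrite in_itv/= -ler_norml.
Qed.

Lemma dot_ucube_bounded n (a v : 'rV[R]_n) h : 0 <= h -> ucube n h v ->
  `|dot a v| <= enorm a * (n%:R * h).
Proof.
move=> h0 /(ucube_norm h0) vh; rewrite (le_trans (normr_dot_le _ _))// ler_wpM2l ?enorm_ge0//.
by rewrite (le_trans (enorm_le_norm _))// ler_wpM2l.
Qed.

Lemma bounded_comp_dot n (a : 'rV[R]_n) (g : R -> R) h : 0 <= h -> continuous g ->
  exists C, forall v, ucube n h v -> `|g (dot a v)| <= C.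
Proof.
move=> h0 cg; have [C hC] := continuous_bounded_itv (enorm a * (n%:R * h)) cg.
by exists C => v uv; apply: hC; exact: dot_ucube_bounded.
Qed.

Lemma integrable_comp_dot n (a : 'rV[R]_n) (g : R -> R) h : 0 < h -> continuous g ->
  (lebesgue_rV R n).-integrable (ucube n h) (EFin \o (fun v => g (dot a v))).
Proof.
move=> h0 cg; have [C hC] := bounded_comp_dot a (ltW h0) cg.
apply: (bounded_integrable (C := C)) => //.
- exact: measurable_ucube.
- exact: lebesgue_ucube_lty.
- apply: measurable_funTS; exact: measurable_comp_dot.
Qed.

Lemma Rintegral_ucubeN n (h : R) (f : 'rV[R]_n -> R) : measurable_fun (ucube n h) f ->
  \int[lebesgue_rV R n]_(v in ucube n h) f (- v) = \int[lebesgue_rV R n]_(v in ucube n h) f v.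
Proof.
move=> mf; rewrite -[RHS](Rintegral_preserving (@measurable_opprV R n))//.
- by congr (Rintegral _ _ _); apply/seteqP; split => v /ucubeN.
- exact: lebesgue_rV_opp.
- exact: measurable_ucube.
Qed.

Variables (p : R -> R) (cp : continuous p).
Hypotheses (pN : forall x, p (- x) = - p x) (p0 : forall x, 0 <= x -> 0 <= p x).

Let cps (B : R) : continuous (fun x => p (B + x)).
Proof.
move=> x; apply: continuous_comp; last exact: cp.
by apply: cvgD; [exact: cvg_cst|exact: cvg_id].
Qed.

(** Induction on the dimension. Integrating out all coordinates but the first replaces [p] by [q],
    which is again odd, by the symmetry of the cube, and nonnegative on the positive half-line, by
    induction; the one-dimensional reflection inequality then applies to [q]. *)
Lemma Rintegral_odd_dot_ge0 n (h : R) (a : 'rV[R]_n) (A : R) : 0 < h -> 0 <= A ->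
  0 <= \int[lebesgue_rV R n]_(v in ucube n h) p (A + dot a v).
Proof.
elim: n a A => [|n IH] a A h0 A0.
  by apply: Rintegral_ge0 => v _; rewrite /dot big_ord0 addr0 p0.
have [C hC] := bounded_comp_dot a (ltW h0) (@cps A).
have mf := measurable_comp_dot a (@cps A).
rewrite (Rintegral_ucube h0 mf hC).
pose q B := \int[lebesgue_rV R n]_(v in ucube n h) p (B + dot (rV_behead a) v).
have qE t : \int[lebesgue_rV R n]_(v in ucube n h) p (A + dot a (rV_cons (t, v))) =
    q (A + a ord0 ord0 * t).
  by apply: eq_Rintegral => v _; rewrite dot_cons addrA.
under eq_Rintegral do rewrite qE.
apply: Rintegral_odd_shift_ge0 => //.
- move=> B; rewrite /q.
  rewrite -(Rintegral_ucubeN (f := fun v => p (- B + dot (rV_behead a) v))); last first.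
    by apply: measurable_funTS; exact: (measurable_comp_dot _ (@cps _)).
  rewrite -[RHS]mulN1r -RintegralZl; last 2 first.
  + exact: measurable_ucube.
  + exact: (integrable_comp_dot _ h0 (@cps _)).
  by apply: eq_Rintegral => v _; rewrite mulN1r -pN dotNr opprD.
- by move=> B B0; exact: IH.
- have := integrable_ucube_inner h0 mf hC; apply: eq_integrable.
    exact: measurable_itv.
  by move=> t _ /=; rewrite qE.
Qed.

End cube_moments.

Section cube_moments2.
Context {R : realType}.
Local Notation lam := (@lebesgue_measure R).

(** For [x >= 0], [p s x] is [x (x - s)^2]; it is odd and [g s] is its derivative.
    [g s x = (3|x| - s)(|x| - s)] changes sign, but for [s > 0] its mean over []-s, s[] is 0, which
    is the case of a direction along an edge. *)
Let p (s x : R) := x ^+ 3 - 2 * s * (x * `|x|) + s ^+ 2 * x.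
Let g (s x : R) := 3 * x ^+ 2 - 4 * s * `|x| + s ^+ 2.

Let continuous_sqr : continuous (fun x : R => x ^+ 2).
Proof. exact: exprn_continuous. Qed.

Let cid : continuous (@id R).
Proof. by move=> x; exact: cvg_id. Qed.

Let cp s : continuous (p s).
Proof.
move=> x; apply: cvgD.
  apply: cvgB; first exact: exprn_continuous.
  apply: cvgMr; apply: cvgM; [exact: cvg_id|exact: norm_continuous].
by apply: cvgMr; exact: cvg_id.
Qed.

Let cg s : continuous (g s).
Proof.
move=> x; apply: cvgD; last exact: cvg_cst.
by apply: cvgB; apply: cvgMr; [exact: exprn_continuous|exact: norm_continuous].
Qed.

Let pN s x : p s (- x) = - p s x.
Proof. rewrite /p normrN; ring. Qed.

Let p0 s x : 0 <= x -> 0 <= p s x.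
Proof.
move=> x0; rewrite /p ger0_norm//.
rewrite (_ : _ + _ = x * (x - s) ^+ 2); last by ring.
by rewrite mulr_ge0// sqr_ge0.
Qed.

Let dp s (y : R) : is_derive (y : R^o) (1 : R^o) (p s : R -> R^o) (g s y).
Proof.
have d := is_derive_mul_norm y.
rewrite (_ : p s = ((id : R -> R^o) ^+ 3 - (2 * s) \*: (fun y : R => y * `|y| : R^o) +
    (s ^+ 2) \*: (id : R -> R^o))); last by apply/funext.
apply: is_derive_eq; rewrite /g /GRing.scale/=; ring.
Qed.

Let dpb s (b c t : R) : b != 0 ->
  is_derive (t : R^o) (1 : R^o) (fun t => b^-1 * p s (c + b * t) : R^o) (g s (c + b * t)).
Proof.
move=> b0.
have d1 : is_derive (t : R^o) (1 : R^o) (fun t => c + b * t : R^o) b.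
  rewrite (_ : (fun t => c + b * t : R^o) = (cst c + b \*: (id : R -> R^o))); last by apply/funext.
  by apply: is_derive_eq; rewrite add0r /GRing.scale/= mulr1.
have d2 := @is_derive1_comp R (p s) (fun t => c + b * t) t _ _ (dp s (c + b * t)) d1.
rewrite (_ : (fun t => _) = (b^-1 \*: (p s \o (fun t => c + b * t : R^o)))); last by apply/funext.
by apply: is_derive_eq; rewrite /GRing.scale/=; field.
Qed.

Let cgb s (b c : R) : continuous (fun t => g s (c + b * t)).
Proof.
apply: (continuous_compose (f := fun t => c + b * t) (g := g s)); last exact: cg.
by move=> t; apply: cvgD; [exact: cvg_cst|apply: cvgMr; exact: cvg_id].
Qed.

Let int_g s (b c h : R) : 0 < h -> b != 0 ->
  \int[lam]_(t in `]- h, h[) g s (c + b * t) = b^-1 * (p s (b * h + c) + p s (b * h + - c)).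
Proof.
move=> h0 b0.
rewrite (FTC_itvoo h0 (@cgb s b c) (fun x => dpb s c x b0)).
rewrite -mulrBr; congr (_ * _); rewrite [b * h + c]addrC; congr (_ + _).
by rewrite -pN; congr (p s _); ring.
Qed.

Let int_dot0 n (h : R) (a : 'rV[R]_n) : 0 < h ->
  \int[lebesgue_rV R n]_(v in ucube n h) dot a v = 0.
Proof.
move=> h0.
have mf : measurable_fun (ucube n h) (dot a).
  by apply: measurable_funTS; exact: (measurable_comp_dot a cid).
have := Rintegral_ucubeN mf; under eq_Rintegral do rewrite dotNr -mulN1r.
rewrite RintegralZl; last 2 first.
- exact: measurable_ucube.
- exact: (integrable_comp_dot a h0 cid).
by move: (Rintegral _ _ _) => J; lra.
Qed.

Let icst n (h c : R) : 0 < h -> (lebesgue_rV R n).-integrable (ucube n h) (EFin \o cst c).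
Proof.
move=> h0; apply: (@bounded_integrable _ _ _ _ _ _ `|c|) => //.
- exact: measurable_ucube.
- exact: lebesgue_ucube_lty.
Qed.

Lemma Rintegral_ucube_cst n (h c : R) : 0 < h ->
  \int[lebesgue_rV R n]_(v in ucube n h) c = (2 * h) ^+ n * c.
Proof.
move=> h0; rewrite Rintegral_cst; last exact: measurable_ucube.
by rewrite mulrC; congr (_ * _); rewrite /= lebesgue_ucube.
Qed.

(** The second moment is isotropic: the cross terms vanish by symmetry and each coordinate has
    variance [h ^+ 2 / 3]. *)
Lemma Rintegral_sqr_dot n (h : R) (a : 'rV[R]_n) : 0 < h ->
  \int[lebesgue_rV R n]_(v in ucube n h) (dot a v ^+ 2) = (2 * h) ^+ n * (h ^+ 2 / 3) * dot a a.
Proof.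
move=> h0; elim: n a => [|n IH] a.
  rewrite [dot a a]/dot big_ord0 mulr0.
  rewrite (_ : (fun v => _) = cst 0) ?Rintegral_cst ?mul0r//; first exact: measurable_ucube.
  by apply/funext => v; rewrite /dot big_ord0 expr0n.
have [C hC] := bounded_comp_dot a (ltW h0) continuous_sqr.
rewrite (Rintegral_ucube h0 (measurable_comp_dot a continuous_sqr) hC).
set a0 := a ord0 ord0; set a' := rV_behead a.
have inE' t : \int[lebesgue_rV R n]_(v in ucube n h) (dot a (rV_cons (t, v)) ^+ 2) =
    (2 * h) ^+ n * (a0 ^+ 2 * t ^+ 2 + h ^+ 2 / 3 * dot a' a').
  under eq_Rintegral do rewrite dot_cons sqrrD -/a0 -/a' -mulr_natl mulrA.
  have mU := @measurable_ucube R n h.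
  have i1 := integrable_comp_dot a' h0 cid.
  rewrite RintegralD//; last 2 first.
  - by apply: integrableDR => //; [exact: icst|exact: integrableZlR].
  - exact: (integrable_comp_dot a' h0 continuous_sqr).
  rewrite RintegralD//; [|exact: icst|exact: integrableZlR].
  rewrite Rintegral_ucube_cst// RintegralZl// int_dot0// IH; ring.
under eq_Rintegral do rewrite inE'.
have c2 : continuous (fun t : R => (2 * h) ^+ n * (a0 ^+ 2 * t ^+ 2 + h ^+ 2 / 3 * dot a' a')).
  move=> t; apply: cvgMr; apply: cvgD; last exact: cvg_cst.
  by apply: cvgMr; exact: exprn_continuous.
have dF (x : R) : is_derive (x : R^o) (1 : R^o)
    (fun t => (2 * h) ^+ n * (a0 ^+ 2 * (t ^+ 3 / 3) + h ^+ 2 / 3 * dot a' a' * t) : R^o)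
    ((2 * h) ^+ n * (a0 ^+ 2 * x ^+ 2 + h ^+ 2 / 3 * dot a' a')).
  rewrite (_ : (fun t => _) = ((2 * h) ^+ n * a0 ^+ 2 / 3) \*: ((id : R -> R^o) ^+ 3) +
    ((2 * h) ^+ n * (h ^+ 2 / 3 * dot a' a')) \*: (id : R -> R^o)); last first.
    apply/funext => t; transitivity ((2 * h) ^+ n * a0 ^+ 2 / 3 * t ^+ 3 +
      (2 * h) ^+ n * (h ^+ 2 / 3 * dot a' a') * t) => //; by field.
  by apply: is_derive_eq; rewrite /GRing.scale/=; field.
rewrite (FTC_itvoo h0 c2 dF).
have -> : dot a a = a0 ^+ 2 + dot a' a'.
  rewrite [LHS]/dot big_ord_recl -expr2; congr (_ + _).
  by apply: eq_bigr => i _; rewrite mxE.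
rewrite [(2 * h) ^+ n.+1]exprS; by field.
Qed.

(** Since [g s] is the derivative of [p s], integrating along the first coordinate leaves
    [p s (a0 h + c) + p s (a0 h - c)] over [a0], with [c] linear in the other coordinates; both
    terms fall under [Rintegral_odd_dot_ge0]. If [a0 = 0] the dimension drops. *)
Let M n (h s : R) (a : 'rV[R]_n) : 0 < h ->
  0 <= \int[lebesgue_rV R n]_(v in ucube n h) g s (dot a v).
Proof.
move=> h0; elim: n a => [|n IH] a.
  apply: Rintegral_ge0 => v _; rewrite /dot big_ord0 /g normr0 expr0n/= !mulr0 subrr add0r.
  exact: sqr_ge0.
have [C hC] := bounded_comp_dot a (ltW h0) (@cg s).
have mf := measurable_comp_dot a (@cg s).
set a0 := a ord0 ord0; set a' := rV_behead a.
have [a00|a00] := eqVneq a0 0.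
  rewrite (Rintegral_ucube h0 mf hC); apply: Rintegral_ge0 => t _.
  by under eq_Rintegral do rewrite dot_cons -/a0 -/a' a00 mul0r add0r.
rewrite (Rintegral_ucube_swap h0 mf hC).
under eq_Rintegral => v _.
  under eq_Rintegral do rewrite dot_cons -/a0 -/a' addrC.
  rewrite int_g//.
  over.
have cpb c : continuous (fun x => p s (c + x)).
  apply: (continuous_compose (f := fun x => c + x) (g := p s)); last exact: cp.
  by move=> x; apply: cvgD; [exact: cvg_cst|exact: cvg_id].
have ip c (b : 'rV[R]_n) : (lebesgue_rV R n).-integrable (ucube n h) (EFin \o (fun v => p s (c + dot b v))).
  exact: (integrable_comp_dot b h0 (@cpb c)).
have mU := @measurable_ucube R n h.
under eq_Rintegral do rewrite -dotNl.
rewrite RintegralZl//; last exact: integrableDR.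
rewrite RintegralD//.
have L c (b : 'rV[R]_n) : 0 <= c -> 0 <= \int[lebesgue_rV R n]_(v in ucube n h) p s (c + dot b v).
  by move=> c0; apply: Rintegral_odd_dot_ge0 => //; exact: p0.
have [a0p|a0n|] := ltgtP a0 0; last by move/eqP; rewrite (negbTE a00).
  (* For negative [a0] the sign is moved by oddness onto the constant, which becomes nonnegative,
     and the negative factor [a0^-1] restores the sign. *)
  have LN b : \int[lebesgue_rV R n]_(v in ucube n h) p s (a0 * h + dot b v) =
      - \int[lebesgue_rV R n]_(v in ucube n h) p s (- (a0 * h) + dot (- b) v).
    rewrite -[RHS]mulN1r -RintegralZl//; apply: eq_Rintegral => v _.
    by rewrite mulN1r -pN dotNl opprD !opprK.
  rewrite !LN -opprD mulrN -mulNr mulr_ge0//.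
    by rewrite oppr_ge0 invr_le0 ltW.
  by rewrite addr_ge0// L// oppr_ge0 mulr_le0_ge0// ltW.
by rewrite mulr_ge0// ?invr_ge0 ?(ltW a0n)// addr_ge0// L// mulr_ge0// ltW.
Qed.

(** [M] at [s = h * enorm a], where three times the second moment equals [s ^+ 2] times the volume;
    this leaves [4 s] times the integral at most [2 s ^+ 2] times the volume. Cauchy-Schwarz would
    give [h] over the square root of 3 instead of [h / 2], and the constant 1/4 of the limit would
    be missed. *)
Lemma Rintegral_normr_dot_le n (h : R) (a : 'rV[R]_n) : 0 < h ->
  \int[lebesgue_rV R n]_(v in ucube n h) `|dot a v| <= (2 * h) ^+ n * (h / 2) * enorm a.
Proof.
move=> h0; have [->|a0] := eqVneq a 0.
  rewrite (_ : (fun v => _) = cst 0) ?Rintegral_cst ?mul0r; last 2 first.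
  - exact: measurable_ucube.
  - by apply/funext => v; rewrite dot0l normr0.
  by rewrite !mulr_ge0 ?exprn_ge0 ?enorm_ge0// ?mulr_ge0// ltW.
have ea : 0 < enorm a by rewrite lt_neqAle eq_sym enorm_eq0 a0 enorm_ge0.
set s := h * enorm a.
have s0 : 0 < s by rewrite mulr_gt0.
have := M s a h0; rewrite /g.
have mU := @measurable_ucube R n h.
have i1 := integrable_comp_dot a h0 (@norm_continuous _ R).
have i2 := integrable_comp_dot a h0 continuous_sqr.
rewrite RintegralD//; [|apply: integrableBR => //; exact: integrableZlR|exact: icst].
rewrite RintegralB//; try exact: integrableZlR.
rewrite Rintegral_ucube_cst// !RintegralZl// Rintegral_sqr_dot//.
move: (Rintegral _ _ _) => J HJ.
rewrite -(ler_pM2l (mulr_gt0 (ltr0n R 4) s0)).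
move: HJ; rewrite /s -sqr_enorm => HJ; nra.
Qed.

(** Equality holds for a direction along an edge; the lower bound depends on it. *)
Lemma Rintegral_normr_coord0 n (h : R) : 0 < h ->
  \int[lebesgue_rV R n.+1]_(v in ucube n.+1 h) `|v ord0 ord0| = (2 * h) ^+ n.+1 * (h / 2).
Proof.
move=> h0; pose e : 'rV[R]_n.+1 := delta_mx ord0 ord0.
have eE (v : 'rV[R]_n.+1) : v ord0 ord0 = dot e v.
  rewrite /dot (bigD1 ord0)//= !mxE !eqxx mul1r big1 ?addr0// => i i0.
  by rewrite mxE (negbTE i0) andbF mul0r.
under eq_Rintegral do rewrite eE.
have [C hC] := bounded_comp_dot e (ltW h0) (@norm_continuous _ R).
rewrite (Rintegral_ucube h0 (measurable_comp_dot e (@norm_continuous _ R)) hC).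
under eq_Rintegral => t _.
  under eq_Rintegral => v _. rewrite -eE rV_cons0 /=. over. cbv beta.
  rewrite Rintegral_ucube_cst//.
  over.
have c2 : continuous (fun t : R => (2 * h) ^+ n * `|t|).
  by move=> t; apply: cvgMr; exact: norm_continuous.
have dF (x : R) : is_derive (x : R^o) (1 : R^o)
    (fun t => ((2 * h) ^+ n / 2) * (t * `|t|) : R^o) ((2 * h) ^+ n * `|x|).
  have d := is_derive_mul_norm x.
  rewrite (_ : (fun t => _) = ((2 * h) ^+ n / 2) \*: (fun y : R => y * `|y| : R^o)); last by apply/funext.
  by apply: is_derive_eq; rewrite /GRing.scale/=; field.
rewrite (FTC_itvoo h0 c2 dF).
rewrite normrN gtr0_norm// [(2 * h) ^+ n.+1]exprS; by field.
Qed.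

End cube_moments2.

(** * Mollifiers *)

Lemma continuous_mulR (R : realType) (T : topologicalType) (f g : T -> R) :
  continuous f -> continuous g -> continuous (fun x => f x * g x).
Proof. by move=> cf cg x; apply: cvgM; [exact: cf|exact: cg]. Qed.

Section bump.
Context {R : realType} {n : nat}.
Local Notation mu := (lebesgue_rV R n).
Local Notation V := ('rV[R]_n).
Implicit Types x y h : V.

(** The square of a truncated quadratic: C^1 with Lipschitz gradient, hence an admissible kernel,
    and simple enough for every estimate to be a polynomial inequality in Euclidean norms. *)
Definition bump (d : R) x : R := Num.max 0 (d ^+ 2 - dot x x) ^+ 2.

Definition bump_grad (d : R) x : V := (- 4 * Num.max 0 (d ^+ 2 - dot x x)) *: x.

Lemma bump_ge0 d x : 0 <= bump d x. Proof. exact: sqr_ge0. Qed.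

Lemma bumpN d x : bump d (- x) = bump d x.
Proof. by rewrite /bump dotNl dotNr opprK. Qed.

Lemma bump_out d x : 0 <= d -> d <= enorm x -> bump d x = 0.
Proof.
move=> d0 dx; rewrite /bump -sqr_enorm max_l ?expr0n//.
by rewrite subr_le0 ler_pXn2r// ?nnegrE ?enorm_ge0.
Qed.

Lemma bump_grad_out d x : 0 <= d -> d <= enorm x -> bump_grad d x = 0.
Proof.
move=> d0 dx; rewrite /bump_grad -sqr_enorm max_l ?mulr0 ?scale0r//.
by rewrite subr_le0 ler_pXn2r// ?nnegrE ?enorm_ge0.
Qed.

Lemma bump_le d x : bump d x <= d ^+ 4.
Proof.
rewrite /bump -[4%N]/(2 * 2)%N exprM ler_pXn2r// ?nnegrE ?le_max ?lexx ?sqr_ge0//.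
by rewrite ge_max sqr_ge0/= lerBlDr lerDl dot_ge0.
Qed.

Let max0E (a : R) : Num.max 0 a = if 0 <= a then a else 0.
Proof. by case: leP => [/max_r|/ltW/max_l]. Qed.

Let enormB_dist x y : `|enorm x - enorm y| <= enorm (x - y).
Proof.
rewrite ler_norml; apply/andP; split.
  rewrite lerNl opprB lerBlDr -(enormN (x - y)) opprB.
  by rewrite (le_trans _ (enormD _ _))// subrK.
by rewrite lerBlDr (le_trans _ (enormD _ _))// subrK.
Qed.

(** Only the norms [a] of [x], [c] of [x + h], [e] of [h] and the product [p] of [x] and [h] enter,
    tied by [2 p = c^2 - a^2 - e^2], by |c - a| <= e and by Cauchy-Schwarz. The four cases tell
    which of the two points lies in the ball of radius [d]. *)
Lemma bump_quadratic d x h : 0 < d ->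
  `|bump d (x + h) - bump d x - dot (bump_grad d x) h| <= 16 * d ^+ 2 * dot h h.
Proof.
move=> d0; rewrite /bump /bump_grad dotZl -!sqr_enorm.
have := enormB_dist (x + h) x; rewrite (addrC x) addrK ler_norml => /andP[].
have := normr_dot_le x h.
have : enorm (h + x) ^+ 2 = enorm x ^+ 2 + 2 * dot x h + enorm h ^+ 2.
  by rewrite !sqr_enorm !(dotDl, dotDr) (dotC h x); ring.
move: (enorm_ge0 (h + x)) (enorm_ge0 x) (enorm_ge0 h).
move: (enorm (h + x)) (enorm x) (enorm h) (dot x h) => c a e p c0 a0 e0 cE pae h1 h2.
have pE : 2 * p = c ^+ 2 - a ^+ 2 - e ^+ 2 by rewrite cE; ring.
have dE (u : R) : d ^+ 2 - u ^+ 2 = (d - u) * (d + u) by ring.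
rewrite !max0E; case: ifPn => hc; case: ifPn => ha; rewrite ?expr0n/= ?mulr0 ?mul0r.
- have ad : a <= d by rewrite -(@ler_pXn2r _ 2)// ?nnegrE ?(ltW d0)//; lra.
  have cd : c <= d by rewrite -(@ler_pXn2r _ 2)// ?nnegrE ?(ltW d0)//; lra.
  have -> : (d ^+ 2 - c ^+ 2) ^+ 2 - (d ^+ 2 - a ^+ 2) ^+ 2 - - 4 * (d ^+ 2 - a ^+ 2) * p =
     (c ^+ 2 - a ^+ 2) ^+ 2 - 2 * (d ^+ 2 - a ^+ 2) * e ^+ 2.
    by rewrite (_ : - 4 * (d ^+ 2 - a ^+ 2) * p = - 2 * (d ^+ 2 - a ^+ 2) * (2 * p)); [rewrite pE|]; ring.
  have k1 : (c ^+ 2 - a ^+ 2) ^+ 2 <= 4 * d ^+ 2 * e ^+ 2.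
    rewrite (_ : c ^+ 2 - a ^+ 2 = (c - a) * (c + a)); last by ring.
    rewrite exprMn.
    have k2 : (c - a) ^+ 2 <= e ^+ 2 by nra.
    have k3 : (c + a) ^+ 2 <= 4 * d ^+ 2 by nra.
    have := ler_pM (sqr_ge0 (c - a)) (sqr_ge0 (c + a)) k2 k3; lra.
  have k4 := sqr_ge0 (c ^+ 2 - a ^+ 2).
  have k5 : 0 <= (d ^+ 2 - a ^+ 2) * e ^+ 2 by rewrite mulr_ge0// sqr_ge0.
  have k6 : 0 <= a ^+ 2 * e ^+ 2 by rewrite mulr_ge0// sqr_ge0.
  have k7 : 0 <= d ^+ 2 * e ^+ 2 by rewrite mulr_ge0// sqr_ge0.
  by rewrite ler_norml; apply/andP; split; lra.
- rewrite subr0 subr0.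
  have ad : d <= a by rewrite -(@ler_pXn2r _ 2)// ?nnegrE ?(ltW d0)//; lra.
  have cd : c <= d by rewrite -(@ler_pXn2r _ 2)// ?nnegrE ?(ltW d0)//; lra.
  rewrite ger0_norm ?sqr_ge0// dE exprMn.
  have k2 : (d - c) ^+ 2 <= e ^+ 2 by nra.
  have k3 : (d + c) ^+ 2 <= 4 * d ^+ 2 by nra.
  have := ler_pM (sqr_ge0 (d - c)) (sqr_ge0 (d + c)) k2 k3.
  have k7 : 0 <= d ^+ 2 * e ^+ 2 by rewrite mulr_ge0// sqr_ge0.
  lra.
- have ad : a <= d by rewrite -(@ler_pXn2r _ 2)// ?nnegrE ?(ltW d0)//; lra.
  have cd : d <= c by rewrite -(@ler_pXn2r _ 2)// ?nnegrE ?(ltW d0)//; lra.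
  have p1 : `|p| <= d * e by rewrite (le_trans pae)// ler_wpM2r.
  have r1 : d ^+ 2 - a ^+ 2 <= 2 * d * e by nra.
  have r2 : (d ^+ 2 - a ^+ 2) ^+ 2 <= 4 * d ^+ 2 * e ^+ 2.
    by rewrite (_ : 4 * _ * _ = (2 * d * e) ^+ 2) ?ler_pXn2r// ?nnegrE//; [nra|ring].
  have r3 : `|(d ^+ 2 - a ^+ 2) * p| <= 2 * d ^+ 2 * e ^+ 2.
    rewrite normrM (ger0_norm ha) (_ : 2 * _ * _ = 2 * d * e * (d * e)); last by ring.
    exact: ler_pM.
  move: r3; rewrite !ler_norml => /andP[r3 r4].
  have k7 : 0 <= d ^+ 2 * e ^+ 2 by rewrite mulr_ge0// sqr_ge0.
  have k8 := sqr_ge0 (d ^+ 2 - a ^+ 2).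
  by apply/andP; split; lra.
- rewrite subrr subr0 normr0; apply: mulr_ge0; last exact: sqr_ge0.
  by apply: mulr_ge0 => //; exact: sqr_ge0.
Qed.

Lemma bump_lipschitz d x y : 0 < d -> `|bump d x - bump d y| <= 4 * d ^+ 3 * enorm (x - y).
Proof.
move=> d0; rewrite /bump -!sqr_enorm.
have := enormB_dist x y; rewrite ler_norml => /andP[].
move: (enorm_ge0 x) (enorm_ge0 y) (enorm_ge0 (x - y)).
move: (enorm x) (enorm y) (enorm (x - y)) => a b e a0 b0 e0 h1 h2.
have dE (u v : R) : (d ^+ 2 - u ^+ 2) ^+ 2 - (d ^+ 2 - v ^+ 2) ^+ 2 =
  (v - u) * ((v + u) * (2 * d ^+ 2 - u ^+ 2 - v ^+ 2)) by ring.
(* Both radii are at most [d] here. A point outside the ball is replaced by one of radius [d], where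
   the profile is also 0 and the distance to the other radius only shrinks. *)
have key (u v : R) : 0 <= u -> 0 <= v -> u <= d -> v <= d -> `|v - u| <= e ->
    `|(d ^+ 2 - u ^+ 2) ^+ 2 - (d ^+ 2 - v ^+ 2) ^+ 2| <= 4 * d ^+ 3 * e.
  move=> u0 v0 ud vd uv; rewrite dE normrM mulrC.
  have w0 : 0 <= 2 * d ^+ 2 - u ^+ 2 - v ^+ 2 by nra.
  apply: ler_pM => //.
  rewrite ger0_norm; last exact: (mulr_ge0 (addr_ge0 v0 u0) w0).
  rewrite (_ : 4 * d ^+ 3 = (2 * d) * (2 * d ^+ 2)); last by ring.
  by apply: ler_pM; [exact: addr_ge0|exact: w0|lra|nra].
have zero : (d ^+ 2 - d ^+ 2) ^+ 2 = 0 :> R by rewrite subrr expr0n.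
rewrite !max0E; case: ifPn => ha; case: ifPn => hb; rewrite ?[0 ^+ 2]expr0n/=.
- have ad : a <= d by rewrite -(@ler_pXn2r _ 2)// ?nnegrE ?(ltW d0)//; lra.
  have bd : b <= d by rewrite -(@ler_pXn2r _ 2)// ?nnegrE ?(ltW d0)//; lra.
  by apply: key => //; rewrite ler_norml; apply/andP; split; lra.
- have ad : a <= d by rewrite -(@ler_pXn2r _ 2)// ?nnegrE ?(ltW d0)//; lra.
  have bd : d <= b by rewrite -(@ler_pXn2r _ 2)// ?nnegrE ?(ltW d0)//; lra.
  have := key a d a0 (ltW d0) ad (lexx d); rewrite zero; apply.
  by rewrite ler_norml; apply/andP; split; lra.
- have ad : d <= a by rewrite -(@ler_pXn2r _ 2)// ?nnegrE ?(ltW d0)//; lra.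
  have bd : b <= d by rewrite -(@ler_pXn2r _ 2)// ?nnegrE ?(ltW d0)//; lra.
  have := key d b (ltW d0) b0 (lexx d) bd; rewrite zero; apply.
  by rewrite ler_norml; apply/andP; split; lra.
- rewrite subrr normr0; apply: mulr_ge0 => //; apply: mulr_ge0 => //.
  by apply: exprn_ge0; exact: ltW.
Qed.

Let continuous_max0 (d : R) : continuous (fun x : V => Num.max 0 (d ^+ 2 - dot x x)).
Proof.
apply: (continuous_compose (f := fun x : V => d ^+ 2 - dot x x) (g := fun t => Num.max 0 t)).
  have cd : continuous (fun x : V => dot x x).
    by apply: (@continuous_dot R n _ id id) => z; exact: cvg_id.
  by move=> x; apply: (@continuousB _ _ _ (cst (d ^+ 2)) (fun x : V => dot x x));
    [exact: cst_continuous|exact: cd].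
move=> t; apply: (@continuous_max _ _ (cst 0) id t); [exact: cvg_cst|exact: cvg_id].
Qed.

Lemma continuous_bump d : continuous (bump d).
Proof.
apply: (continuous_compose (f := fun x : V => Num.max 0 (d ^+ 2 - dot x x)) (g := fun t => t ^+ 2)).
  exact: continuous_max0.
exact: exprn_continuous.
Qed.

Lemma continuous_bump_grad d i : continuous (fun x => bump_grad d x ord0 i).
Proof.
rewrite /bump_grad; under eq_fun do rewrite mxE.
apply: continuous_mulR; last by move=> x; exact: coord_continuous.
by apply: continuous_mulR; [move=> x; exact: cst_continuous|exact: continuous_max0].
Qed.

Lemma measurable_bump d : measurable_fun setT (bump d).
Proof. by apply: continuous_measurable_rV; exact: continuous_bump. Qed.

Definition cball (r : R) : set V := [set x | forall i, `[- r, r]%classic (x ord0 i)].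

Lemma measurable_cball r : measurable (cball r).
Proof. exact: (@measurable_rV_box R n (fun=> `[- r, r]%classic)). Qed.

Lemma cballE r x : 0 <= r -> cball r x <-> `|x| <= r.
Proof.
move=> r0; rewrite rV_normP//; split => [H|/forallP H i].
  by apply/forallP => i; have := H i; rewrite /= in_itv/= ler_norml.
by have := H i; rewrite /= in_itv/= -ler_norml.
Qed.

Lemma lebesgue_cball r : 0 <= r -> mu (cball r) = ((2 * r) ^+ n)%:E.
Proof.
move=> r0; apply: (@lebesgue_rV_pow R n `[- r, r]%classic) => //.
rewrite lebesgue_measure_itv/= lte_fin; case: ifPn => [_|].
  by rewrite -EFinD; congr EFin; ring.
by rewrite -leNgt => r1; congr EFin; lra.
Qed.

Lemma lebesgue_cball_lty r : 0 <= r -> (mu (cball r) < +oo)%E.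
Proof. by move=> r0; rewrite lebesgue_cball// ltry. Qed.

Lemma integrable_bump d : 0 < d -> mu.-integrable setT (EFin \o bump d).
Proof.
move=> d0.
have -> : bump d = bump d \_ (cball d).
  apply/funext => x; rewrite patchE; case: ifPn => //; rewrite notin_setE => xd.
  apply: bump_out; first exact: ltW.
  rewrite leNgt; apply/negP => xd'; apply: xd; apply/cballE; first exact: ltW.
  by rewrite (le_trans (norm_le_enorm _))// ltW.
rewrite -restrict_EFin -integrable_mkcond; last exact: measurable_cball.
apply: (bounded_integrable (C := d ^+ 4)).
- exact: measurable_cball.
- by apply: lebesgue_cball_lty; exact: ltW.
- by apply: measurable_funTS; exact: measurable_bump.
- by move=> x _; rewrite ger0_norm ?bump_ge0// bump_le.
Qed.

Definition bump_mass (d : R) : R := \int[mu]_x bump d x.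

(** On the cube of half-side [d / (2 (n + 1))] the Euclidean norm is at most [d / 2], so the bump is
    at least [d ^+ 4 / 4] there. The order [d^(n + 4)] governs the constants of the normalised
    kernel. *)
Lemma bump_mass_ge d : 0 < d -> d ^+ 4 / 4 * (d / n.+1%:R) ^+ n <= bump_mass d.
Proof.
move=> d0; have N0 : 0 < n.+1%:R :> R by [].
pose r := d / (2 * n.+1%:R).
have r0 : 0 < r by rewrite divr_gt0// mulr_gt0.
have rE : 2 * r = d / n.+1%:R by rewrite /r; field; rewrite gt_eqF.
apply: (@le_trans _ _ (\int[mu]_(x in cball r) (d ^+ 4 / 4))).
  have e : fine (mu (cball r)) = (d / n.+1%:R) ^+ n by rewrite lebesgue_cball ?(ltW r0)//= rE.
  by rewrite -e Rintegral_cst; [exact: lexx|exact: measurable_cball].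
rewrite Rintegral_mkcond; apply: le_Rintegral => //.
- rewrite -restrict_EFin -integrable_mkcond; last exact: measurable_cball.
  apply: (bounded_integrable (C := `|d ^+ 4 / 4|)) => //; first exact: measurable_cball.
  by apply: lebesgue_cball_lty; exact: ltW.
- exact: integrable_bump.
- move=> x _; rewrite patchE; case: ifPn => [|_]; last exact: bump_ge0.
  rewrite inE => /(cballE _ (ltW r0)) xr.
  have xd : dot x x <= d ^+ 2 / 4.
    rewrite -sqr_enorm (_ : d ^+ 2 / 4 = (d / 2) ^+ 2); last by field.
    rewrite ler_pXn2r// ?nnegrE ?enorm_ge0 ?divr_ge0 ?(ltW d0)//.
    rewrite (le_trans (enorm_le_norm _))//.
    apply: (@le_trans _ _ (n.+1%:R * r)); first by apply: ler_pM => //; rewrite ler_nat.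
    by rewrite /r le_eqVlt; apply/orP; left; apply/eqP; field; rewrite gt_eqF.
  rewrite /bump max_r; last by have := sqr_ge0 d; lra.
  rewrite (_ : d ^+ 4 / 4 = (d ^+ 2 / 2) ^+ 2); last by field.
  by rewrite ler_pXn2r// ?nnegrE; have := sqr_ge0 d; lra.
Qed.

Lemma bump_mass_gt0 d : 0 < d -> 0 < bump_mass d.
Proof.
move=> d0; apply: lt_le_trans (bump_mass_ge d0).
by rewrite mulr_gt0// ?exprn_gt0// ?divr_gt0// ?exprn_gt0.
Qed.

End bump.
Arguments cball {R} n r.

Lemma dot_delta (R : realType) n (x : 'rV[R]_n) i : dot x (delta_mx ord0 i) = x ord0 i.
Proof.
rewrite /dot (bigD1 i)//= [delta_mx _ _ _ _]mxE !eqxx mulr1 big1 ?addr0// => l li.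
by rewrite [delta_mx _ _ _ _]mxE (negbTE li) andbF mulr0.
Qed.

Lemma enorm0 (R : realType) n : enorm (0 : 'rV[R]_n) = 0.
Proof. by rewrite enormE dot0l sqrtr0. Qed.

Lemma differentiable_quadratic (R : realType) (V W : normedModType R) (f : V -> W)
    (df : {linear V -> W}) (x : V) (C K : R) :
  (forall h, `|df h| <= K * `|h|) ->
  (forall h, `|f (h + x) - f x - df h| <= C * `|h| ^+ 2) -> differentiable f x.
Proof.
move=> dfK fC.
have cdf : continuous df.
  apply: bounded_linear_continuous; apply/bounded_funP => r; exists (`|K| * `|r|) => h hr.
  rewrite (le_trans (dfK h))// (@le_trans _ _ (`|K| * `|h|)) ?ler_wpM2r ?ler_norm//.
  by rewrite ler_wpM2l// (le_trans hr)// ler_norm.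
have E : f \o shift x = cst (f x) + df +o_ 0 id.
  apply/eqaddoP => e e0.
  have C1 : 0 < `|C| + 1 by rewrite ltr_wpDl.
  have eC := divr_gt0 e0 C1.
  near=> h => /=; rewrite !fctE /= opprD addrA (le_trans (fC h))//.
  rewrite expr2 mulrA ler_wpM2r//.
  apply: (@le_trans _ _ ((`|C| + 1) * `|h|)).
    by rewrite ler_wpM2r// (le_trans (ler_norm _))// lerDl.
  rewrite -ler_pdivlMl// mulrC.
  by near: h; apply: nbhs0_le.
apply/diff_locallyP; rewrite (diff_unique cdf E); split => //.
Unshelve. all: by end_near. Qed.

Lemma lipschitz_continuous (R : realType) (V W : normedModType R) (f : V -> W) (K : R) :
  (forall x y, `|f x - f y| <= K * `|x - y|) -> continuous f.
Proof.
move=> fK x; have K1 : 0 < `|K| + 1 by rewrite ltr_wpDl.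
apply/cvgrPdist_le => e e0; have eK := divr_gt0 e0 K1; near=> y.
rewrite (le_trans (fK x y))//.
apply: (@le_trans _ _ ((`|K| + 1) * `|x - y|)).
  by rewrite ler_wpM2r// (le_trans (ler_norm _))// lerDl.
rewrite -ler_pdivlMl// mulrC.
by near: y; apply: (cvgr_dist_le id).
Unshelve. all: by end_near. Qed.

Section cball_topology.
Context {R : realType} {n : nat}.

Lemma closed_cball (r : R) : 0 <= r -> closed (cball n r).
Proof.
move=> r0; rewrite (_ : cball n r = [set x | `|x| <= r]).
  have := @preimage_closed _ _ (fun x : 'rV[R]_n => `|x|) [set t | t <= r].
  apply; last exact: closed_le.
  by move=> x _; exact: norm_continuous.
by apply/seteqP; split => x /(cballE _ r0).
Qed.

Lemma compact_cball (r : R) : 0 <= r -> compact (cball n r).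
Proof.
move=> r0; apply: bounded_closed_compact; last exact: closed_cball.
exists r; split; first exact: num_real.
by move=> M rM x /(cballE _ r0) /= xr; rewrite (le_trans xr)// ltW.
Qed.

Lemma compact_sub_cball (K : set 'rV[R]_n) : compact K -> exists2 r, 0 < r & K `<=` cball n r.
Proof.
move=> /compact_bounded[M [_ hM]]; exists (`|M| + 1); first by rewrite ltr_wpDl.
move=> x Kx; apply/cballE; first by rewrite addr_ge0.
by apply: (hM _ _ x Kx); rewrite (le_lt_trans (ler_norm _))// ltrDl.
Qed.

Lemma compact_closure_cball (r : R) (A : set 'rV[R]_n) : 0 <= r ->
  A `<=` cball n r -> compact (closure A).
Proof.
move=> r0 Ar; apply: (@subclosed_compact _ _ (cball n r)).
- exact: closed_closure.
- exact: compact_cball.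
- by rewrite [X in _ `<=` X](closure_id _).1; [exact: closureS|exact: closed_cball].
Qed.

End cball_topology.

Section mollifier.
Context {R : realType} {n : nat}.
Local Notation mu := (lebesgue_rV R n).
Local Notation V := ('rV[R]_n).
Variables (d : R) (d0 : 0 < d).
Implicit Types x y h k : V.

Let N := @bump_mass R n d.
Let N0 : 0 < N. Proof. exact: bump_mass_gt0. Qed.

Definition moll x : R := N^-1 * bump d x.
Definition dmoll x : V := N^-1 *: bump_grad d x.
Definition moll_C2 : R := 16 * d ^+ 2 * N^-1.
Definition moll_lip : R := 4 * d ^+ 3 * N^-1.

Lemma moll_ge0 x : 0 <= moll x. Proof. by rewrite mulr_ge0 ?bump_ge0// invr_ge0 ltW. Qed.

Lemma mollN x : moll (- x) = moll x. Proof. by rewrite /moll bumpN. Qed.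

Lemma moll_out x : d <= enorm x -> moll x = 0.
Proof. by move=> dx; rewrite /moll bump_out ?mulr0// ltW. Qed.

Lemma dmoll_out x : d <= enorm x -> dmoll x = 0.
Proof. by move=> dx; rewrite /dmoll bump_grad_out ?scaler0// ltW. Qed.

Lemma moll_C2_ge0 : 0 <= moll_C2.
Proof.
apply: mulr_ge0; last by rewrite invr_ge0 ltW.
by apply: mulr_ge0 => //; exact: sqr_ge0.
Qed.

Lemma moll_lip_ge0 : 0 <= moll_lip.
Proof.
apply: mulr_ge0; last by rewrite invr_ge0 ltW.
by apply: mulr_ge0 => //; apply: exprn_ge0; exact: ltW.
Qed.

Lemma moll_quadratic x h : `|moll (x + h) - moll x - dot (dmoll x) h| <= moll_C2 * dot h h.
Proof.
rewrite /moll /dmoll dotZl -!mulrBr normrM gtr0_norm ?invr_gt0// /moll_C2 mulrC.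
rewrite (_ : _ * _ * _ * dot h h = 16 * d ^+ 2 * dot h h * N^-1); last by ring.
by rewrite ler_wpM2r ?bump_quadratic// invr_ge0 ltW.
Qed.

Lemma moll_lipschitz x y : `|moll x - moll y| <= moll_lip * enorm (x - y).
Proof.
rewrite /moll -mulrBr normrM gtr0_norm ?invr_gt0// /moll_lip mulrC.
rewrite (_ : _ * _ * _ * enorm _ = 4 * d ^+ 3 * enorm (x - y) * N^-1); last by ring.
by rewrite ler_wpM2r ?bump_lipschitz// invr_ge0 ltW.
Qed.

(** The order [d^-(n+1)] is that of the gradient of a unit mass spread over a ball of radius [d].
    Multiplied by the side of a cube and by a volume of order [d^n], it leaves the ratio of side to
    [d]. *)
Lemma moll_lip_le : moll_lip <= 16 * n.+1%:R ^+ n / d ^+ n.+1.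
Proof.
have k0 : 0 < d ^+ 4 / 4 * (d / n.+1%:R) ^+ n.
  by rewrite mulr_gt0// ?exprn_gt0// ?divr_gt0// ?exprn_gt0.
have k1 : N^-1 <= (d ^+ 4 / 4 * (d / n.+1%:R) ^+ n)^-1.
  by rewrite lef_pV2// ?posrE// bump_mass_ge.
rewrite /moll_lip (le_trans (ler_wpM2l _ k1))//.
  by rewrite mulr_ge0// exprn_ge0// ltW.
rewrite le_eqVlt; apply/orP; left; apply/eqP.
rewrite expr_div_n [d ^+ n.+1]exprS.
have u0 : n.+1%:R ^+ n != 0 :> R by rewrite expf_neq0// pnatr_eq0.
have v0 : d ^+ n != 0 by rewrite expf_neq0// gt_eqF.
have dn0 : d != 0 by rewrite gt_eqF.
move: (n.+1%:R ^+ n) (d ^+ n) u0 v0 => u v u0 v0; field.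
by rewrite u0 v0 dn0.
Qed.

Lemma continuous_moll : continuous moll.
Proof.
by apply: continuous_mulR; [move=> x; exact: cst_continuous|exact: continuous_bump].
Qed.

Lemma measurable_moll : measurable_fun setT moll.
Proof. by apply: continuous_measurable_rV; exact: continuous_moll. Qed.

Lemma continuous_dmoll i : continuous (fun x => dmoll x ord0 i).
Proof.
under eq_fun do rewrite mxE.
by apply: continuous_mulR; [move=> x; exact: cst_continuous|exact: continuous_bump_grad].
Qed.

Lemma measurable_dmoll : measurable_fun setT dmoll.
Proof.
by apply: measurable_fun_rV => i; apply: continuous_measurable_rV; exact: continuous_dmoll.
Qed.

Lemma measurable_dot_dmoll k : measurable_fun setT (fun x => dot (dmoll x) k).
Proof.
apply: measurable_sum => i; apply: measurable_funM => //.
exact: (measurableT_comp (@measurable_coord R n i) measurable_dmoll).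
Qed.

Lemma integrable_moll : mu.-integrable setT (EFin \o moll).
Proof. by apply: integrableZlR => //; exact: integrable_bump. Qed.

Lemma Rintegral_moll : \int[mu]_x moll x = 1.
Proof. by rewrite RintegralZl// ?mulVf ?gt_eqF//; exact: integrable_bump. Qed.

Definition moll_max : R := N^-1 * d ^+ 4.

Lemma moll_le x : `|moll x| <= moll_max.
Proof. by rewrite ger0_norm ?moll_ge0// ler_wpM2l ?bump_le// invr_ge0 ltW. Qed.

Lemma dmoll_le x k : `|dot (dmoll x) k| <= moll_lip * enorm k.
Proof.
rewrite (le_trans (normr_dot_le _ _))// ler_wpM2r ?enorm_ge0//.
have [dx|dx] := leP d (enorm x).
  by rewrite dmoll_out// enorm0 moll_lip_ge0.
rewrite /dmoll /bump_grad !enormZ ger0_norm ?invr_ge0 ?(ltW N0)// mulrC /moll_lip.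
rewrite ler_wpM2r ?invr_ge0 ?(ltW N0)// normrM normrN (ger0_norm (ler0n _ 4)) -mulrA ler_wpM2l//.
rewrite [d ^+ 3]exprSr; apply: ler_pM; rewrite ?enorm_ge0 ?(ltW dx)//.
rewrite ger0_norm ?le_max ?lexx// ge_max sqr_ge0/= lerBlDr lerDl; exact: dot_ge0.
Qed.

(** Second derivatives are avoided. Three first-order expansions, from [y] to [y + h], from [y + h]
    to [y + h + z] and from [y] to [y + h + z], differ by the pairing of the gradient increment with
    [z]. With [z] of the length of [h] the remainders add up to [1 + 4 + 1 = 6] times
    [moll_C2 * enorm h ^+ 2]. *)
Lemma dmoll_lipschitz x y k :
  `|dot (dmoll x - dmoll y) k| <= 6 * moll_C2 * enorm (x - y) * enorm k.
Proof.
have key h z : enorm z = enorm h -> `|dot (dmoll (y + h) - dmoll y) z| <= 6 * moll_C2 * enorm h ^+ 2.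
  move=> zh.
  have e1 := moll_quadratic (y + h) z; have e2 := moll_quadratic y (h + z).
  have e3 := moll_quadratic y h.
  have e4 : dot (h + z) (h + z) <= 4 * enorm h ^+ 2.
    rewrite -sqr_enorm (_ : 4 * _ = (enorm h + enorm z) ^+ 2); last by rewrite zh; ring.
    by rewrite ler_pXn2r ?nnegrE ?addr_ge0 ?enorm_ge0// enormD.
  have e5 := ler_wpM2l moll_C2_ge0 e4.
  move: e1 e2 e3; rewrite -!sqr_enorm zh addrA dotBl dotDr in e5 *.
  rewrite !ler_norml => /andP[a1 a2] /andP[b1 b2] /andP[c1 c2].
  by apply/andP; split; lra.
have [->|xy] := eqVneq x y.
  by rewrite !subrr dot0l normr0 enorm0 mulr0 mul0r.
have [->|k0] := eqVneq k 0.
  by rewrite dot0r normr0 enorm0 mulr0.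
have ek : 0 < enorm k by rewrite lt_neqAle eq_sym enorm_eq0 k0 enorm_ge0.
have exy : 0 < enorm (x - y) by rewrite lt_neqAle eq_sym enorm_eq0 subr_eq0 xy enorm_ge0.
(* [k] is rescaled to the length of [x - y], as [key] demands; both sides are homogeneous in [k]. *)
have := key (x - y) ((enorm (x - y) / enorm k) *: k).
rewrite (addrC y) subrK enormZ ger0_norm ?divr_ge0 ?enorm_ge0// divfK ?gt_eqF// => /(_ erefl).
rewrite dotZr normrM ger0_norm ?divr_ge0 ?enorm_ge0// => H.
have e0 : 0 < enorm (x - y) / enorm k by rewrite divr_gt0.
rewrite -(ler_pM2l e0) (le_trans H)// le_eqVlt; apply/orP; left; apply/eqP; field.
by rewrite gt_eqF.
Qed.

End mollifier.

(** * Test fields given by an integral kernel *)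

Section kernel_field.
Context {R : realType} {n : nat}.
Local Notation V := ('rV[R]_n).
Variables (d : R) (d0 : 0 < d).
Context dX (X : measurableType dX) (m : {measure set X -> \bar R}).
Variables (A : set X) (mA : measurable A) (Aoo : (m A < +oo)%E).
Variables (k c : X -> V) (mk : measurable_fun setT k) (mc : measurable_fun setT c).
Variables (B M : R) (B0 : 0 <= B) (M0 : 0 <= M).
Hypotheses (kB : forall xi, A xi -> enorm (k xi) <= B) (cM : forall xi, A xi -> enorm (c xi) <= M).

(** A superposition of translates of the mollifier to the points [c xi] with vector weights [k xi].
    All regularity comes from [moll], so measurable bounded data on a finite measure space, such as
    signs, already give an admissible test field. *)
Definition kfield (x : V) : V := \row_i \int[m]_(xi in A) (k xi ord0 i * moll d (x - c xi)).

Definition kfield_jac (x h : V) : V :=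
  \row_i \int[m]_(xi in A) (k xi ord0 i * dot (dmoll d (x - c xi)) h).

Let mki i : measurable_fun setT (fun xi => k xi ord0 i).
Proof. exact: (measurableT_comp (@measurable_coord R n i) mk). Qed.

Let mxc x : measurable_fun setT (fun xi => x - c xi).
Proof. exact: (@measurable_subrV2 R n _ _ (cst x)). Qed.

Let kiB i xi : A xi -> `|k xi ord0 i| <= B.
Proof. by move=> /kB; exact/le_trans/coord_le_enorm. Qed.

Let ifield i x : m.-integrable A (EFin \o (fun xi => k xi ord0 i * moll d (x - c xi))).
Proof.
apply: (bounded_integrable (C := B * @moll_max R n d)) => //.
  apply: measurable_funTS; apply: measurable_funM => //.
  exact: (measurableT_comp (measurable_moll d) (mxc x)).
by move=> xi Axi; rewrite normrM ler_pM// ?kiB// moll_le.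
Qed.

Let ijac i x h : m.-integrable A (EFin \o (fun xi => k xi ord0 i * dot (dmoll d (x - c xi)) h)).
Proof.
apply: (bounded_integrable (C := B * (@moll_lip R n d * enorm h))) => //.
  apply: measurable_funTS; apply: measurable_funM => //.
  exact: (measurableT_comp (measurable_dot_dmoll d h) (mxc x)).
by move=> xi Axi; rewrite normrM ler_pM// ?kiB// dmoll_le.
Qed.

Let c20 : 0 <= @moll_C2 R n d := moll_C2_ge0 d0.
Let lip0 : 0 <= @moll_lip R n d := moll_lip_ge0 d0.
Let mA0 : 0 <= fine (m A) := fine_ge0 (measure_ge0 m A).

Ltac nonneg := repeat first [assumption | exact: sqr_ge0 | exact: enorm_ge0 |
  exact: ler0n | exact: normr_ge0 | apply: mulr_ge0].

Let C := B * @moll_C2 R n d * fine (m A).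

Let rV_le (v : V) e : 0 <= e -> (forall i, `|v ord0 i| <= e) -> `|v| <= e.
Proof. by move=> e0 ve; rewrite rV_normP//; apply/forallP. Qed.

Lemma kfield_quadratic x h : `|kfield (h + x) - kfield x - kfield_jac x h| <= C * n%:R ^+ 2 * `|h| ^+ 2.
Proof.
have e0 : 0 <= C * n%:R ^+ 2 * `|h| ^+ 2 by nonneg.
apply: rV_le => // i; rewrite !mxE -RintegralB// -RintegralB//; last exact: integrableBR.
apply: (le_trans (normr_Rintegral_le (C := B * (@moll_C2 R n d * (n%:R ^+ 2 * `|h| ^+ 2))) mA Aoo _ _)).
- by apply: integrableBR => //; exact: integrableBR.
- move=> xi Axi; rewrite -mulrBr -mulrBr normrM ler_pM// ?kiB//.
  have := moll_quadratic d0 (x - c xi) h.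
  rewrite (addrC _ h) addrA => H; rewrite (le_trans H)// ler_wpM2l ?moll_C2_ge0//.
  rewrite -sqr_enorm -exprMn ler_pXn2r ?nnegrE ?enorm_ge0 ?mulr_ge0//.
  exact: enorm_le_norm.
- by rewrite le_eqVlt; apply/orP; left; apply/eqP; rewrite /C; ring.
Qed.

Let jac_mx x : 'M[R]_n := \matrix_(i, j) kfield_jac x (delta_mx ord0 i) ord0 j.

Let jac_mxE x h : h *m jac_mx x = kfield_jac x h.
Proof.
apply/rowP => j; rewrite !mxE.
transitivity (\sum_(i < n) \int[m]_(xi in A) (h ord0 i * (k xi ord0 j * dot (dmoll d (x - c xi)) (delta_mx ord0 i)))).
  by apply: eq_bigr => i _; rewrite RintegralZl// !mxE.
rewrite -Rintegral_sum//; last by move=> i _; exact: integrableZlR.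
apply: eq_Rintegral => xi _; rewrite /dot !mulr_sumr; apply: eq_bigr => i _.
by rewrite -/(dot _ _) dot_delta mulrCA; congr (_ * _); rewrite mulrC.
Qed.

Lemma kfield_jac_le x h : `|kfield_jac x h| <= B * (@moll_lip R n d * n%:R) * fine (m A) * `|h|.
Proof.
have e0 : 0 <= B * (@moll_lip R n d * n%:R) * fine (m A) * `|h|.
  by nonneg.
apply: rV_le => // i; rewrite mxE.
apply: (le_trans (normr_Rintegral_le (C := B * (@moll_lip R n d * (n%:R * `|h|))) mA Aoo _ _)) => //.
  move=> xi Axi; rewrite normrM ler_pM// ?kiB// (le_trans (dmoll_le d0 _ _))//.
  by rewrite ler_wpM2l ?moll_lip_ge0// enorm_le_norm.
by rewrite le_eqVlt; apply/orP; left; apply/eqP; ring.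
Qed.

Lemma differentiable_kfield x : differentiable kfield x.
Proof.
apply: (@differentiable_quadratic _ _ _ _ (mulmxr (jac_mx x)) x) => h; rewrite /= jac_mxE.
  exact: kfield_jac_le.
exact: kfield_quadratic.
Qed.

Lemma derive_kfield v x : 'D_v kfield x = kfield_jac x v.
Proof.
have : is_derive x v kfield (kfield_jac x v).
  apply: (@is_derive_quadratic _ _ _ _ _ _ _ (C * n%:R ^+ 2 * `|v| ^+ 2)) => t.
  have := kfield_quadratic x (t *: v).
  by rewrite -!jac_mxE -scalemxAl normrZ exprMn real_normK ?num_real// mulrCA mulrC.
by case.
Qed.

Lemma continuous_derive_kfield v : continuous ('D_v kfield).
Proof.
apply: (@lipschitz_continuous _ _ _ _ (B * (6 * @moll_C2 R n d * n%:R * enorm v) * fine (m A))) => x y.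
rewrite !derive_kfield; apply: rV_le.
  by nonneg.
move=> i; rewrite !mxE -RintegralB//.
apply: (le_trans (normr_Rintegral_le (C := B * (6 * @moll_C2 R n d * (n%:R * `|x - y|) * enorm v)) mA Aoo _ _)).
- exact: integrableBR.
- move=> xi Axi; rewrite -mulrBr normrM ler_pM// ?kiB//.
  rewrite -dotBl (le_trans (dmoll_lipschitz d0 _ _ _))// opprB addrA subrK.
  rewrite ler_wpM2r ?enorm_ge0// ler_wpM2l//; first by nonneg.
  exact: enorm_le_norm.
- by rewrite le_eqVlt; apply/orP; left; apply/eqP; ring.
Qed.

Lemma kfield_out x : M + d <= enorm x -> kfield x = 0.
Proof.
move=> xM; apply/rowP => i; rewrite !mxE.
rewrite -[RHS](mul0r (fine (m A))) -Rintegral_cst//; apply: eq_Rintegral => xi /[!inE] Axi.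
rewrite moll_out ?mulr0// -(lerD2l M) (le_trans xM)//.
rewrite -{1}(subrK (c xi) x) (le_trans (enormD _ _))// addrC lerD2r; exact: cM.
Qed.

Lemma C1c_kfield : C1c kfield.
Proof.
split; [exact: differentiable_kfield|exact: continuous_derive_kfield|].
apply: (@compact_closure_cball _ _ (M + d)); first by rewrite addr_ge0// ltW.
move=> x /= x0; apply/cballE; first by rewrite addr_ge0// ltW.
rewrite leNgt; apply: contra x0 => xM; apply/eqP/kfield_out.
by rewrite (le_trans (ltW xM))// norm_le_enorm.
Qed.

Lemma divergence_kfield x : divergence kfield x = \int[m]_(xi in A) dot (k xi) (dmoll d (x - c xi)).
Proof.
rewrite /divergence; under eq_bigr do rewrite derive_kfield mxE.
rewrite -Rintegral_sum//; apply: eq_Rintegral => xi _; apply: eq_bigr => i _.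
by rewrite dot_delta.
Qed.

End kernel_field.

(** * The field attached to a cube *)

Section product_integral.
Context d1 d2 (X : measurableType d1) (Y : measurableType d2) (R : realType).
Variables (m1 : {sigma_finite_measure set X -> \bar R}) (m2 : {sigma_finite_measure set Y -> \bar R}).
Variables (A : set X) (B : set Y) (mA : measurable A) (mB : measurable B).
Hypotheses (Aoo : (m1 A < +oo)%E) (Boo : (m2 B < +oo)%E).
Variables (f : X * Y -> R) (C : R).
Hypotheses (mf : measurable_fun setT f) (fC : forall p, A p.1 -> B p.2 -> `|f p| <= C).

Lemma product_measure_lty : ((m1 \x m2) (A `*` B) < +oo)%E.
Proof.
rewrite product_measure1E//.
by rewrite lte_mul_pinfty// ge0_fin_numE.
Qed.

Lemma Rintegral_prod :
  \int[(m1 \x m2)%E]_(p in A `*` B) f p = \int[m1]_(x in A) \int[m2]_(y in B) f (x, y).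
Proof.
have mAB : measurable (A `*` B) by exact: measurableX.
pose K := f \_ (A `*` B).
have KE x y : A x -> B y -> K (x, y) = f (x, y).
  by move=> Ax By; rewrite /K patchE mem_set.
have K0 x y : ~ B y -> K (x, y) = 0.
  by move=> By; rewrite /K patchE memNset// => -[].
have K0' x y : ~ A x -> K (x, y) = 0.
  by move=> Ax; rewrite /K patchE memNset// => -[].
have iK : (m1 \x m2)%E.-integrable setT (EFin \o K).
  rewrite /K -restrict_EFin -integrable_mkcond//.
  apply: (@bounded_integrable _ _ _ _ _ _ C) => //.
  - exact: product_measure_lty.
  - exact: measurable_funTS.
  - by move=> p [Ap Bp]; exact: fC.
rewrite Rintegral_mkcond -/K /Rintegral -integral12_prod_meas1// /fubini_F.
rewrite [in RHS]integral_mkcond; congr fine; apply: eq_integral => x _.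
rewrite patchE; case: ifPn => [/[!inE] Ax|]; last first.
  rewrite notin_setE => Ax; under eq_integral do rewrite /= K0'//.
  exact: integral0.
have iKt : m2.-integrable B (EFin \o (fun y => f (x, y))).
  apply: (@bounded_integrable _ _ _ _ _ _ C) => //.
    by apply: measurable_funTS; exact: (measurableT_comp mf (pair1_measurable x)).
  by move=> y By; exact: fC.
rewrite [in RHS]integral_mkcond fineK; last first.
  by rewrite -integral_mkcond; exact: integrable_fin_num.
apply: eq_integral => y _; rewrite patchE; case: ifPn => [/[!inE] By|].
  by rewrite /= KE.
by rewrite notin_setE => By; rewrite /= K0.
Qed.

End product_integral.

Lemma local_lipschitz_continuous (R : realType) (V W : normedModType R) (f : V -> W) (x : V) (r K : R) :
  0 < r -> (forall y, `|x - y| <= r -> `|f x - f y| <= K * `|x - y|) -> {for x, continuous f}.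
Proof.
move=> r0 fK; have K1 : 0 < `|K| + 1 by rewrite ltr_wpDl.
apply/cvgrPdist_le => e e0; have eK := divr_gt0 e0 K1; near=> y.
have xy : `|x - y| <= r by near: y; apply: (cvgr_dist_le id).
rewrite (le_trans (fK y xy))//.
apply: (@le_trans _ _ ((`|K| + 1) * `|x - y|)).
  by rewrite ler_wpM2r// (le_trans (ler_norm _))// lerDl.
rewrite -ler_pdivlMl// mulrC.
by near: y; apply: (cvgr_dist_le id).
Unshelve. all: by end_near. Qed.

Section disjoint_sums.
Context d (T : measurableType d) (R : realType) (mu : {measure set T -> \bar R}).

Lemma sum_Rintegral_disjoint_le (I : eqType) (s : seq I) (Q : I -> set T) (D : set T) (G : T -> R) :
  uniq s -> measurable D -> (forall i, i \in s -> measurable (Q i)) ->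
  (forall i, i \in s -> Q i `<=` D) ->
  (forall i j x, i \in s -> j \in s -> Q i x -> Q j x -> i = j) ->
  (forall x, D x -> 0 <= G x) -> mu.-integrable D (EFin \o G) ->
  \sum_(i <- s) \int[mu]_(x in Q i) G x <= \int[mu]_(x in D) G x.
Proof.
move=> us mD mQ QD disj G0 iG.
have iGQ i : i \in s -> mu.-integrable D (EFin \o (G \_ (Q i))).
  move=> si; rewrite -restrict_EFin.
  apply: (integrableS measurableT mD) => //.
  apply/(integrable_mkcond _ (mQ _ si)); apply: integrableS iG => //; [exact: mQ|exact: QD].
have E : \sum_(i <- s) \int[mu]_(x in Q i) G x = \int[mu]_(x in D) \sum_(i <- s | i \in s) (G \_ (Q i)) x.
  rewrite Rintegral_sum// big_seq; apply: eq_bigr => i si.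
  by rewrite -Rintegral_mkcondr setIidr//; exact: QD.
rewrite E; apply: le_Rintegral => //; first exact: integrable_sumR.
move=> x Dx; rewrite -big_seq.
have [[i0 si0 Qx]|noQ] := pselect (exists2 i, i \in s & Q i x).
  rewrite (bigD1_seq i0)//= patchE mem_set// big_seq_cond big1 ?addr0// => i /andP[si ii0].
  rewrite patchE memNset// => Qix; move: ii0; rewrite (disj i i0 x)// eqxx//.
rewrite big_seq big1 ?G0// => i si; rewrite patchE memNset// => Qix.
by apply: noQ; exists i.
Qed.

End disjoint_sums.

(** * Mollification of locally integrable functions *)

Section convolution.
Context {R : realType} {n : nat}.
Local Notation mu := (lebesgue_rV R n).
Local Notation V := ('rV[R]_n).
Implicit Types (f : V -> R) (x y z : V).

Lemma L1loc_integrable f r : L1loc f -> 0 <= r -> mu.-integrable (cball n r) (EFin \o f).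
Proof.
move=> [mf fK] r0; apply/integrableP; split.
  by apply/measurable_EFinP; exact: measurable_funTS.
exact: (fK _ (compact_cball r0)).
Qed.

Definition conv (d : R) f x : R := \int[mu]_y (f y * moll d (x - y)).

(** [f] is only locally integrable; the support of [moll] confines the integral to one set common to
    all [x] in [cball n r], the form in which Fubini and the L^1 bounds apply. *)
Lemma conv_local d f r x : 0 < d -> cball n r x -> 0 <= r ->
  conv d f x = \int[mu]_(y in cball n (r + d)) (f y * moll d (x - y)).
Proof.
move=> d0 xr r0; rewrite [RHS]Rintegral_mkcond; apply: eq_Rintegral => y _.
rewrite patchE; case: ifPn => //; rewrite notin_setE => yr.
rewrite moll_out ?mulr0// leNgt; apply/negP => xy; apply: yr.
apply/cballE; first by rewrite addr_ge0// ltW.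
rewrite -(subrK x y) addrC (le_trans (ler_normD _ _))// lerD//.
  by apply/cballE.
by rewrite -normrN opprB (le_trans (norm_le_enorm _))// ltW.
Qed.

Let measurable_moll_sub d x : measurable_fun setT (fun y : V => moll d (x - y)).
Proof.
apply: (measurableT_comp (measurable_moll d)).
exact: (@measurable_subrV2 R n _ _ (cst x)).
Qed.

Lemma integrable_conv d f r x : 0 < d -> L1loc f -> 0 <= r ->
  mu.-integrable (cball n r) (EFin \o (fun y => f y * moll d (x - y))).
Proof.
move=> d0 hf r0; apply: (integrableM_bounded (C := @moll_max R n d)).
- exact: measurable_cball.
- exact: L1loc_integrable.
- by apply: measurable_funTS; exact: measurable_moll_sub.
- by move=> y _; exact: moll_le.
Qed.

Lemma continuous_conv d f : 0 < d -> L1loc f -> continuous (conv d f).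
Proof.
move=> d0 hf x; pose r := `|x| + 1.
have r0 : 0 <= r by rewrite addr_ge0.
have rd0 : 0 <= r + d by rewrite addr_ge0// ltW.
pose J := \int[mu]_(y in cball n (r + d)) `|f y|.
have J0 : 0 <= J by exact: Rintegral_ge0.
have xr : cball n r x by apply/cballE => //; rewrite lerDl.
have fi := L1loc_integrable hf rd0.
have mC := @measurable_cball R n (r + d).
apply: (@local_lipschitz_continuous _ _ _ _ _ 1 ((@moll_lip R n d * n%:R) * J)) => // y xy.
have yr : cball n r y.
  by apply/cballE => //; rewrite -(subrK x y) addrC (le_trans (ler_normD _ _))// lerD2l distrC.
have iB := integrableBR mC (integrable_conv x d0 hf rd0) (integrable_conv y d0 hf rd0).
have i1 := integrable_norm fi.
rewrite !(@conv_local _ _ r)// -RintegralB//; try exact: integrable_conv.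
apply: (le_trans (le_normr_Rintegral mC iB)).
rewrite mulrAC -RintegralZl//.
apply: le_Rintegral => //; [exact: integrable_norm iB|exact: integrableZlR|].
move=> t _; rewrite -mulrBr normrM [leRHS]mulrC ler_wpM2l// (le_trans (moll_lipschitz d0 _ _))//.
rewrite opprB addrA subrK -[leRHS]mulrA ler_wpM2l ?moll_lip_ge0//.
exact: enorm_le_norm.
Qed.

End convolution.

Section cube_kernel.
Context {R : realType} {n : nat}.
Local Notation mu := (lebesgue_rV R n).
Local Notation lam := (@lebesgue_measure R).
Local Notation V := ('rV[R]_n).
Variables (d : R) (d0 : 0 < d).

Lemma is_derive_moll_segment (y z u : V) (t : R) :
  is_derive (t : R^o) (1 : R^o) (fun t : R => moll d (y - (z + t *: u)) : R^o)
    (- dot (dmoll d (y - (z + t *: u))) u).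
Proof.
apply: (@is_derive_quadratic _ _ _ _ _ _ _ (@moll_C2 R n d * dot u u)) => s.
have -> : y - (z + ((s *: (1 : R^o) : R^o) + t) *: u) = y - (z + t *: u) + (- s) *: u.
  have -> : (s *: (1 : R^o) : R^o) = s by rewrite /GRing.scale/= mulr1.
  by rewrite scalerDl scaleNr (addrC (s *: u)) addrA opprD addrA.
have := moll_quadratic d0 (y - (z + t *: u)) ((- s) *: u).
have -> : dot ((- s) *: u) ((- s) *: u) = dot u u * s ^+ 2 by rewrite dotZl dotZr; ring.
have -> : dot (dmoll d (y - (z + t *: u))) ((- s) *: u) = s *: (- dot (dmoll d (y - (z + t *: u))) u : R^o).
  by rewrite dotZr /GRing.scale/= mulNr mulrN.
by rewrite mulrA.
Qed.

(** This is where the field of a cube originates: against a function of mean zero on the cube,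
    [moll d (y - w)] may be replaced by its increment from the centre, and that increment is an
    integral of gradients along the segment from [z] to [w]. *)
Lemma moll_segment (y z w : V) :
  moll d (y - w) - moll d (y - z) =
  \int[lam]_(t in `[0, 1]) (- dot (dmoll d (y - (z + t *: (w - z)))) (w - z)).
Proof.
have cseg : continuous (fun t : R => y - (z + t *: (w - z)) : V).
  move=> t; apply: (@lipschitz_continuous _ R^o V _ `|w - z|) => a b.
  rewrite opprB [X in `|X|]addrC addrA subrK opprD addrACA subrr add0r -scaleNr -scalerDl normrZ.
  by rewrite [X in X <= _]mulrC -(normrN (b - a)) opprB; exact: lexx.
have cd : continuous (fun t : R => dot (dmoll d (y - (z + t *: (w - z)))) (w - z)).
  apply: continuous_big => [|i _]; first exact: add_continuous.
  apply: continuous_mulR; last by move=> t; exact: cst_continuous.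
  exact: (continuous_compose cseg (@continuous_dmoll R n d i)).
have cf : continuous (fun t : R => - dot (dmoll d (y - (z + t *: (w - z)))) (w - z)).
  by move=> t; apply: cvgN; exact: cd.
rewrite (FTC_everywhere ltr01 cf (is_derive_moll_segment y z (w - z))).
by rewrite scale1r scale0r addr0 (addrC z) subrK.
Qed.

Variables (z : V) (O : 'M[R]_n) (h : R) (h0 : 0 < h) (OO : O *m O^T = 1%:M).
Let Q := ocube z O h.
Variables (s : V -> R) (ms : measurable_fun setT s) (s1 : forall x, `|s x| <= 1).

Let mQ : measurable Q. Proof. exact: measurable_ocube. Qed.
Let Qoo : (mu Q < +oo)%E. Proof. by rewrite lebesgue_ocube// ltry. Qed.
Let q := fine (mu Q).
Let qE : q = (2 * h) ^+ n. Proof. by rewrite /q lebesgue_ocube. Qed.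
Let q0 : 0 < q. Proof. by rewrite qE exprn_gt0// mulr_gt0. Qed.

Let sbar := q^-1 * \int[mu]_(x in Q) s x.
Definition centred_sign x := s x - sbar.
Local Notation psi := centred_sign.

Let bdQ (g : V -> R) C : measurable_fun setT g -> (forall x, Q x -> `|g x| <= C) ->
  mu.-integrable Q (EFin \o g).
Proof. by move=> mg gC; apply: (bounded_integrable (C := C)) => //; exact: measurable_funTS. Qed.

Let is_ : mu.-integrable Q (EFin \o s). Proof. exact: (bdQ (C := 1)). Qed.

Let sbar1 : `|sbar| <= 1.
Proof.
rewrite normrM ger0_norm ?invr_ge0 ?(ltW q0)// ler_pdivrMl// mulr1 -[leRHS]mul1r.
exact: normr_Rintegral_le.
Qed.

Lemma measurable_centred_sign : measurable_fun setT psi.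
Proof. exact: measurable_funB. Qed.

Lemma centred_sign_le x : `|psi x| <= 2.
Proof. by rewrite (le_trans (ler_normB _ _))// -[2]/(1 + 1) lerD. Qed.

Let ipsi : mu.-integrable Q (EFin \o psi).
Proof. by apply: (bdQ (C := 2)); [exact: measurable_centred_sign|move=> *; exact: centred_sign_le]. Qed.

Lemma Rintegral_centred_sign : \int[mu]_(x in Q) psi x = 0.
Proof.
rewrite RintegralB//; last by apply: (bdQ (C := `|sbar|)).
by rewrite Rintegral_cst// -/q /sbar mulrAC mulVf ?gt_eqF// mul1r subrr.
Qed.

Let dist_Q w : Q w -> enorm (w - z) <= n%:R * h.
Proof. by apply: ocube_dist => //; exact: ltW. Qed.

Let mdot e : measurable_fun setT (fun w : V => dot (w - z) e).
Proof.
under eq_fun do rewrite dotBl dotC.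
apply: measurable_funB => //; apply: continuous_measurable_rV; exact: continuous_dotl.
Qed.

Let dot_Q e w : Q w -> `|dot (w - z) e| <= n%:R * h * enorm e.
Proof.
by move=> Qw; rewrite (le_trans (normr_dot_le _ _))// ler_wpM2r ?enorm_ge0// dist_Q.
Qed.

Let idot e : mu.-integrable Q (EFin \o (fun w => dot (w - z) e)).
Proof. by apply: (bdQ (C := n%:R * h * enorm e)) => // w; exact: dot_Q. Qed.

Let dotE e v : dot (z + v *m O - z) e = dot (e *m O^T) v.
Proof. by rewrite (addrC z) addrK dotC dot_mulmx. Qed.

Lemma Rintegral_ocube_dot e : \int[mu]_(w in Q) dot (w - z) e = 0.
Proof.
rewrite /Q Rintegral_ocube//; last exact: measurable_funTS.
have mU := @measurable_ucube R n h.
have cid : continuous (@id R) by move=> x; exact: cvg_id.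
have i1 := integrable_comp_dot (e *m O^T) h0 cid.
under eq_Rintegral do rewrite dotE.
have := @Rintegral_ucubeN R n h (dot (e *m O^T)).
move/(_ (measurable_funTS (measurable_comp_dot _ cid))).
under eq_Rintegral do rewrite dotNr -mulN1r.
rewrite RintegralZl//.
by move: (Rintegral _ _ _) => J; lra.
Qed.

Lemma Rintegral_ocube_normr_dot e :
  \int[mu]_(w in Q) `|dot (w - z) e| <= q * (h / 2) * enorm e.
Proof.
rewrite /Q Rintegral_ocube//; last by apply: measurable_funTS; apply: measurableT_comp.
under eq_Rintegral do rewrite dotE.
rewrite (le_trans (Rintegral_normr_dot_le _ h0))// qE.
by rewrite enorm_orth// trmxK (mulmx1C OO).
Qed.

(** The mean subtracted in [psi] contributes nothing, as the first moments about the centre vanish.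
    The bound is thus that of [s], of modulus at most 1, although [psi] itself is only known to be
    bounded by 2. *)
Lemma Rintegral_centred_sign_dot e :
  `|\int[mu]_(w in Q) (psi w * dot (w - z) e)| <= q * (h / 2) * enorm e.
Proof.
have isd : mu.-integrable Q (EFin \o (fun w => s w * dot (w - z) e)).
  apply: (bdQ (C := 1 * (n%:R * h * enorm e))); first exact: measurable_funM.
  by move=> w Qw; rewrite normrM ler_pM// dot_Q.
under eq_Rintegral do rewrite mulrBl.
rewrite RintegralB//; last exact: integrableZlR.
rewrite RintegralZl// Rintegral_ocube_dot mulr0 subr0.
rewrite (le_trans _ (Rintegral_ocube_normr_dot e))// (le_trans (le_normr_Rintegral _ _))//.
apply: le_Rintegral => //; [exact: integrable_norm isd|exact: integrable_norm (idot e)|].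
by move=> w Qw; rewrite normrM ler_piMl.
Qed.

End cube_kernel.

Section C1c_sums.
Context {R : realType} {n : nat}.
Local Notation V := ('rV[R]_n).
Implicit Types phi psi : V -> V.

Lemma C1c_derivable phi x v : C1c phi -> derivable phi x v.
Proof. by move=> [dphi _ _]; exact: diff_derivable. Qed.

Lemma C1c_support phi : C1c phi -> exists2 r, 0 < r & forall x, ~ cball n r x -> phi x = 0.
Proof.
move=> [_ _ /compact_sub_cball[r r0 hr]]; exists r => // x xr.
apply/eqP; rewrite -[_ == _]negbK; apply/negP => x0; apply: xr; apply: hr.
by apply: subset_closure.
Qed.

Lemma C1c0 : C1c (fun _ : V => 0 : V).
Proof.
split => [x|v|]; first exact: differentiable_cst.
  by move=> x; rewrite (_ : 'D_v _ = cst 0);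
    [exact: cst_continuous|apply/funext => y; exact: derive_cst].
rewrite (_ : [set x : V | _] = set0); first by rewrite closure0; exact: compact0.
by apply/seteqP; split => // x; rewrite /= eqxx.
Qed.

Lemma C1cD phi psi : C1c phi -> C1c psi -> C1c (fun x => phi x + psi x).
Proof.
move=> hphi hpsi; have [r1 r10 h1] := C1c_support hphi; have [r2 r20 h2] := C1c_support hpsi.
split => [x|v|].
- by apply: differentiableD; [have [] := hphi|have [] := hpsi].
- rewrite (_ : 'D_v _ = (fun x => 'D_v phi x + 'D_v psi x)).
    have [_ c1 _] := hphi; have [_ c2 _] := hpsi.
    by move=> x; apply: (@continuousD _ _ _ ('D_v phi) ('D_v psi) x); [exact: (c1 v x)|exact: (c2 v x)].
  by apply/funext => x; rewrite deriveD//; exact: C1c_derivable.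
- apply: (@compact_closure_cball _ _ (r1 + r2)); first by rewrite addr_ge0// ltW.
  move=> x /= x0; apply/cballE; first by rewrite addr_ge0// ltW.
  rewrite leNgt; apply: contra x0 => xr; apply/eqP.
  have nb r : 0 < r -> r <= r1 + r2 -> ~ cball n r x.
    by move=> r0 rr /(cballE _ (ltW r0)); rewrite leNgt (le_lt_trans rr).
  by rewrite h1 ?h2 ?addr0//; apply: nb => //; rewrite ?lerDl ?lerDr ltW.
Qed.

Lemma divergenceD phi psi x : C1c phi -> C1c psi ->
  divergence (fun x => phi x + psi x) x = divergence phi x + divergence psi x.
Proof.
move=> hphi hpsi; rewrite /divergence -big_split/=; apply: eq_bigr => i _.
by rewrite deriveD ?mxE//; exact: C1c_derivable.
Qed.

Lemma divergence0 x : divergence (fun _ : V => 0 : V) x = 0.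
Proof.
by rewrite /divergence big1// => i _; rewrite derive_cst mxE.
Qed.

Lemma C1c_sum (I : Type) (s : seq I) (F : I -> V -> V) :
  (forall i, C1c (F i)) -> C1c (fun x => \sum_(i <- s) F i x).
Proof.
move=> hF; elim: s => [|i s IH].
  by under eq_fun do rewrite big_nil; exact: C1c0.
by under eq_fun do rewrite big_cons; exact: C1cD.
Qed.

Lemma divergence_sum (I : Type) (s : seq I) (F : I -> V -> V) x :
  (forall i, C1c (F i)) -> divergence (fun x => \sum_(i <- s) F i x) x = \sum_(i <- s) divergence (F i) x.
Proof.
move=> hF; elim: s => [|i s IH].
  by under [X in divergence X]eq_fun do rewrite big_nil; rewrite big_nil divergence0.
under [X in divergence X]eq_fun do rewrite big_cons.
by rewrite divergenceD ?IH ?big_cons//; exact: C1c_sum.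
Qed.

End C1c_sums.

(** The arithmetic closing [dot_cube_field_le]: [N] is the dimension, [L] the Lipschitz constant of
    the mollifier, [q] the volume of the cube and [m] the value of the mollifier at the centre. With
    [P] the common factor, the two sides differ by [P N^2 - P N / 4]. *)
Lemma scalar_majorant (R : realFieldType) (kap N h e L q m : R) :
  0 <= 2 * h * kap * e * q * L * h -> N <= N ^+ 2 ->
  kap * 2 * (N * h) * e * (L * (N * h)) * q + m * (kap * (q * (h / 2) * e)) <=
  2 * h * kap * e * ((m - L * (N * h)) * q / 4 + 2 * N ^+ 2 * h * L * q).
Proof.
move=> P0 n2; have := ler_wpM2l P0 n2; have := mulr_ge0 P0 (sqr_ge0 N).
set P := _ * h in P0 *; rewrite -subr_ge0 => H1; rewrite -subr_ge0 => H2.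
rewrite -subr_ge0 (_ : _ - _ = (P * N ^+ 2 - P * N) / 4 + 3 / 4 * (P * N ^+ 2)); last by rewrite /P; field.
by move: H2; rewrite subr0 => H2; rewrite addr_ge0 ?divr_ge0// mulr_ge0// divr_ge0.
Qed.

Section cube_field.
Context {R : realType} {n : nat}.
Local Notation mu := (lebesgue_rV R n).
Local Notation lam := (@lebesgue_measure R).
Local Notation V := ('rV[R]_n).
Variables (d : R) (d0 : 0 < d) (n0 : (0 < n)%N).
Variables (z : V) (O : 'M[R]_n) (h : R) (h0 : 0 < h) (OO : O *m O^T = 1%:M).
Local Notation Q := (ocube z O h).
Variables (s : V -> R) (ms : measurable_fun setT s) (s1 : forall x, `|s x| <= 1).
Variables (kap : R) (kap0 : 0 <= kap).
Local Notation psi := (centred_sign z O h s).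
Local Notation X := (V * measurableTypeR R)%type.
Let J : set (measurableTypeR R) := `[0, 1]%classic.
Let A : set X := Q `*` J.
Let k (p : X) : V := (- (kap * psi p.1)) *: (p.1 - z).
Let c (p : X) : V := z + (p.2 : R) *: (p.1 - z).

Definition cube_field (x : V) : V := kfield d (mu \x lam)%E A k c x.

Let mJ : measurable J. Proof. exact: measurable_itv. Qed.
Let lamJ : lam J = 1%E.
Proof. by rewrite /J lebesgue_measure_itv/= lte_fin ltr01 -EFinD subr0. Qed.
Let Joo : (lam J < +oo)%E. Proof. by rewrite lamJ ltry. Qed.
Let mQ : measurable Q. Proof. exact: measurable_ocube. Qed.
Let Qoo : (mu Q < +oo)%E. Proof. by rewrite lebesgue_ocube// ltry. Qed.
Let mA : measurable A. Proof. exact: measurableX. Qed.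
Let Aoo : ((mu \x lam) A < +oo)%E. Proof. exact: product_measure_lty. Qed.
Let q := fine (mu Q).
Let Aq : fine ((mu \x lam)%E A) = q.
Proof. by rewrite product_measure1E//= lamJ mule1. Qed.
Let q0 : 0 < q. Proof. by rewrite /q lebesgue_ocube//= exprn_gt0// mulr_gt0. Qed.

Let mpsi1 : measurable_fun setT (fun p : X => psi p.1).
Proof. exact: (measurableT_comp (measurable_centred_sign z O h ms) measurable_fst). Qed.

Let msub : measurable_fun setT (fun p : X => p.1 - z).
Proof. exact: (measurableT_comp (@measurable_addrV R n (- z)) measurable_fst). Qed.

Let msubi i : measurable_fun setT (fun p : X => (p.1 - z) ord0 i).
Proof. exact: (measurableT_comp (@measurable_coord R n i) msub). Qed.

Let mk : measurable_fun setT k.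
Proof.
apply: measurable_fun_rV => i; under eq_fun do rewrite mxE.
apply: measurable_funM => //; apply: measurableT_comp => //.
by apply: measurable_funM => //; exact: measurable_cst.
Qed.

Let mc : measurable_fun setT c.
Proof.
apply: measurable_fun_rV => i; under eq_fun do rewrite !mxE -/(_ - _).
apply: measurable_funD => //; apply: measurable_funM; first exact: measurable_snd.
by have := msubi i; under eq_fun do rewrite !mxE.
Qed.

Let dist_Q w : Q w -> enorm (w - z) <= n%:R * h.
Proof. by apply: ocube_dist => //; exact: ltW. Qed.

Let nh0 : 0 <= n%:R * h. Proof. by rewrite mulr_ge0// ltW. Qed.

Let psi2 w : `|psi w| <= 2. Proof. exact: centred_sign_le. Qed.

Let kB p : A p -> enorm (k p) <= kap * 2 * (n%:R * h).
Proof.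
move=> [Qp _]; rewrite /k enormZ normrN normrM (ger0_norm kap0).
by apply: ler_pM; rewrite ?mulr_ge0 ?enorm_ge0// ?dist_Q// ler_wpM2l.
Qed.

Let cz p : A p -> enorm (c p - z) <= n%:R * h.
Proof.
move=> [Qp Jp]; rewrite /c (addrC z) addrK enormZ.
move: Jp; rewrite /J/= in_itv/= => /andP[t0 t1].
by rewrite ger0_norm// (le_trans _ (dist_Q Qp))// ler_piMl ?enorm_ge0.
Qed.

Let M := enorm z + n%:R * h.
Let M0 : 0 <= M. Proof. by rewrite addr_ge0// enorm_ge0. Qed.
Let cM p : A p -> enorm (c p) <= M.
Proof.
by move=> Ap; rewrite -(subrK z (c p)) addrC (le_trans (enormD _ _))// lerD2l cz.
Qed.

Let B := kap * 2 * (n%:R * h).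
Let B0 : 0 <= B. Proof. by apply: mulr_ge0 => //; exact: mulr_ge0. Qed.

Lemma C1c_cube_field : C1c cube_field.
Proof. exact: (C1c_kfield d0 mA Aoo mk mc B0 M0 kB cM). Qed.

(** For fixed [w] the integral over the segment is an increment of the mollifier, by [moll_segment];
    its value at the centre [z] drops out because [psi] has mean 0. *)
Lemma divergence_cube_field y :
  divergence cube_field y = kap * \int[mu]_(w in Q) (psi w * moll d (w - y)).
Proof.
rewrite (divergence_kfield d0 mA Aoo mk mc B0 kB).
pose F (p : X) := dot (k p) (dmoll d (y - c p)).
have mF : measurable_fun setT F.
  apply: measurable_sum => i; apply: measurable_funM.
    exact: (measurableT_comp (@measurable_coord R n i) mk).
  apply: (measurableT_comp (@measurable_coord R n i)).
  apply: (measurableT_comp (measurable_dmoll d)).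
  exact: (@measurable_subrV2 R n _ _ (cst y)).
have FC p : Q p.1 -> J p.2 -> `|F p| <= @moll_lip R n d * B.
  move=> Qp Jp; rewrite /F dotC (le_trans (dmoll_le d0 _ _))//.
  by rewrite ler_wpM2l ?moll_lip_ge0//; exact: kB.
rewrite (@Rintegral_prod _ _ _ _ _ mu lam Q J mQ mJ Qoo Joo F _ mF FC).
transitivity (\int[mu]_(w in Q) (kap * (psi w * moll d (w - y) - moll d (y - z) * psi w))).
  apply: eq_Rintegral => w _; rewrite /F /k /c/=.
  under eq_Rintegral do rewrite dotZl dotC mulNr -mulrN.
  rewrite RintegralZl//; last first.
    apply: (bounded_integrable (C := @moll_lip R n d * enorm (w - z))) => //.
      apply: measurable_funTS; apply: measurableT_comp => //.
      apply: (measurableT_comp (measurable_dot_dmoll d (w - z))).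
      apply: (@measurable_subrV2 R n _ _ (cst y)) => //.
      apply: (@measurable_addrV2 R n _ _ (cst z)) => //.
      apply: measurable_fun_rV => i; under eq_fun do rewrite mxE.
      exact: (@measurable_funM _ _ _ _ id).
    by move=> t _; rewrite normrN dmoll_le.
  by rewrite -(moll_segment d0) -mulrA mulrBr; congr (_ * (_ - _)); [rewrite -mollN opprB|rewrite mulrC].
have i1 : mu.-integrable Q (EFin \o psi).
  apply: (bounded_integrable (C := 2)) => //.
  by apply: measurable_funTS; exact: measurable_centred_sign.
have i2 : mu.-integrable Q (EFin \o (fun w => psi w * moll d (w - y))).
  apply: (integrableM_bounded (C := @moll_max R n d)) => //.
    apply: measurable_funTS; apply: (measurableT_comp (measurable_moll d)).
    exact: measurable_addrV.
  by move=> w _; exact: moll_le.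
rewrite RintegralZl//; last by apply: integrableBR => //; exact: integrableZlR.
rewrite RintegralB//; last exact: integrableZlR.
by rewrite RintegralZl// Rintegral_centred_sign// mulr0 subr0.
Qed.

Definition field_error := 2 * n%:R ^+ 2 * h * @moll_lip R n d.

(** Made to be integrated in [w]: over disjoint cubes the integrals add up to at most the total
    mass, so the sum of the fields is bounded at [x] without counting cubes. The first term has mass
    1/4; the second pays for freezing the mollifier on a cube and lives on a set containing every
    cube whose field can be nonzero at [x]. *)
Definition field_majorant (x w : V) : R :=
  moll d (x - w) / 4 + field_error * \1_(cball n (d + 2 * n%:R * h)) (w - x).

Let lip0 : 0 <= @moll_lip R n d. Proof. exact: moll_lip_ge0. Qed.

Lemma field_error_ge0 : 0 <= field_error.
Proof. by apply: mulr_ge0 => //; rewrite mulr_ge0 ?(ltW h0)// mulr_ge0// sqr_ge0. Qed.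

Lemma field_majorant_ge0 x w : 0 <= field_majorant x w.
Proof.
apply: addr_ge0; first by rewrite divr_ge0// moll_ge0.
by rewrite mulr_ge0// field_error_ge0.
Qed.

Let r0 : 0 <= d + 2 * n%:R * h.
Proof. by rewrite addr_ge0 ?(ltW d0)// -mulrA mulr_ge0. Qed.

Lemma integrable_moll_sub x : mu.-integrable setT (EFin \o (fun w => moll d (x - w))).
Proof.
have E := @measurable_subrV2 R n _ _ (cst x) id (measurable_cst _) (@measurable_id _ _ _).
have hp (S : set V) : measurable S -> mu ((fun w => x - w) @^-1` S) = mu S.
  move=> mS; have mS' : measurable [set w : V | S (w + x)] by exact: (measurable_preimage (measurable_addrV x)).
  rewrite -(lebesgue_rV_shift x mS) -(lebesgue_rV_opp mS'); congr (mu _).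
  by apply/seteqP; split => w /=; rewrite addrC.
have := integrable_preserving E hp measurableT (integrable_moll d0).
by rewrite preimage_setT.
Qed.

Lemma Rintegral_moll_sub x : \int[mu]_w moll d (x - w) = 1.
Proof.
have E := @measurable_subrV2 R n _ _ (cst x) id (measurable_cst _) (@measurable_id _ _ _).
have hp (S : set V) : measurable S -> mu ((fun w => x - w) @^-1` S) = mu S.
  move=> mS; have mS' : measurable [set w : V | S (w + x)] by exact: (measurable_preimage (measurable_addrV x)).
  rewrite -(lebesgue_rV_shift x mS) -(lebesgue_rV_opp mS'); congr (mu _).
  by apply/seteqP; split => w /=; rewrite addrC.
rewrite -(@Rintegral_moll R n d d0).
rewrite -(Rintegral_preserving E hp measurableT (measurable_moll d)).
by rewrite preimage_setT.
Qed.

Let mcomp x : measurable_fun setT (fun p : X => moll d (x - c p)).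
Proof.
apply: (measurableT_comp (measurable_moll d)).
exact: (@measurable_subrV2 R n _ _ (cst x)).
Qed.

Let mdotk e : measurable_fun setT (fun p : X => dot (k p) e).
Proof.
apply: measurable_sum => i; apply: measurable_funM => //.
exact: (measurableT_comp (@measurable_coord R n i) mk).
Qed.

Let dotkB e p : A p -> `|dot (k p) e| <= B * enorm e.
Proof.
by move=> Ap; rewrite (le_trans (normr_dot_le _ _))// ler_wpM2r ?enorm_ge0//; exact: kB.
Qed.

Let cube_field_dotE x e :
  dot (cube_field x) e = \int[(mu \x lam)%E]_(p in A) (dot (k p) e * moll d (x - c p)).
Proof.
have ik i : (mu \x lam)%E.-integrable A (EFin \o (fun p => k p ord0 i * moll d (x - c p))).
  apply: (bounded_integrable (C := B * @moll_max R n d)) => //.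
    apply: measurable_funTS; apply: measurable_funM => //.
    exact: (measurableT_comp (@measurable_coord R n i) mk).
  move=> p Ap; rewrite normrM ler_pM// ?moll_le//.
  by rewrite (le_trans (coord_le_enorm _ _))//; exact: kB.
transitivity (\sum_(i < n) \int[(mu \x lam)%E]_(p in A) (e ord0 i * (k p ord0 i * moll d (x - c p)))).
  by apply: eq_bigr => i _; rewrite RintegralZl// mulrC mxE.
rewrite -Rintegral_sum//; last by move=> i _; exact: integrableZlR.
apply: eq_Rintegral => p _; rewrite /dot mulr_suml; apply: eq_bigr => i _.
by rewrite mulrA (mulrC (e ord0 i)).
Qed.

Let int_dotk e : `|\int[(mu \x lam)%E]_(p in A) dot (k p) e| <= kap * (q * (h / 2) * enorm e).
Proof.
rewrite (@Rintegral_prod _ _ _ _ _ mu lam Q J mQ mJ Qoo Joo _ _ (mdotk e) (fun p Qp Jp => dotkB e (conj Qp Jp))).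
have E w : \int[lam]_(t in J) dot (k (w, t)) e = - kap * (psi w * dot (w - z) e).
  have fJ : fine (lam J) = 1 by rewrite lamJ.
  by rewrite /k/= Rintegral_cst// fJ mulr1 dotZl; ring.
under eq_Rintegral do rewrite E.
rewrite RintegralZl//; last first.
  apply: (bounded_integrable (C := 2 * (n%:R * h * enorm e))) => //.
    apply: measurable_funTS; apply: measurable_funM; first exact: measurable_centred_sign.
    under eq_fun do rewrite dotBl dotC.
    by apply: measurable_funB => //; apply: continuous_measurable_rV; exact: continuous_dotl.
  move=> w Qw; rewrite normrM ler_pM//.
  by rewrite (le_trans (normr_dot_le _ _))// ler_wpM2r ?enorm_ge0// dist_Q.
rewrite normrM normrN (ger0_norm kap0) ler_wpM2l//.
exact: Rintegral_centred_sign_dot.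
Qed.

Let enormB_ge (a b : V) : enorm a - enorm b <= enorm (a - b).
Proof. by rewrite lerBlDr (le_trans _ (enormD _ _))// subrK. Qed.

Lemma dot_cube_field_le x e :
  dot (cube_field x) e <= 2 * h * kap * enorm e * \int[mu]_(w in Q) field_majorant x w.
Proof.
have e0 := enorm_ge0 e.
have hk0 : 0 <= 2 * h * kap * enorm e.
  by apply: mulr_ge0 => //; apply: mulr_ge0 => //; apply: mulr_ge0 => //; exact: ltW.
(* All the points [c p] lie within [n h] of [z], so for a far [x] the mollifier vanishes at each
   [x - c p]. *)
have [far|near] := leP (d + n%:R * h) (enorm (x - z)).
  rewrite cube_field_dotE (_ : \int[_]_(p in A) _ = 0); last first.
    rewrite -[RHS](mul0r q) -Aq -Rintegral_cst//; apply: eq_Rintegral => p /[!inE] Ap.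
    rewrite moll_out ?mulr0//.
    have := enormB_ge (x - z) (c p - z); rewrite opprB addrA subrK => H.
    by have := cz Ap; lra.
  by rewrite mulr_ge0// Rintegral_ge0// => w _; exact: field_majorant_ge0.
have imQ : mu.-integrable Q (EFin \o (fun w => moll d (x - w))) by exact: integrableS (integrable_moll_sub x).
have majE : \int[mu]_(w in Q) field_majorant x w = (\int[mu]_(w in Q) moll d (x - w)) / 4 + field_error * q.
  transitivity (\int[mu]_(w in Q) (moll d (x - w) * 4^-1 + field_error)).
    apply: eq_Rintegral => w /[!inE] Qw; rewrite /field_majorant indicE mem_set ?mulr1//.
    apply/cballE => //; rewrite (le_trans (norm_le_enorm _))//.
    have := enormD (w - z) (z - x); rewrite addrA subrK => H.
    have := dist_Q Qw; have : enorm (z - x) = enorm (x - z) by rewrite -enormN opprB.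
    move: near H; move: (n%:R : R) => N; lra.
  rewrite RintegralD//.
  - by rewrite RintegralZr// Rintegral_cst.
  - have := integrableZlR 4^-1 mQ imQ; apply: eq_integrable => // w _ /=.
    by rewrite mulrC.
  - by apply: (bounded_integrable (C := `|field_error|)).
have intQ : (moll d (x - z) - @moll_lip R n d * (n%:R * h)) * q <= \int[mu]_(w in Q) moll d (x - w).
  rewrite -Rintegral_cst//; apply: le_Rintegral => //.
    by apply: (bounded_integrable (C := `|moll d (x - z) - @moll_lip R n d * (n%:R * h)|)).
  move=> w Qw; have := moll_lipschitz d0 (x - z) (x - w).
  rewrite opprB (addrC (x - z)) addrA subrK => H.
  have : @moll_lip R n d * enorm (w - z) <= @moll_lip R n d * (n%:R * h).
    by rewrite ler_wpM2l// dist_Q.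
  by move: H; rewrite ler_norml => /andP[_]; lra.
have split_dot : dot (cube_field x) e <= B * enorm e * (@moll_lip R n d * (n%:R * h)) * q +
    moll d (x - z) * (kap * (q * (h / 2) * enorm e)).
  have i1 : (mu \x lam)%E.-integrable A (EFin \o (fun p => dot (k p) e)).
    apply: (bounded_integrable (C := B * enorm e)) => //; first exact: measurable_funTS.
    by move=> p; exact: dotkB.
  have i2 : (mu \x lam)%E.-integrable A (EFin \o (fun p => dot (k p) e * moll d (x - c p))).
    apply: (integrableM_bounded (C := @moll_max R n d)) => //; first exact: measurable_funTS.
    by move=> p _; exact: moll_le.
  have i3 : (mu \x lam)%E.-integrable A (EFin \o (fun p => dot (k p) e * moll d (x - z))).
    by apply: (integrableM_bounded (C := @moll_max R n d)) => // p _; exact: moll_le.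
  rewrite -[leLHS](subrK (moll d (x - z) * \int[(mu \x lam)%E]_(p in A) dot (k p) e)).
  apply: lerD.
    rewrite cube_field_dotE -RintegralZl//; under [X in _ - X]eq_Rintegral do rewrite mulrC.
    rewrite -RintegralB// (le_trans (ler_norm _))// -Aq.
    apply: normr_Rintegral_le => //; first exact: integrableBR.
    move=> p Ap; rewrite -mulrBr normrM ler_pM//; first exact: dotkB.
    rewrite (le_trans (moll_lipschitz d0 _ _))// ler_wpM2l//.
    by rewrite opprB addrC addrA subrK -enormN opprB cz.
  by rewrite ler_wpM2l ?moll_ge0// (le_trans (ler_norm _))// int_dotk.
rewrite (le_trans split_dot)// majE.
have n1 : 1 <= n%:R :> R by rewrite ler1n.
have n2 : n%:R <= n%:R ^+ 2 :> R by rewrite expr2 ler_peMl.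
apply: (@le_trans _ _ (2 * h * kap * enorm e * ((moll d (x - z) - @moll_lip R n d * (n%:R * h)) * q / 4 + field_error * q))); last first.
  by rewrite ler_wpM2l// lerD2r ler_wpM2r// invr_ge0.
have P0 : 0 <= 2 * h * kap * enorm e * q * @moll_lip R n d * h.
  by apply: mulr_ge0; [apply: mulr_ge0 => //; apply: mulr_ge0 => //; exact: ltW|exact: ltW].
rewrite /field_error /B; exact: scalar_majorant.
Qed.

Let iind x : mu.-integrable setT (EFin \o (fun w => \1_(cball n (d + 2 * n%:R * h)) (w - x) : R)).
Proof.
have E := @measurable_addrV R n (- x).
have hp (S : set V) : measurable S -> mu ((fun w => w - x) @^-1` S) = mu S.
  by move=> mS; rewrite -(lebesgue_rV_shift (- x) mS).
have iS : mu.-integrable setT (EFin \o (\1_(cball n (d + 2 * n%:R * h)) : V -> R)).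
  have mb : measurable (cball n (d + 2 * n%:R * h) : set V) by exact: measurable_cball.
  apply/integrableP; split; first by apply/measurable_EFinP; exact: measurable_indic.
  under eq_integral do rewrite /= ger0_norm//.
  by rewrite integral_indic ?setIT//; exact: lebesgue_cball_lty.
have := integrable_preserving E hp measurableT iS.
by rewrite preimage_setT.
Qed.

Lemma integrable_field_majorant x : mu.-integrable setT (EFin \o field_majorant x).
Proof.
apply: integrableDR => //; last exact: (integrableZlR _ measurableT (iind x)).
by have := integrableZlR 4^-1 measurableT (integrable_moll_sub x); apply: eq_integrable => // w _ /=; rewrite mulrC.
Qed.

Lemma Rintegral_field_majorant x :
  \int[mu]_w field_majorant x w = 4^-1 + field_error * (2 * (d + 2 * n%:R * h)) ^+ n.
Proof.
have mb : measurable (cball n (d + 2 * n%:R * h) : set V) by exact: measurable_cball.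
rewrite RintegralD//; last 2 first.
- by have := integrableZlR 4^-1 measurableT (integrable_moll_sub x); apply: eq_integrable => // w _ /=; rewrite mulrC.
- exact: (integrableZlR _ measurableT (iind x)).
have -> : \int[mu]_w (moll d (x - w) / 4) = 4^-1.
  under eq_Rintegral do rewrite mulrC.
  by rewrite [LHS](RintegralZl 4^-1 measurableT (integrable_moll_sub x)) Rintegral_moll_sub mulr1.
rewrite [X in _ + X](RintegralZl field_error measurableT (iind x)); congr (_ + _ * _).
have E := @measurable_addrV R n (- x).
have hp (S : set V) : measurable S -> mu ((fun w => w - x) @^-1` S) = mu S.
  by move=> mS; rewrite -(lebesgue_rV_shift (- x) mS).
have := Rintegral_preserving E hp measurableT (measurable_indic mb).
rewrite preimage_setT => ->.
have e : fine (mu (cball n (d + 2 * n%:R * h))) = (2 * (d + 2 * n%:R * h)) ^+ n by rewrite lebesgue_cball.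
by rewrite /Rintegral integral_indic// setIT.
Qed.

End cube_field.

(** * Oscillation of mollifications *)

Lemma measurable_sgr {R : realType} : measurable_fun [set: measurableTypeR R] (Num.sg : R -> R).
Proof.
rewrite (_ : Num.sg = fun x : R => \1_(`]0, +oo[%classic : set R) x - \1_(`]-oo, 0[%classic : set R) x).
  by apply: measurable_funB; apply: measurable_indic; exact: measurable_itv.
apply/funext => x; rewrite !indicE !mem_setE !in_itv/= andbT.
by case: sgrP => /=; rewrite ?subr0 ?sub0r ?subrr.
Qed.

Section conv_L1loc.
Context {R : realType} {n : nat}.
Local Notation mu := (lebesgue_rV R n).
Local Notation V := ('rV[R]_n).

Lemma measurable_moll_sub2 (d : R) : measurable_fun setT (fun p : V * V => moll d (p.1 - p.2)).
Proof.
apply: (measurableT_comp (measurable_moll d)).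
by apply: measurable_subrV2; [exact: measurable_fst|exact: measurable_snd].
Qed.

Lemma integrable_conv_cball (d r : R) (f : V -> R) : 0 < d -> 0 <= r -> L1loc f ->
  mu.-integrable (cball n r) (EFin \o conv d f).
Proof.
move=> d0 r0 hf; have rd0 : 0 <= r + d by rewrite addr_ge0// ltW.
have mb := measurable_cball.
have i1 : mu.-integrable (cball n r) (EFin \o (fun=> 1 : R)).
  by apply: (bounded_integrable (C := 1)) => //; [exact: mb|exact: lebesgue_cball_lty|move=> *; rewrite normr1].
have := integrable_weighted_inner (mb _ _ r) (mb _ _ (r + d)) i1 (L1loc_integrable hf rd0)
  (measurable_moll_sub2 d) (fun p => moll_le d0 (p.1 - p.2)).
apply: eq_integrable; first exact: mb.
by move=> x /[!inE] xr; rewrite /= mul1r (conv_local _ d0 xr).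
Qed.

Lemma measurable_conv (d : R) (f : V -> R) : 0 < d -> L1loc f -> measurable_fun setT (conv d f).
Proof. by move=> d0 hf; apply: continuous_measurable_rV; exact: continuous_conv. Qed.

Lemma L1loc_cball (f : V -> R) : measurable_fun setT f ->
  (forall r, 0 < r -> mu.-integrable (cball n r) (EFin \o f)) -> L1loc f.
Proof.
move=> mf hf; split => // K cK; have [r r0 Kr] := compact_sub_cball cK.
have /integrableP[m] := hf r r0.
apply: le_lt_trans; apply: ge0_subset_integral => //.
- by apply: closed_measurable_rV; apply: compact_closed => //; exact: norm_hausdorff.
- exact: measurable_cball.
- by apply/measurable_EFinP; apply: measurableT_comp => //; exact/measurable_EFinP.
Qed.

Lemma L1loc_conv (d : R) (f : V -> R) : 0 < d -> L1loc f -> L1loc (conv d f).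
Proof.
move=> d0 hf; apply: L1loc_cball; first exact: measurable_conv.
by move=> r r0; apply: integrable_conv_cball => //; exact: ltW.
Qed.

End conv_L1loc.

Lemma dot_suml {R : realType} {n : nat} (I : Type) (s : seq I) (F : I -> 'rV[R]_n) (v : 'rV[R]_n) :
  dot (\sum_(i <- s) F i) v = \sum_(i <- s) dot (F i) v.
Proof.
by elim: s => [|i s IH]; [rewrite !big_nil dot0l|rewrite !big_cons dotDl IH].
Qed.

Lemma ocube_enorm {R : realType} {n : nat} (z : 'rV[R]_n) (O : 'M[R]_n) (h : R) x :
  0 <= h -> O *m O^T = 1%:M -> ocube z O h x -> enorm x <= enorm z + n%:R * h.
Proof.
move=> h0 OO Qx; rewrite -(subrK z x) addrC (le_trans (enormD _ _))// lerD2l.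
exact: ocube_dist Qx.
Qed.

Section upper_bound.
Context {R : realType} {n : nat}.
Local Notation mu := (lebesgue_rV R n).
Local Notation V := ('rV[R]_n).

(** Both recentrings are free: [psi] has mean 0, so [g] may be replaced by [g - a], and [g - a] has
    mean 0, so the mean of the sign disappears. The sign of [g - a] times [g - a] remains. *)
Lemma Rintegral_centred_sign_osc (z : V) (O : 'M[R]_n) (h : R) (g : V -> R) :
  0 < h -> O *m O^T = 1%:M -> measurable_fun setT g ->
  mu.-integrable (ocube z O h) (EFin \o g) ->
  let a := average g (ocube z O h) in
  \int[mu]_(w in ocube z O h) (centred_sign z O h (fun w => Num.sg (g w - a)) w * g w) =
  \int[mu]_(w in ocube z O h) `|g w - a|.
Proof.
move=> h0 OO mg ig a; set Q := ocube z O h; set s := fun w => Num.sg (g w - a).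
have mQ : measurable Q by exact: measurable_ocube.
have qE : fine (mu Q) = (2 * h) ^+ n by rewrite lebesgue_ocube.
have q0 : 0 < (2 * h) ^+ n by rewrite exprn_gt0// mulr_gt0.
have ms : measurable_fun setT s.
  by apply: (measurableT_comp (@measurable_sgr R)) => //; exact: measurable_funB.
have s1 x : `|s x| <= 1 by rewrite /s normr_sg lern1 leq_b1.
have Qoo : (mu Q < +oo)%E by rewrite /Q lebesgue_ocube// ltry.
have ia : mu.-integrable Q (EFin \o (fun=> a)) by apply: (bounded_integrable (C := `|a|)).
have iga : mu.-integrable Q (EFin \o (fun w => g w - a)) by exact: integrableBR.
have mpsi := measurable_centred_sign z O h ms.
have ips : mu.-integrable Q (EFin \o centred_sign z O h s).
  by apply: (bounded_integrable (C := 2)) => //; [exact: measurable_funTS|move=> w _; exact: centred_sign_le].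
have ipg : mu.-integrable Q (EFin \o (fun w => centred_sign z O h s w * g w)).
  have := integrableM_bounded mQ ig (measurable_funTS mpsi) (fun w _ => centred_sign_le z h0 OO ms s1 w).
  by apply: eq_integrable => // w _ /=; rewrite mulrC.
have ga0 : \int[mu]_(w in Q) (g w - a) = 0.
  rewrite RintegralB// Rintegral_cst// -/Q.
  by rewrite /a /average -/Q mulrAC mulVf ?mul1r ?subrr// qE gt_eqF.
rewrite -[LHS]subr0 -(mulr0 a) -(Rintegral_centred_sign z h0 OO ms s1) -RintegralZl// -RintegralB//; last exact: integrableZlR.
have isg : mu.-integrable Q (EFin \o (fun w => (g w - a) * s w)).
  by apply: (integrableM_bounded (C := 1)) => //; exact: measurable_funTS.
set sbar := (fine (mu Q))^-1 * \int[mu]_(x in Q) s x.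
transitivity (\int[mu]_(w in Q) ((g w - a) * s w - sbar * (g w - a))).
  by apply: eq_Rintegral => w _; rewrite /centred_sign -/Q -/sbar; ring.
rewrite RintegralB//; last exact: integrableZlR.
rewrite RintegralZl// ga0 mulr0 subr0; apply: eq_Rintegral => w _.
by rewrite /s mulrC normrEsg.
Qed.

Variables (d h : R) (d0 : 0 < d) (h0 : 0 < h) (n0 : (0 < n)%N).

(** The total mass of [field_majorant]; up to the factor [2 * h * kap], a uniform bound on the sum
    of the fields of disjoint cubes. *)
Definition upper_factor := 4^-1 + @field_error R n d h * (2 * (d + 2 * n%:R * h)) ^+ n.
Local Notation lam := upper_factor.

Lemma upper_factor_gt0 : 0 < lam.
Proof.
rewrite /lam ltr_pwDl// mulr_ge0//; first exact: field_error_ge0.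
by rewrite exprn_ge0// mulr_ge0// addr_ge0 ?(ltW d0)// mulr_ge0// ltW.
Qed.

(** The sum of the cube fields, normalised, competes in the supremum that defines the variation of
    [f]. Its pairing with [f] is the sum of the oscillations of the mollification. *)
Lemma sum_oscillation_le (f : V -> R) (C : R) (I : eqType) (s : seq I) (z : I -> V) (O : I -> 'M[R]_n) :
  L1loc f -> (ext_total_variation f <= C%:E)%E -> (forall i, O i *m (O i)^T = 1%:M) -> uniq s ->
  (forall i j x, i \in s -> j \in s -> ocube (z i) (O i) h x -> ocube (z j) (O j) h x -> i = j) ->
  \sum_(i <- s) \int[mu]_(w in ocube (z i) (O i) h)
      `|conv d f w - average (conv d f) (ocube (z i) (O i) h)| <= 2 * h * lam * C.
Proof.
move=> hf fC OO us disj; pose Q i := ocube (z i) (O i) h; pose g := conv d f.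
have lam0 := upper_factor_gt0.
pose sg i w := Num.sg (g w - average g (Q i)).
have mg : measurable_fun setT g by exact: measurable_conv.
have msg i : measurable_fun setT (sg i).
  by apply: (measurableT_comp (@measurable_sgr R)) => //; exact: measurable_funB.
have sg1 i x : `|sg i x| <= 1 by rewrite /sg normr_sg lern1 leq_b1.
(* The weight for which [2 * h * kap] times the mass of the majorant is 1. *)
pose kap := (2 * h * lam)^-1.
have kap0 : 0 < kap by rewrite invr_gt0 !mulr_gt0.
pose Phi i := cube_field d (z i) (O i) h (sg i) kap.
have CPhi i : C1c (Phi i) by exact: (C1c_cube_field d0 (z i) h0 (OO i) (msg i) (sg1 i) (ltW kap0)).
pose Ph x := \sum_(i <- s) Phi i x.
have mQ i : measurable (Q i) by exact: measurable_ocube.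
have Qoo i : (mu (Q i) < +oo)%E by rewrite /Q lebesgue_ocube// ltry.
have Ph1 x : enorm (Ph x) <= 1.
  (* The estimate of each field in a direction [e] is applied with [e = Ph x], the value of the sum
     itself, and yields the bound on its norm. *)
  have H : dot (Ph x) (Ph x) <= enorm (Ph x).
    rewrite {1}/Ph dot_suml.
    apply: (@le_trans _ _ (2 * h * kap * enorm (Ph x) * \sum_(i <- s) \int[mu]_(w in Q i) field_majorant d h x w)).
      rewrite mulr_sumr; apply: ler_sum => i _.
      exact: (dot_cube_field_le d0 n0 (z i) h0 (OO i) (msg i) (sg1 i) (ltW kap0)).
    have hl : 2 * h * kap * lam = 1.
      by rewrite /kap mulrAC mulfV// gt_eqF// !mulr_gt0.
    apply: (@le_trans _ _ (2 * h * kap * enorm (Ph x) * lam)); last by rewrite mulrAC hl mul1r.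
    apply: ler_wpM2l; first by rewrite mulr_ge0 ?enorm_ge0// mulr_ge0 ?(ltW kap0)// mulr_ge0// ltW.
    rewrite /lam -(Rintegral_field_majorant d0 h0 x).
    apply: sum_Rintegral_disjoint_le => //; last exact: integrable_field_majorant.
    by move=> w _; exact: field_majorant_ge0.
  have [e0|e0] := ltrP 0 (enorm (Ph x)); last by rewrite (le_trans e0).
  by move: H; rewrite -sqr_enorm expr2 ger_pMl.
(* A crude common radius: a sum dominates each of its nonnegative terms and needs no maximum over a
   possibly empty list. *)
pose r := \sum_(i <- s) (enorm (z i) + n%:R * h).
have nh0 : 0 <= n%:R * h by rewrite mulr_ge0// ltW.
have zr0 i : 0 <= enorm (z i) + n%:R * h by rewrite addr_ge0// enorm_ge0.
have r0 : 0 <= r by exact: sumr_ge0.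
have rd0 : 0 <= r + d by rewrite addr_ge0// ltW.
have Qr i : i \in s -> Q i `<=` cball n r.
  move=> si x Qx; apply/cballE => //; rewrite (le_trans (norm_le_enorm _))//.
  rewrite (@le_trans _ _ (enorm (z i) + n%:R * h))//.
    by apply: ocube_enorm Qx => //; exact: ltW.
  by rewrite /r (big_rem i)//= lerDl sumr_ge0.
have mb : measurable (cball n (r + d) : set V) by exact: measurable_cball.
pose psi i := centred_sign (z i) (O i) h (sg i).
have mpsi i : measurable_fun setT (psi i) by exact: measurable_centred_sign.
have psi2 i w : `|psi i w| <= 2 by exact: centred_sign_le.
have ipsi i : mu.-integrable (Q i) (EFin \o psi i).
  exact: (bounded_integrable (mQ i) (Qoo i) (measurable_funTS (mpsi i)) (fun w _ => psi2 i w)).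
pose K (p : V * V) := moll d (p.2 - p.1).
have mK : measurable_fun setT K.
  apply: (measurableT_comp (measurable_moll d)).
  by apply: measurable_subrV2; [exact: measurable_snd|exact: measurable_fst].
have KC p : `|K p| <= @moll_max R n d by exact: moll_le.
have fi := L1loc_integrable hf rd0.
have divE y : divergence Ph y = \sum_(i <- s) kap * \int[mu]_(w in Q i) (psi i w * moll d (w - y)).
  rewrite divergence_sum//; apply: eq_bigr => i _.
  exact: (divergence_cube_field d0 (z i) h0 (OO i) (msg i) (sg1 i) (ltW kap0)).
have div0 y : ~ cball n (r + d) y -> divergence Ph y = 0.
  move=> yr; rewrite divE big_seq big1// => i si; rewrite (_ : Rintegral _ _ _ = 0) ?mulr0//.
  rewrite -[RHS](mul0r (fine (mu (Q i)))) -Rintegral_cst//; apply: eq_Rintegral => w /[!inE] Qw.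
  rewrite moll_out ?mulr0//; rewrite leNgt; apply/negP => wy; apply: yr.
  apply/cballE => //; rewrite -(subrK w y) addrC (le_trans (ler_normD _ _))// lerD//.
    by apply/cballE => //; exact: Qr si _ Qw.
  by rewrite (le_trans (norm_le_enorm _))// -enormN opprB ltW.
have iF i : mu.-integrable (cball n (r + d)) (EFin \o (fun y => f y * \int[mu]_(w in Q i) (psi i w * moll d (w - y)))).
  exact: (integrable_weighted_inner mb (mQ i) fi (ipsi i) mK KC).
have fdE : (fun y => f y * divergence Ph y) =
    (fun y => \sum_(i <- s) kap * (f y * \int[mu]_(w in Q i) (psi i w * moll d (w - y)))) \_ (cball n (r + d)).
  apply/funext => y; rewrite patchE; case: ifPn => [_|/negP yr].
    by rewrite divE mulr_sumr; apply: eq_bigr => i _; rewrite mulrCA.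
  by rewrite div0 ?mulr0// => yy; apply: yr; rewrite inE.
have iS : mu.-integrable (cball n (r + d)) (EFin \o (fun y => \sum_(i <- s) kap * (f y * \int[mu]_(w in Q i) (psi i w * moll d (w - y))))).
  by apply: integrable_sumR => // i _; exact: (integrableZlR _ mb (iF i)).
(* Fubini, with the kernel [moll d (w - y)], moves the mollification from the sign functions to
   [f]. *)
have key : \int[mu]_y (f y * divergence Ph y) =
    kap * \sum_(i <- s) \int[mu]_(w in Q i) `|g w - average g (Q i)|.
  rewrite fdE -Rintegral_mkcond Rintegral_sum//; last by move=> i _; exact: (integrableZlR _ mb (iF i)).
  rewrite mulr_sumr big_seq [RHS]big_seq; apply: eq_bigr => i si.
  rewrite (RintegralZl kap mb (iF i)); congr (_ * _).
  have := weighted_fubini mb (mQ i) fi (ipsi i) mK KC; rewrite /K/= => ->.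
  have ig : mu.-integrable (Q i) (EFin \o g).
    by apply: (integrableS _ (mQ i) (Qr _ si) (integrable_conv_cball d0 r0 hf)); exact: measurable_cball.
  rewrite -(Rintegral_centred_sign_osc h0 (OO i) mg ig).
  apply: eq_Rintegral => w /[!inE] Qw; congr (_ * _).
  by rewrite /g (conv_local f d0 (Qr _ si _ Qw)).
have : (\int[mu]_y (f y * divergence Ph y))%:E%E = (\int[mu]_y (f y * divergence Ph y)%:E)%E.
  rewrite /Rintegral fineK//; apply: integrable_fin_num => //.
  rewrite [X in mu.-integrable _ X](_ : _ = EFin \o (fun y => f y * divergence Ph y))// fdE.
  by rewrite -restrict_EFin -integrable_mkcond.
rewrite key => E.
have : (\int[mu]_y (f y * divergence Ph y)%:E <= C%:E)%E.
  apply: le_trans fC; apply: ereal_sup_ubound; exists Ph => //; split => //.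
  exact: C1c_sum.
by rewrite -E lee_fin /kap -ler_pdivlMl ?invrK.
Qed.

End upper_bound.

Section Kfun_upper.
Context {R : realType} {n : nat}.
Local Notation mu := (lebesgue_rV R n).
Local Notation V := ('rV[R]_n).

Lemma Kfun_conv_le (d eps C : R) (f : V -> R) : 0 < d -> 0 < eps -> (0 < n)%N -> L1loc f ->
  (ext_total_variation f <= C%:E)%E ->
  (Kfun eps (conv d f) <= (@upper_factor R n d (eps / 2) * C)%:E)%E.
Proof.
move=> d0 e0 n0 hf fC; have h0 : 0 < eps / 2 by rewrite divr_gt0.
apply: ge_ereal_sup => _ [H [Hc Ht] <-].
set g := conv d f.
have eE : eps ^+ n = eps ^+ n.-1 * eps by rewrite -exprSr prednK.
suff S : (\esum_(Q in H) mean_osc g Q <= ((eps ^+ n)^-1 * (eps * (@upper_factor R n d (eps / 2) * C)))%:E)%E.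
  apply: (le_trans (lee_wpmul2l _ S)); first by rewrite lee_fin exprn_ge0// ltW.
  rewrite -EFinM lee_fin eE invfM !mulrA mulfV ?mul1r ?gt_eqF ?exprn_gt0//.
  by rewrite mulVf ?mul1r// gt_eqF.
(* [\esum] is a supremum over finite subfamilies, so a family of any cardinality reduces to a finite
   list of cubes. *)
apply: ge_ereal_sup => _ [X [finX XH] <-].
have W Q : exists zo : V * 'M[R]_n, zo.2 *m zo.2^T = 1%:M /\ (H Q -> Q = ocube zo.1 zo.2 (eps / 2)).
  have [HQ|nH] := pselect (H Q).
    by have [z [ O [ OO ->]]] := (cubeP _ _).1 (Hc _ HQ); exists (z, O).
  by exists (0, 1%:M); rewrite trmx1 mulmx1.
have [zO zOP] := choice W.
pose s := finmap.enum_fset (fset_set X).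
have sX Q : (Q \in s) = (Q \in X) := in_fset_set finX Q.
have XE Q : Q \in s -> Q = ocube (zO Q).1 (zO Q).2 (eps / 2).
  by rewrite sX inE => XQ; apply: (zOP Q).2; exact: XH.
have OO Q := (zOP Q).1.
have := @sum_oscillation_le R n d (eps / 2) d0 h0 n0 f C _ s (fun Q => (zO Q).1) (fun Q => (zO Q).2) hf fC OO (finmap.fset_uniq _).
have e2 : 2 * (eps / 2) = eps by rewrite mulrC divfK.
rewrite e2 => /(_ _)/le_trans H0.
rewrite fsbig_finite// -/s big_seq.
rewrite (eq_bigr (fun Q => ((eps ^+ n)^-1 * \int[mu]_(w in ocube (zO Q).1 (zO Q).2 (eps / 2))
   `|g w - average g (ocube (zO Q).1 (zO Q).2 (eps / 2))|)%:E)); last first.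
  move=> Q sQ; have EQ := XE _ sQ; set Q' := ocube _ _ _ in EQ *.
  have mQ : measurable Q' by exact: measurable_ocube.
  have qE : fine (mu Q') = eps ^+ n by rewrite lebesgue_ocube//= e2.
  have Qoo : (mu Q' < +oo)%E by rewrite lebesgue_ocube// ltry.
  rewrite {}EQ /mean_osc qE EFinM; congr (_ * _)%E; rewrite /Rintegral fineK//.
  have [K cK QK] : exists2 K : set V, compact K & Q' `<=` K.
    have r0 : 0 <= enorm (zO Q).1 + n%:R * (eps / 2) by rewrite addr_ge0 ?enorm_ge0// mulr_ge0// ltW.
    exists (cball n (enorm (zO Q).1 + n%:R * (eps / 2))); first exact: compact_cball.
    move=> x Qx; apply/cballE => //; rewrite (le_trans (norm_le_enorm _))//.
    by apply: ocube_enorm Qx => //; exact: ltW.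
  have mK : measurable K by apply: closed_measurable_rV; apply: compact_closed => //; exact: norm_hausdorff.
  have [mg gK] := L1loc_conv d0 hf.
  apply: integrable_fin_num => //.
  have ig : mu.-integrable Q' (EFin \o g).
    apply: (integrableS mK mQ QK); apply/integrableP; split; last exact: gK.
    by apply/measurable_EFinP; exact: measurable_funTS.
  have ia : mu.-integrable Q' (EFin \o (fun=> average g Q')).
    apply: (bounded_integrable (C := `|average g Q'|)) => //.
  by have := integrable_abse (integrableBR mQ ig ia); apply: eq_integrable.
rewrite -big_seq sumEFin lee_fin -mulr_sumr ler_wpM2l//.
  by rewrite invr_ge0 exprn_ge0// ltW.
rewrite [leRHS]mulrA; apply: H0 => //.
move=> Q1 Q2 x s1 s2; rewrite -(XE _ s1) -(XE _ s2) => x1 x2.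
apply: (Ht Q1 Q2); [| |by exists x].
  by apply: XH; move: s1; rewrite sX inE.
by apply: XH; move: s2; rewrite sX inE.
Qed.
End Kfun_upper.

(** * Convergence of mollifications *)

Lemma eq_ler (R : realDomainType) (x y : R) : x = y -> x <= y.
Proof. by move=> ->. Qed.

Section measure_approximation.
Context d (T : measurableType d) (R : realType) (mu : {measure set T -> \bar R}).

Lemma measure_bigcup_approx (A : (set T)^nat) (e : R) :
  (forall k, measurable (A k)) -> nondecreasing_seq A -> (mu (\bigcup_k A k) < +oo)%E -> 0 < e ->
  exists k, fine (mu (\bigcup_k A k)) - fine (mu (A k)) <= e.
Proof.
move=> mA ndA Aoo e0; have mU : measurable (\bigcup_k A k) by exact: bigcup_measurable.
have := @nondecreasing_cvg_mu _ _ _ mu A mA mU ndA.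
rewrite -[X in _ --> X](@fineK _ (mu (\bigcup_k A k))); last by rewrite ge0_fin_numE.
move=> /fine_cvg/cvgrPdist_le/(_ e e0)[k _ /(_ k (leqnn k))/=] H.
by exists k; rewrite (le_trans (ler_norm _)).
Qed.

Lemma Rintegral_le_subset (D E : set T) (g : T -> R) : measurable D -> measurable E -> D `<=` E ->
  (forall x, E x -> 0 <= g x) -> mu.-integrable E (EFin \o g) ->
  \int[mu]_(x in D) g x <= \int[mu]_(x in E) g x.
Proof.
move=> mD mE DE g0 ig.
have := @sum_Rintegral_disjoint_le _ _ _ mu unit [:: tt] (fun=> D) E g isT mE (fun _ _ => mD) (fun _ _ => DE).
by rewrite big_seq1; apply => // -[] [].
Qed.

End measure_approximation.

Section mollification.
Context {R : realType} {n : nat}.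
Local Notation mu := (lebesgue_rV R n).
Local Notation V := ('rV[R]_n).
Implicit Types (f g : V -> R) (a d r e : R).

Let mb r : measurable (cball n r : set V). Proof. exact: measurable_cball. Qed.

Lemma L1loc_lin a f g : L1loc f -> L1loc g -> L1loc (fun x => a * f x + g x).
Proof.
move=> hf hg; apply: L1loc_cball.
  by apply: measurable_funD; [apply: measurable_funM => //; exact: hf.1|exact: hg.1].
move=> r r0; apply: integrableDR => //; last exact: (L1loc_integrable hg (ltW r0)).
exact: (integrableZlR _ (mb r) (L1loc_integrable hf (ltW r0))).
Qed.

Lemma L1loc_norm f : L1loc f -> L1loc (fun x => `|f x|).
Proof.
move=> [mf hf]; split; first by apply: measurableT_comp.
by move=> K cK; under eq_integral do rewrite normr_id; exact: hf.
Qed.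

Lemma L1loc_bounded f C : measurable_fun setT f -> (forall x, `|f x| <= C) -> L1loc f.
Proof.
move=> mf fC; apply: L1loc_cball => // r r0.
by apply: (bounded_integrable (C := C)) => //; [exact/lebesgue_cball_lty/ltW|exact: measurable_funTS].
Qed.

Lemma L1loc_indic (A : set V) : measurable A -> L1loc (\1_A : V -> R).
Proof.
move=> mA; apply: (@L1loc_bounded _ 1); first exact: measurable_indic.
by move=> x; rewrite indicE; case: (x \in A); rewrite ?normr1// normr0.
Qed.

Lemma sub_cball r s : 0 <= r -> r <= s -> cball n r `<=` (cball n s : set V).
Proof.
move=> r0 rs x /(cballE _ r0) xr; apply/(cballE _ (le_trans r0 rs)).
exact: (le_trans xr).
Qed.

Lemma Rintegral_cball_le r s f : 0 <= r -> r <= s -> L1loc f ->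
  \int[mu]_(x in cball n r) `|f x| <= \int[mu]_(x in cball n s) `|f x|.
Proof.
move=> r0 rs hf; have s0 := le_trans r0 rs.
have p0 x : cball n s x -> 0 <= `|f x| by move=> _; exact: normr_ge0.
exact: (Rintegral_le_subset (mb r) (mb s) (sub_cball r0 rs) p0 (L1loc_integrable (L1loc_norm hf) s0)).
Qed.

Lemma conv_lin d a f g x : 0 < d -> L1loc f -> L1loc g ->
  conv d (fun y => a * f y + g y) x = a * conv d f x + conv d g x.
Proof.
move=> d0 hf hg; have x0 := normr_ge0 x.
have xx : cball n `|x| x by apply/cballE.
have xd : 0 <= `|x| + d by rewrite addr_ge0// ltW.
have i1 := integrable_conv x d0 hf xd; have i2 := integrable_conv x d0 hg xd.
rewrite !(conv_local _ d0 xx x0).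
rewrite -(RintegralZl a (mb _) i1) -RintegralD//; last exact: (integrableZlR _ (mb _) i1).
by apply: eq_Rintegral => y _; rewrite mulrDl mulrA.
Qed.

(** Young's inequality in local form: the mass of the kernel is 1, and the domain grows by its
    radius, at most 1 since [d <= 1]. It makes convergence stable under L^1_loc approximation. *)
Lemma conv_contraction d f r : 0 < d -> d <= 1 -> 0 <= r -> L1loc f ->
  \int[mu]_(x in cball n r) `|conv d f x| <= \int[mu]_(x in cball n (r + 1)) `|f x|.
Proof.
move=> d0 d1 r0 hf; have hN := L1loc_norm hf.
have rd0 : 0 <= r + d by rewrite addr_ge0// ltW.
have r10 : 0 <= r + 1 by rewrite addr_ge0.
have iN := L1loc_integrable hN rd0.
have rd1 : r + d <= r + 1 by rewrite lerD2l.
apply: (@le_trans _ _ (\int[mu]_(x in cball n r) conv d (fun y => `|f y|) x)).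
  apply: le_Rintegral => //.
  - by have := L1loc_integrable (L1loc_norm (L1loc_conv d0 hf)) r0.
  - exact: integrable_conv_cball.
  - move=> x xr; rewrite !(conv_local _ d0 xr r0).
    rewrite (le_trans (le_normr_Rintegral _ (integrable_conv x d0 hf rd0)))//.
    by apply: eq_ler; apply: eq_Rintegral => y _; rewrite normrM (ger0_norm (moll_ge0 _ _)).
have i1 : mu.-integrable (cball n r) (EFin \o (fun=> 1 : R)).
  by apply: (bounded_integrable (C := 1)) => //; [exact: lebesgue_cball_lty|move=> *; rewrite normr1].
have W := weighted_fubini (mb r) (mb (r + d)) i1 iN (measurable_moll_sub2 d) (fun p => moll_le d0 (p.1 - p.2)).
rewrite [leLHS](_ : _ = \int[mu]_(x in cball n r) (1 * \int[mu]_(y in cball n (r + d)) (`|f y| * moll d (x - y)))); last first.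
  by apply: eq_Rintegral => x /[!inE] xr; rewrite mul1r (conv_local _ d0 xr r0).
rewrite W.
have J y : \int[mu]_(x in cball n r) (1 * moll d (x - y)) <= 1.
  rewrite -[leRHS](@Rintegral_moll_sub R n d d0 y).
  rewrite [leLHS](_ : _ = \int[mu]_(x in cball n r) moll d (y - x)).
    have p0 (x : V) : setT x -> 0 <= moll d (y - x) by move=> _; exact: moll_ge0.
    exact: (Rintegral_le_subset (mb r) measurableT (@subsetT _ _) p0 (integrable_moll_sub d0 y)).
  by apply: eq_Rintegral => x _; rewrite mul1r -mollN opprB.
apply: (@le_trans _ _ (\int[mu]_(x in cball n (r + d)) `|f x|)).
  have K' := @measurable_subrV2 R n _ _ (fun p : V * V => p.2) (fun p => p.1) measurable_snd measurable_fst.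
  have I := integrable_weighted_inner (mb (r + d)) (mb r) iN i1 (measurableT_comp (measurable_moll d) K') (fun p => moll_le d0 (p.2 - p.1)).
  apply: (le_Rintegral (mb _) I iN) => y _.
  by apply: ler_piMr; [exact: normr_ge0|exact: J].
exact: (Rintegral_cball_le rd0 rd1 hf).
Qed.

(** The class is built up from sets: it is linear and closed under L^1_loc approximation, contains
    the indicators of open sets, hence by a Dynkin argument those of all measurable sets, hence
    simple functions and all of L^1_loc. Density of continuous functions is not invoked. *)
Definition mollifiable f := L1loc f /\ forall r e, 0 <= r -> 0 < e -> exists2 del, 0 < del &
  forall d, 0 < d -> d < del -> \int[mu]_(x in cball n r) `|conv d f x - f x| <= e.

Let iosc d f r : 0 < d -> 0 <= r -> L1loc f ->
  mu.-integrable (cball n r) (EFin \o (fun x => `|conv d f x - f x|)).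
Proof.
move=> d0 r0 hf; apply: (@L1loc_integrable _ _ (fun x => `|conv d f x - f x|)) => //.
apply: L1loc_norm; have := L1loc_lin (-1) hf (L1loc_conv d0 hf).
by congr L1loc; apply/funext => x; rewrite mulN1r addrC.
Qed.

Lemma mollifiable_lin a f g : mollifiable f -> mollifiable g -> mollifiable (fun x => a * f x + g x).
Proof.
move=> [hf Pf] [hg Pg]; have hh := L1loc_lin a hf hg; split => // r e r0 e0.
have a1 : 0 < `|a| + 1 by rewrite ltr_wpDl.
have [d1 d10 H1] := Pf r (e / (2 * (`|a| + 1))) r0 (divr_gt0 e0 (mulr_gt0 (ltr0Sn _ _) a1)).
have [d2 d20 H2] := Pg r (e / 2) r0 (divr_gt0 e0 (ltr0Sn _ _)).
exists (Num.min d1 d2); first by rewrite lt_min d10.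
move=> d d0; rewrite lt_min => /andP[dd1 dd2].
have i1 := iosc d0 r0 hf; have i2 := iosc d0 r0 hg.
apply: (@le_trans _ _ (\int[mu]_(x in cball n r) (`|a| * `|conv d f x - f x| + `|conv d g x - g x|))).
  apply: le_Rintegral => //; first exact: iosc.
    by apply: integrableDR => //; exact: (integrableZlR _ (mb r) i1).
  move=> x _; rewrite conv_lin// -normrM (le_trans _ (ler_normD _ _))//.
  by apply: eq_ler; congr `|_|; ring.
rewrite RintegralD//; last exact: (integrableZlR _ (mb r) i1).
rewrite (RintegralZl _ (mb r) i1).
have := H1 d d0 dd1; have := H2 d d0 dd2.
move: (Rintegral _ _ _) => J2; move: (Rintegral _ _ _) => J1 h2 h1.
have : `|a| * J1 <= (`|a| + 1) * (e / (2 * (`|a| + 1))).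
  apply: (@le_trans _ _ (`|a| * (e / (2 * (`|a| + 1))))); first exact: ler_wpM2l.
  by rewrite ler_wpM2r ?lerDl// divr_ge0 ?(ltW e0)// mulr_ge0// ltW.
have -> : (`|a| + 1) * (e / (2 * (`|a| + 1))) = e / 2 by field; rewrite gt_eqF.
by move: h2; lra.
Qed.

Lemma mollifiable_approx f : L1loc f ->
  (forall r e, 0 <= r -> 0 < e -> exists2 g, mollifiable g & \int[mu]_(x in cball n r) `|f x - g x| <= e) ->
  mollifiable f.
Proof.
move=> hf H; split => // r e r0 e0; have r10 : 0 <= r + 1 by rewrite addr_ge0.
have [g [hg Pg] fg] := H (r + 1) (e / 3) r10 (divr_gt0 e0 (ltr0Sn _ _)).
have [del del0 Hd] := Pg r (e / 3) r0 (divr_gt0 e0 (ltr0Sn _ _)).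
exists (Num.min del 1); first by rewrite lt_min del0 ltr01.
move=> d d0; rewrite lt_min => /andP[ddel /ltW d1].
pose k x := f x - g x.
have kE : k = fun x => (-1) * g x + f x by apply/funext => x; rewrite mulN1r addrC.
have hk : L1loc k by rewrite kE; exact: L1loc_lin.
have ik := L1loc_integrable (L1loc_norm hk) r0.
have ick := L1loc_integrable (L1loc_norm (L1loc_conv d0 hk)) r0.
have ig := iosc d0 r0 hg.
apply: (@le_trans _ _ (\int[mu]_(x in cball n r) (`|conv d k x| + `|conv d g x - g x| + `|k x|))).
  apply: le_Rintegral => //; first exact: iosc.
    by apply: integrableDR => //; exact: integrableDR.
  move=> x _; rewrite kE conv_lin//.
  have := ler_normD (-1 * conv d g x + conv d f x + (conv d g x - g x)) (- (-1 * g x + f x)).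
  rewrite normrN (_ : _ + _ + _ = conv d f x - f x); last by ring.
  by move/le_trans; apply; rewrite lerD2r ler_normD.
rewrite !RintegralD//; last exact: integrableDR.
have c := conv_contraction d0 d1 r0 hk.
have fg' : \int[mu]_(x in cball n r) `|k x| <= \int[mu]_(x in cball n (r + 1)) `|k x|.
  by apply: Rintegral_cball_le hk => //; rewrite lerDl.
have := Hd d d0 ddel; move: fg fg' c; rewrite -/k.
move: (Rintegral _ _ _) (Rintegral _ _ _) (Rintegral _ _ _) (Rintegral _ _ _) => J1 J2 J3 J4; lra.
Qed.

End mollification.

Section mollifiable_sets.
Context {R : realType} {n : nat}.
Local Notation mu := (lebesgue_rV R n).
Local Notation V := ('rV[R]_n).
Implicit Types (f g : V -> R) (a d r e : R).

Let mb r : measurable (cball n r : set V). Proof. exact: measurable_cball. Qed.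

Lemma Rintegral_indic_cball (A : set V) r : measurable A -> A `<=` cball n r ->
  \int[mu]_(x in cball n r) \1_A x = fine (mu A).
Proof.
move=> mA Ar; rewrite /Rintegral integral_indic//; congr fine.
by congr (mu _); apply/setIidPl.
Qed.

Lemma Rintegral_indic_cball_le (A : set V) r s : measurable A -> A `<=` cball n s -> 0 <= r -> 0 <= s ->
  \int[mu]_(x in cball n r) \1_A x <= fine (mu A).
Proof.
move=> mA As r0 s0; rewrite /Rintegral integral_indic//.
have Aoo : (mu A < +oo)%E.
  by apply: (le_lt_trans (le_measure _ _ _ As)); rewrite ?inE//; exact: lebesgue_cball_lty.
have mAr : measurable (A `&` cball n r) by exact: measurableI.
have le : (mu (A `&` cball n r) <= mu A)%E by apply: le_measure; rewrite ?inE.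
by rewrite fine_le// ge0_fin_numE// (le_lt_trans le).
Qed.

Lemma indic_ge0 (A : set V) x : 0 <= \1_A x :> R.
Proof. by rewrite indicE ler0n. Qed.

(** [A k] consists of the points whose ball of radius [1/(k+1)] lies in [B]. These sets increase to
    [B], and for [d <= 1/(k+1)] the mollified indicator is exactly 1 on [A k], so the error is at
    most twice the measure of [B] minus [A k]. *)
Lemma mollifiable_open_bounded (B : set V) s : open B -> 0 <= s -> B `<=` cball n s ->
  mollifiable (\1_B : V -> R).
Proof.
move=> oB s0 Bs; have mB : measurable B by exact: open_measurable_rV.
have hB := L1loc_indic mB; split => // r e r0 e0.
have Boo : (mu B < +oo)%E.
  by apply: (le_lt_trans (le_measure _ _ _ Bs)); rewrite ?inE//; exact: lebesgue_cball_lty.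
pose A k := [set x : V | ball x (k.+1%:R^-1 : R) `<=` B].
have AB k : A k `<=` B by move=> x; apply; apply: ballxx; rewrite invr_gt0.
have mA k : measurable (A k).
  apply: closed_measurable_rV; rewrite -[A k]setCK; apply: open_closedC.
  rewrite (_ : ~` A k = \bigcup_(y in ~` B) ball y (k.+1%:R^-1 : R)).
    by apply: bigcup_open => y _; apply: ball_open; rewrite invr_gt0.
  apply/seteqP; split => x /=.
    move=> /existsNP[y /not_implyP[xy By]]; exists y => //; exact: ball_sym.
  by move=> [y By yx] xB; apply: By; apply: xB; exact: ball_sym.
have ndA : nondecreasing_seq A.
  move=> i j ij; apply/subsetPset => x /=; apply: subset_trans; apply: le_ball.
  by rewrite lef_pV2 ?posrE// ler_nat.
have UA : \bigcup_k A k = B.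
  apply/seteqP; split => [x [k _]|x Bx]; first exact: AB.
  have /nbhs_ballP[del /= del0 Hd] := oB _ Bx.
  have [k kd] := ltr_add_invr del0; exists k => //; apply: subset_trans Hd.
  by apply: le_ball; move: kd; rewrite add0r => /ltW.
have [k Hk] : exists k, fine (mu B) - fine (mu (A k)) <= e / 2.
  by have := @measure_bigcup_approx _ _ _ mu A (e / 2) mA ndA; rewrite UA; apply => //; exact: divr_gt0.
exists (Num.min (k.+1%:R^-1) 1); first by rewrite lt_min invr_gt0 ltr0Sn ltr01.
move=> d d0; rewrite lt_min => /andP[/ltW dk /ltW d1].
pose r1 := Num.max r s.
have rr1 : r <= r1 by rewrite le_max lexx.
have sr1 : s <= r1 by rewrite le_max lexx orbT.
have r10 : 0 <= r1 by exact: le_trans rr1.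
have Br1 : B `<=` cball n r1 by apply: subset_trans Bs _; exact: sub_cball.
have hc := L1loc_conv d0 hB.
have hbc : L1loc (fun x => conv d (\1_B) x - \1_B x).
  have := L1loc_lin (-1) hB hc; congr L1loc; apply/funext => x.
  by rewrite mulN1r addrC.
apply: (le_trans (Rintegral_cball_le r0 rr1 hbc)).
have cge0 x : 0 <= conv d (\1_B) x.
  by apply: Rintegral_ge0 => y _; apply: mulr_ge0; [exact: indic_ge0|exact: moll_ge0].
have c1 x : A k x -> conv d (\1_B) x = 1.
  move=> Ax; rewrite -[RHS](Rintegral_moll_sub d0 x); apply: eq_Rintegral => y _.
  have [By|nBy] := pselect (B y); first by rewrite indicE mem_set// mul1r.
  rewrite [in RHS]moll_out ?mulr0//; first by rewrite indicE memNset// mul0r.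
  rewrite leNgt; apply/negP => xy; apply: nBy; apply: Ax.
  by rewrite -ball_normE/=; exact: (le_lt_trans (norm_le_enorm _) (lt_le_trans xy dk)).
(* On [A k] both sides are 0; elsewhere this is the triangle inequality. The right side integrates
   to at most [2 (mu B - mu (A k))], because mollification does not increase the mass. *)
have pw x : `|conv d (\1_B) x - \1_B x| <= conv d (\1_B) x + \1_B x - 2 * \1_(A k) x.
  have := cge0 x; rewrite !indicE.
  have [Ax|nAx] := pselect (A k x).
    rewrite !mem_set ?c1//; last exact: AB Ax.
    by move=> _; rewrite (_ : (true : nat)%:R = 1 :> R)// subrr normr0 mulr1 subr_ge0.
  rewrite [x \in A k]memNset// mulr0 subr0 => c0.
  by rewrite (le_trans (ler_normB _ _))// (ger0_norm c0) ger0_norm.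
have i1 := L1loc_integrable hc r10; have i2 := L1loc_integrable hB r10.
have i3 := integrableZlR 2 (mb r1) (L1loc_integrable (L1loc_indic (mA k)) r10).
have i12 := integrableDR (mb r1) i1 i2.
apply: (le_trans (le_Rintegral (mb r1) (L1loc_integrable (L1loc_norm hbc) r10) (integrableBR (mb r1) i12 i3) (fun x _ => pw x))).
rewrite RintegralB// RintegralD// (RintegralZl 2 (mb r1) (L1loc_integrable (L1loc_indic (mA k)) r10)).
rewrite (Rintegral_indic_cball (mA k)) ?(Rintegral_indic_cball mB)//; last exact: subset_trans (AB k) Br1.
have : \int[mu]_(x in cball n r1) conv d (\1_B) x <= fine (mu B).
  apply: (@le_trans _ _ (\int[mu]_(x in cball n r1) `|conv d (\1_B) x|)).
    by apply: le_Rintegral => //; [exact: (L1loc_integrable (L1loc_norm hc) r10)|move=> x _; exact: ler_norm].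
  apply: (le_trans (conv_contraction d0 d1 r10 hB)).
  have r110 : 0 <= r1 + 1 by rewrite addr_ge0.
  apply: (le_trans _ (Rintegral_indic_cball_le mB Bs r110 s0)); apply: eq_ler.
  by apply: eq_Rintegral => x _; rewrite ger0_norm ?indic_ge0.
move: Hk; move: (Rintegral _ _ _) (fine _) (fine _) => J a1 a2; lra.
Qed.

Lemma mollifiable_open (U : set V) : open U -> mollifiable (\1_U : V -> R).
Proof.
move=> oU; have mU := open_measurable_rV oU; apply: mollifiable_approx; first exact: L1loc_indic.
move=> r e r0 e0; have r10 : 0 <= r + 1 by rewrite addr_ge0.
pose B := U `&` ball (0 : V) (r + 1).
exists (\1_B).
  apply: (@mollifiable_open_bounded _ (r + 1)) => //; first by apply: openI => //; exact: ball_open.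
  move=> x [_]; rewrite -ball_normE/= sub0r normrN => /ltW xr; exact/cballE.
rewrite (@eq_Rintegral _ _ _ mu (cball n r) (fun=> 0)).
  by rewrite Rintegral_cst// mul0r ltW.
move=> x; rewrite inE => /(cballE _ r0) xr; rewrite !indicE.
have Bx : ball (0 : V) (r + 1) x.
  by rewrite -ball_normE/= sub0r normrN; apply: (le_lt_trans xr); rewrite ltrDl.
have -> : (x \in B) = (x \in U) by rewrite /B in_setI (mem_set Bx) andbT.
by rewrite subrr normr0.
Qed.

Lemma mollifiable_setT : mollifiable (\1_[set: V] : V -> R).
Proof.
split; first exact: L1loc_indic.
move=> r e r0 e0; exists 1 => // d d0 _.
rewrite (@eq_Rintegral _ _ _ mu (cball n r) (fun=> 0)); first by rewrite Rintegral_cst// mul0r ltW.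
move=> x _; rewrite indicT (_ : conv d _ x = 1) ?subrr ?normr0//.
rewrite -[RHS](Rintegral_moll_sub d0 x); apply: eq_Rintegral => y _.
exact: mul1r.
Qed.

(** Boxes generate by definition; the Dynkin argument starts from open sets, which form a pi-system
    on which mollification is controlled directly. *)
Lemma measurable_rV_open : @measurable _ V = <<s [set U : set V | open U]>>.
Proof.
apply/seteqP; split; last first.
  apply: smallest_sub; first exact: sigma_algebra_measurable.
  by move=> U; exact: open_measurable_rV.
apply: smallest_sub; first exact: smallest_sigma_algebra.
rewrite -bigcup_seq; apply: bigcup_sub => i _ A [Y mY <-].
have H : measurable_fun [set: g_sigma_algebraType [set U : set V | open U]]
    (fun x : g_sigma_algebraType [set U : set V | open U] => (x : V) ord0 i : measurableTypeR R).
  apply: (measurability _ (RGenOInfty.measurableE R)) => _ [_ [a ->] <-].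
  apply: sub_sigma_algebra => /=; rewrite setTI.
  have cc : continuous (fun x : V => x ord0 i).
    by apply: continuous_coordV => x; exact: cvg_id.
  by move/continuousP: cc; apply; exact: rray_open.
by have := H measurableT _ mY.
Qed.

Lemma mollifiable_bigcup (F : (set V)^nat) : (forall k, measurable (F k)) -> trivIset setT F ->
  (forall k, mollifiable (\1_(F k) : V -> R)) -> mollifiable (\1_(\bigcup_k F k) : V -> R).
Proof.
move=> mF tF PF; have mU : measurable (\bigcup_k F k) by exact: bigcup_measurable.
apply: mollifiable_approx; first exact: L1loc_indic.
move=> r e r0 e0; pose G k := \big[setU/set0]_(i < k) F i.
have mG k : measurable (G k) by exact: bigsetU_measurable.
have PG k : mollifiable (\1_(G k) : V -> R).
  elim: k => [|k IH].
    rewrite /G big_ord0; apply: mollifiable_open; exact: open0.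
  have := mollifiable_lin 1 IH (PF k); congr mollifiable; apply/funext => x.
  rewrite mul1r /G big_ord_recr/= -/(G k) !indicE in_setU.
  have [Fx|nFx] := boolP (x \in F k); last by rewrite orbF addr0.
  rewrite [x \in G k]memNset ?add0r// /G -bigcup_mkord => -[i /= ik Fix].
  have ik' : i = k by apply: (tF i k) => //; exists x; split => //; exact: set_mem.
  by rewrite ik' ltnn in ik.
pose C := cball n r : set V.
have ndG : nondecreasing_seq (fun k => G k `&` C).
  by move=> i j ij; apply/subsetPset; apply: setSI; exact: subset_bigsetU.
have UG : \bigcup_k (G k `&` C) = (\bigcup_k F k) `&` C.
  rewrite -setI_bigcupl; congr (_ `&` _); apply/seteqP; split => [x [k _]|x [k _ Fx]].
    by rewrite /G -bigcup_mkord => -[i _ Fx]; exists i.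
  by exists k.+1 => //; rewrite /G -bigcup_mkord; exists k => /=.
have mGC k : measurable (G k `&` C) by exact: (measurableI _ _ (mG k) (mb r)).
have mUC : measurable ((\bigcup_k F k) `&` C) by exact: (measurableI _ _ mU (mb r)).
have Coo : (mu (\bigcup_k (G k `&` C)) < +oo)%E.
  rewrite UG; apply: (@le_lt_trans _ _ (mu C)); last exact: lebesgue_cball_lty.
  by apply: le_measure; rewrite ?inE//; exact: mb.
have [k Hk] := measure_bigcup_approx mGC ndG Coo e0.
exists (\1_(G k)) => //; apply: le_trans Hk; rewrite UG.
rewrite -(Rintegral_indic_cball mUC (@subIsetr _ _ _)) -(Rintegral_indic_cball (mGC k) (@subIsetr _ _ _)).
have i1 := L1loc_integrable (L1loc_indic mUC) r0; have i2 := L1loc_integrable (L1loc_indic (mGC k)) r0.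
rewrite -RintegralB//; apply: eq_ler; apply: eq_Rintegral => x; rewrite inE => Cx.
rewrite !indicE !in_setI (mem_set Cx) !andbT ger0_norm// subr_ge0 ler_nat.
case: (boolP (x \in G k)) => // /set_mem; rewrite /G -bigcup_mkord => -[i _ Fx].
by rewrite mem_set//; exists i.
Qed.

Lemma mollifiable_measurable (A : set V) : measurable A -> mollifiable (\1_A : V -> R).
Proof.
rewrite measurable_rV_open; move: A.
apply: (dynkin_induction (P := fun A : set V => mollifiable (\1_A : V -> R)) measurable_rV_open).
- by move=> A B; exact: openI.
- exact: mollifiable_setT.
- by move=> U; exact: mollifiable_open.
- move=> S mS PS; have := mollifiable_lin (-1) PS mollifiable_setT; congr mollifiable.
  apply/funext => x; rewrite indicT indicC mulN1r addrC !indicE.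
  by case: (x \in S); rewrite ?subrr ?subr0.
- by move=> F mF tF PF; exact: mollifiable_bigcup.
Qed.

Lemma mollifiable_sum (s : seq R) (c : R -> R) (A : R -> set V) : (forall y, measurable (A y)) ->
  mollifiable (fun x => \sum_(y <- s) (c y * \1_(A y) x)).
Proof.
move=> mA; elim: s => [|y s IH].
  under eq_fun do rewrite big_nil.
  have := mollifiable_lin (-1) mollifiable_setT mollifiable_setT; congr mollifiable.
  by apply/funext => x; rewrite mulN1r addNr.
under eq_fun do rewrite big_cons.
exact: mollifiable_lin (mollifiable_measurable (mA y)) IH.
Qed.

Import HBSimple.

Lemma mollifiable_L1loc f : L1loc f -> mollifiable f.
Proof.
move=> hf; apply: mollifiable_approx => // r e r0 e0.
have fi := L1loc_integrable hf r0.
have [g [ig _ gf]] := approximation_sfun_integrable (mb r) fi.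
have Pg k : @mollifiable R n (g k).
  have := @mollifiable_sum (finmap.enum_fset (fset_set (range (g k)))) id (fun y => g k @^-1` [set y]) (fun y => @measurable_sfunP _ _ _ _ (g k) _ (measurable_set1 y)).
  by congr mollifiable; apply/funext => x; rewrite fimfunE fsbig_finite.
have [[N1 _ H1] /cvgrPdist_le/(_ e e0)[N2 _ H2]] := (fine_cvgP _ _).1 gf.
exists (g N2) => //; have := H2 N2 (leqnn N2); rewrite /= sub0r normrN.
exact: (le_trans (ler_norm _)).
Qed.

Lemma cvg_L1loc_conv f : L1loc f -> cvg_L1loc (fun eps => conv (Num.sqrt eps) f) f.
Proof.
move=> hf K cK; have [r r0 Kr] := compact_sub_cball cK.
have [_ /(_ r)Hf] := mollifiable_L1loc hf.
have mK : measurable K by apply: closed_measurable_rV; apply: compact_closed => //; exact: norm_hausdorff.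
have H0 eps : 0 < eps -> (\int[mu]_(x in K) `|conv (Num.sqrt eps) f x - f x|%:E <=
    (\int[mu]_(x in cball n r) `|conv (Num.sqrt eps) f x - f x|)%:E)%E.
  move=> e0; have d0 : 0 < Num.sqrt eps by rewrite sqrtr_gt0.
  have hc : L1loc (fun x => conv (Num.sqrt eps) f x - f x).
    have := L1loc_lin (-1) hf (L1loc_conv d0 hf); congr L1loc; apply/funext => x.
    by rewrite mulN1r addrC.
  have ic := L1loc_integrable (L1loc_norm hc) (ltW r0).
  rewrite /Rintegral fineK; last exact: integrable_fin_num.
  apply: ge0_subset_integral => //.
  by case/integrableP: ic.
have P0 eps : (0 <= \int[mu]_(x in K) `|conv (Num.sqrt eps) f x - f x|%:E)%E by exact: integral_ge0.
apply/fine_cvgP; split.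
  near=> eps; rewrite ge0_fin_numE//.
  by apply: (le_lt_trans (H0 eps _)); rewrite ?ltry.
apply/cvgrPdist_le => e e0; have [del del0 Hd] := Hf e (ltW r0) e0.
near=> eps.
have eps0 : 0 < eps by [].
rewrite /= sub0r normrN ger0_norm ?fine_ge0//.
rewrite -lee_fin fineK; last by rewrite ge0_fin_numE// (le_lt_trans (H0 eps eps0))// ltry.
apply: (le_trans (H0 eps eps0)); rewrite lee_fin; apply: Hd; first by rewrite sqrtr_gt0.
rewrite -[del]gtr0_norm// -sqrtr_sqr ltr_sqrt ?exprn_gt0//.
by near: eps; apply: nbhs_right_lt; rewrite exprn_gt0.
Unshelve. all: by end_near.
Qed.

End mollifiable_sets.

(** * Lower bound by duality *)

Section lower_duality.
Context {R : realType} {n : nat}.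
Local Notation mu := (lebesgue_rV R n).
Local Notation V := ('rV[R]_n).

Lemma L1loc_integrable_ocube (F : V -> R) z (O : 'M[R]_n) h : L1loc F -> 0 < h -> O *m O^T = 1%:M ->
  mu.-integrable (ocube z O h) (EFin \o F).
Proof.
move=> hF h0 OO; have r0 : 0 <= enorm z + n%:R * h by rewrite addr_ge0 ?enorm_ge0// mulr_ge0// ltW.
have mQ : measurable (ocube z O h) by exact: measurable_ocube.
apply: (integrableS (measurable_cball (enorm z + n%:R * h)) mQ _ (L1loc_integrable hF r0)).
move=> x Qx; apply/cballE => //; rewrite (le_trans (norm_le_enorm _))//.
by apply: ocube_enorm Qx => //; exact: ltW.
Qed.

Lemma test_le_oscillation (F psi : V -> R) z (O : 'M[R]_n) h : L1loc F -> 0 < h -> O *m O^T = 1%:M ->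
  measurable_fun setT psi -> (forall x, `|psi x| <= 1) -> \int[mu]_(x in ocube z O h) psi x = 0 ->
  \int[mu]_(x in ocube z O h) (F x * psi x) <=
  \int[mu]_(x in ocube z O h) `|F x - average F (ocube z O h)|.
Proof.
move=> hF h0 OO mpsi psi1 psi0; set Q := ocube z O h; set a := average F Q.
have mQ : measurable Q by exact: measurable_ocube.
have Qoo : (mu Q < +oo)%E by rewrite /Q lebesgue_ocube// ltry.
have iF : mu.-integrable Q (EFin \o F) by exact: L1loc_integrable_ocube.
have ipsi : mu.-integrable Q (EFin \o psi) by apply: (bounded_integrable (C := 1)) => //; exact: measurable_funTS.
have ia : mu.-integrable Q (EFin \o (fun=> a)) by apply: (bounded_integrable (C := `|a|)).
have iFa := integrableBR mQ iF ia.
have iN : mu.-integrable Q (EFin \o (fun x => `|F x - a|)).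
  by have := integrable_abse iFa; apply: eq_integrable.
have iFp : mu.-integrable Q (EFin \o (fun x => F x * psi x)).
  by apply: (integrableM_bounded mQ iF (measurable_funTS mpsi)) => x _; exact: psi1.
rewrite -[leLHS]subr0 -(mulr0 a) -psi0 -(RintegralZl a mQ ipsi) -RintegralB//; last exact: integrableZlR.
apply: le_Rintegral => //; first by apply: integrableBR => //; exact: integrableZlR.
move=> x _; rewrite -mulrBl (le_trans (ler_norm _))// normrM.
by rewrite ler_piMr.
Qed.

Lemma Kfun_test (eps C : R) (F : V -> R) (I : eqType) (s : seq I) (z : I -> V) (O : I -> 'M[R]_n)
    (psi : I -> V -> R) : 0 < eps -> (0 < n)%N -> L1loc F -> (Kfun eps F <= C%:E)%E -> uniq s ->
  (forall i, O i *m (O i)^T = 1%:M) ->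
  (forall i j x, i \in s -> j \in s -> ocube (z i) (O i) (eps / 2) x -> ocube (z j) (O j) (eps / 2) x -> i = j) ->
  (forall i, measurable_fun setT (psi i)) -> (forall i x, `|psi i x| <= 1) ->
  (forall i, \int[mu]_(x in ocube (z i) (O i) (eps / 2)) psi i x = 0) ->
  \sum_(i <- s) \int[mu]_(x in ocube (z i) (O i) (eps / 2)) (F x * psi i x) <= eps * C.
Proof.
move=> e0 n0 hF FC us OO disj mpsi psi1 psi0; pose Q i := ocube (z i) (O i) (eps / 2).
have h0 : 0 < eps / 2 by rewrite divr_gt0.
have e2 : 2 * (eps / 2) = eps by rewrite mulrC divfK.
have Q0 i : Q i (z i).
  by apply/(ocubeP _ _ _ (OO i)); exists 0; rewrite ?mul0mx ?addr0// => j; rewrite mxE; lra.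
(* [Kfun] ranges over sets of cubes while the test uses a list; each cube contains its centre, so
   disjoint cubes of the list are distinct as sets and the two sums have the same terms. *)
have Qinj : {in s &, injective Q}.
  by move=> i j si sj Qij; apply: (disj i j (z i)) => //; rewrite -/(Q j) -?Qij; exact: Q0.
pose H : set (set V) := [set` map Q s].
have Hs A : H A <-> exists2 i, i \in s & A = Q i.
  by split=> [/mapP[i si ->]|[i si ->]]; [exists i|apply/mapP; exists i].
have HK : ((eps ^+ n.-1)%:E * (\esum_(A in H) mean_osc F A) <= C%:E)%E.
  apply: le_trans FC; apply: ereal_sup_ubound; exists H => //; split.
    by move=> A /Hs[i si ->]; apply/cubeP; exists (z i), (O i).
  move=> A B /Hs[i si ->] /Hs[j sj ->] [x [xi xj]]; congr Q.
  exact: (disj i j x).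
have mQ i : measurable (Q i) by exact: measurable_ocube.
have qE i : fine (mu (Q i)) = eps ^+ n by rewrite lebesgue_ocube//= e2.
have oscE i : mean_osc F (Q i) = ((eps ^+ n)^-1 * \int[mu]_(x in Q i) `|F x - average F (Q i)|)%:E.
  rewrite /mean_osc qE EFinM; congr (_ * _)%E; rewrite /Rintegral fineK//.
  have iF : mu.-integrable (Q i) (EFin \o F) by exact: L1loc_integrable_ocube.
  have Qoo : (mu (Q i) < +oo)%E by rewrite lebesgue_ocube// ltry.
  have ia : mu.-integrable (Q i) (EFin \o (fun=> average F (Q i))).
    by apply: (bounded_integrable (C := `|average F (Q i)|)).
  apply: integrable_fin_num => //.
  by have := integrable_abse (integrableBR (mQ i) iF ia); apply: eq_integrable.
have finH : finite_set H by exact: finite_seq.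
have EH : (\esum_(A in H) mean_osc F A = \sum_(i <- s) mean_osc F (Q i))%E.
  rewrite esum_fset//; last by move=> A; rewrite inE => /Hs[i _ ->]; rewrite oscE lee_fin mulr_ge0 ?invr_ge0 ?exprn_ge0 ?(ltW e0)// Rintegral_ge0.
  rewrite -(big_map Q xpredT (mean_osc F)) /H [RHS]fsbig_seq//.
  by rewrite map_inj_in_uniq.
move: HK; rewrite EH; under eq_bigr do rewrite oscE.
rewrite sumEFin -EFinM lee_fin -mulr_sumr mulrA => HK.
have eE : eps ^+ n.-1 * (eps ^+ n)^-1 = eps^-1.
  by rewrite -[in X in X^-1](prednK n0) exprS invfM mulrCA mulfV ?mulr1// gt_eqF// exprn_gt0.
move: HK; rewrite eE ler_pdivrMl// => HK; apply: le_trans HK.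
by apply: ler_sum => i _; exact: test_le_oscillation.
Qed.

(* The translates of the family by y compete in Kfun; averaging over y with
   weight moll d y replaces F by its mollification. *)
Lemma Kfun_test_conv (d eps C : R) (F : V -> R) (I : eqType) (s : seq I) (z : I -> V) (O : I -> 'M[R]_n)
    (psi : I -> V -> R) : 0 < d -> 0 < eps -> (0 < n)%N -> L1loc F -> (Kfun eps F <= C%:E)%E -> uniq s ->
  (forall i, O i *m (O i)^T = 1%:M) ->
  (forall i j x, i \in s -> j \in s -> ocube (z i) (O i) (eps / 2) x -> ocube (z j) (O j) (eps / 2) x -> i = j) ->
  (forall i, measurable_fun setT (psi i)) -> (forall i x, `|psi i x| <= 1) ->
  (forall i, \int[mu]_(x in ocube (z i) (O i) (eps / 2)) psi i x = 0) ->
  \sum_(i <- s) \int[mu]_(x in ocube (z i) (O i) (eps / 2)) (psi i x * conv d F x) <= eps * C.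
Proof.
move=> d0 e0 n0 hF FC us OO disj mpsi psi1 psi0; pose Q i := ocube (z i) (O i) (eps / 2).
have h0 : 0 < eps / 2 by rewrite divr_gt0.
have mQ i : measurable (Q i) by exact: measurable_ocube.
have Qoo i : (mu (Q i) < +oo)%E by rewrite /Q lebesgue_ocube// ltry.
have nh0 : 0 <= n%:R * (eps / 2) by rewrite mulr_ge0// ltW.
pose r := \sum_(i <- s) (enorm (z i) + n%:R * (eps / 2)).
have zr0 i : 0 <= enorm (z i) + n%:R * (eps / 2) by rewrite addr_ge0// enorm_ge0.
have r0 : 0 <= r by exact: sumr_ge0.
have rd0 : 0 <= r + d by rewrite addr_ge0// ltW.
have Qr i : i \in s -> Q i `<=` cball n r.
  move=> si x Qx; apply/cballE => //; rewrite (le_trans (norm_le_enorm _))//.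
  rewrite (@le_trans _ _ (enorm (z i) + n%:R * (eps / 2)))//.
    by apply: ocube_enorm Qx => //; exact: ltW.
  by rewrite /r (big_rem i)//= lerDl sumr_ge0.
pose B := cball n (r + d) : set V.
have mB : measurable B by exact: measurable_cball.
pose D := cball n d : set V.
have mD : measurable D by exact: measurable_cball.
have iF : mu.-integrable B (EFin \o F) := L1loc_integrable hF rd0.
have iD : mu.-integrable D (EFin \o moll d).
  by apply: (integrableS measurableT mD) => //; exact: integrable_moll.
have ipsi i : mu.-integrable (Q i) (EFin \o psi i).
  exact: (bounded_integrable (mQ i) (Qoo i) (measurable_funTS (mpsi i)) (fun w _ => psi1 i w)).
pose psiQ i : V -> R := psi i \_ (Q i).
have mpsiQ i : measurable_fun setT (psiQ i) by apply/(measurable_restrictT _ (mQ i)); exact: measurable_funTS.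
have psiQ1 i x : `|psiQ i x| <= 1.
  by rewrite /psiQ patchE; case: ifPn => // _; rewrite normr0.
have mK i : measurable_fun setT (fun p : V * V => psiQ i (p.1 + p.2)).
  apply: (measurableT_comp (mpsiQ i)).
  by apply: measurable_addrV2; [exact: measurable_fst|exact: measurable_snd].
have K1 i (p : V * V) : `|psiQ i (p.1 + p.2)| <= 1 by exact: psiQ1.
(* Fubini brings out [F], the substitution [w = x + y] shifts the kernel onto [psi], and a second
   Fubini leaves an average over [y] of tests of [F] itself against translated signs. *)
have E1 i : i \in s -> \int[mu]_(w in Q i) (psi i w * conv d F w) =
    \int[mu]_(y in D) (moll d y * \int[mu]_(x in B) (F x * psiQ i (x + y))).
  move=> si.
  have m1 := @measurable_moll_sub2 R n d.
  transitivity (\int[mu]_(w in Q i) (psi i w * \int[mu]_(x in B) (F x * moll d (w - x)))).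
    by apply: eq_Rintegral => w /[!inE] Qw; rewrite (conv_local F d0 (Qr _ si _ Qw)).
  rewrite (weighted_fubini (mQ i) mB (ipsi i) iF m1 (fun p => moll_le d0 (p.1 - p.2))) /=.
  rewrite -(weighted_fubini mB mD iF iD (mK i) (K1 i)) /=.
  apply: eq_Rintegral => x _; congr (_ * _).
  have mshift (A : set V) : measurable A -> mu ((fun y => y + x) @^-1` A) = mu A.
    by move=> mA; rewrite -(lebesgue_rV_shift x mA).
  have mg : measurable_fun setT (fun w => psiQ i w * moll d (w - x)).
    apply: measurable_funM => //; apply: (measurableT_comp (measurable_moll d)).
    exact: measurable_addrV.
  transitivity (\int[mu]_w (psiQ i w * moll d (w - x))).
    rewrite [LHS]Rintegral_mkcond; apply: eq_Rintegral => w _; rewrite /psiQ !patchE.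
    by case: (w \in Q i); rewrite ?mul0r.
  rewrite -(Rintegral_preserving (measurable_addrV x) mshift measurableT mg) preimage_setT.
  rewrite [RHS]Rintegral_mkcond; apply: eq_Rintegral => y _.
  rewrite patchE addrK [y + x]addrC mulrC; case: ifPn => // /negP yD.
  rewrite moll_out ?mul0r// leNgt; apply/negP => yd.
  by apply: yD; rewrite inE; apply/(cballE _ (ltW d0)); rewrite (le_trans (norm_le_enorm _))// ltW.
rewrite big_seq; rewrite (eq_bigr _ E1) -big_seq.
have iy i : mu.-integrable D (EFin \o (fun y => moll d y * \int[mu]_(x in B) (F x * psiQ i (x + y)))).
  have mK' : measurable_fun setT (fun p : V * V => psiQ i (p.2 + p.1)).
    apply: (measurableT_comp (mpsiQ i)).
    by apply: measurable_addrV2; [exact: measurable_snd|exact: measurable_fst].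
  exact: (integrable_weighted_inner mD mB iD iF mK' (fun p => psiQ1 i (p.2 + p.1))).
rewrite -Rintegral_sum//.
have mollD : \int[mu]_(y in D) moll d y = 1.
  rewrite -(@Rintegral_moll R n d d0) [LHS]Rintegral_mkcond; apply: eq_Rintegral => y _.
  rewrite patchE; case: ifPn => // /negP yD; rewrite moll_out// leNgt; apply/negP => yd.
  by apply: yD; rewrite inE; apply/(cballE _ (ltW d0)); rewrite (le_trans (norm_le_enorm _))// ltW.
rewrite -[leRHS]mul1r -mollD -RintegralZr//.
apply: le_Rintegral => //; first exact: integrable_sumR.
  by have := integrableZlR (eps * C) mD iD; apply: eq_integrable => // y _ /=; rewrite mulrC.
move=> y Dy; rewrite -mulr_sumr; apply: ler_wpM2l; first exact: moll_ge0.
(* For fixed [y] the integrand is a test on the family translated by [- y]; being again disjoint, it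
   obeys [Kfun_test] with the same constant. *)
pose z' i := z i - y.
have shQ i x : ocube (z' i) (O i) (eps / 2) x <-> Q i (x + y).
  by rewrite /Q /ocube/= /z' opprB addrA.
have [ms1 ms2] : measurable_fun setT (fun x : V => x + y) /\ True by split => //; exact: measurable_addrV.
have mshift (A : set V) : measurable A -> mu ((fun x => x + y) @^-1` A) = mu A.
  by move=> mA; rewrite -(lebesgue_rV_shift y mA).
have preQ i : (fun x => x + y) @^-1` Q i = ocube (z' i) (O i) (eps / 2).
  by rewrite predeqE => x; split => [H|H]; [exact: (shQ i x).2 H|exact: (shQ i x).1 H].
have KT := @Kfun_test eps C F I s z' O (fun i x => psi i (x + y)) e0 n0 hF FC us OO.
apply: (le_trans _ (KT _ _ _ _)).
- rewrite big_seq [leRHS]big_seq; apply: ler_sum => i si; apply: eq_ler.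
  rewrite [LHS]Rintegral_mkcond [RHS]Rintegral_mkcond; apply: eq_Rintegral => x _.
  rewrite !patchE -preQ /psiQ patchE.
  have -> : (x \in (fun x => x + y) @^-1` Q i) = (x + y \in Q i) by apply/idP/idP; rewrite !inE.
  have [xB|xB] := boolP (x \in B); first by case: (x + y \in Q i); rewrite ?mulr0.
  case: ifPn => // /set_mem Qxy; case/negP: xB; rewrite inE; apply/cballE => //.
  rewrite -(addrK y x) (le_trans (ler_normB _ _))// lerD//.
    by apply/cballE => //; exact: Qr si _ Qxy.
  exact/(cballE _ (ltW d0)).
- move=> i j x si sj /shQ xi /shQ xj; exact: (disj i j (x + y)).
- by move=> i; apply: (measurableT_comp (mpsi i)).
- by move=> i x; exact: psi1.
- move=> i; rewrite -(psi0 i) -preQ.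
  exact: (Rintegral_preserving (measurable_addrV y) mshift (mQ i) (measurable_funTS (mpsi i))).
Qed.

End lower_duality.

(** * The gradient of a mollification *)

Section gradient_of_mollification.
Context {R : realType} {n : nat}.
Local Notation mu := (lebesgue_rV R n).
Local Notation V := ('rV[R]_n).
Variables (d : R) (d0 : 0 < d).
Implicit Types (f g : V -> R) (x y a : V) (r : R).

Let mb r : measurable (cball n r : set V). Proof. exact: measurable_cball. Qed.

Lemma normr_Rintegral_weight_le (B : set V) f g (c : R) : measurable B -> mu.-integrable B (EFin \o f) ->
  measurable_fun B g -> (forall y, B y -> `|g y| <= c) ->
  `|\int[mu]_(y in B) (f y * g y)| <= c * \int[mu]_(y in B) `|f y|.
Proof.
move=> mB iB mg gc; have iN : mu.-integrable B (EFin \o (fun y => `|f y|)).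
  by have := integrable_abse iB; apply: eq_integrable.
have ifg := integrableM_bounded mB iB mg gc.
apply: (le_trans (le_normr_Rintegral mB ifg)); rewrite -RintegralZl//.
apply: le_Rintegral => //.
- by have := integrable_abse ifg; apply: eq_integrable.
- exact: integrableZlR.
- by move=> y By; rewrite normrM [leRHS]mulrC ler_wpM2l// gc.
Qed.

(** The gradient of [conv d f], given by its formula; [conv_quadratic] is what identifies it as a
    gradient. Every bound below depends on [f] only through an L^1 norm on a ball, and is therefore
    stable under L^1_loc convergence. *)
Definition gconv f x : V := \row_i \int[mu]_y (f y * dmoll d (x - y) ord0 i).

Lemma measurable_dot_dmoll_sub x a : measurable_fun setT (fun y : V => dot (dmoll d (x - y)) a).
Proof.
apply: (measurableT_comp (measurable_dot_dmoll d a)).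
exact: (@measurable_subrV2 R n _ _ (cst x)).
Qed.

Lemma integrable_dot_gconv f x a r : L1loc f -> 0 <= r ->
  mu.-integrable (cball n r) (EFin \o (fun y => f y * dot (dmoll d (x - y)) a)).
Proof.
move=> hf r0; apply: (integrableM_bounded (C := @moll_lip R n d * enorm a)) => //.
- exact: L1loc_integrable.
- by apply: measurable_funTS; exact: measurable_dot_dmoll_sub.
- by move=> y _; exact: dmoll_le.
Qed.

Lemma dot_gconv f x a r : L1loc f -> 0 <= r -> cball n r x ->
  dot (gconv f x) a = \int[mu]_(y in cball n (r + d)) (f y * dot (dmoll d (x - y)) a).
Proof.
move=> hf r0 xr; have rd0 : 0 <= r + d by rewrite addr_ge0// ltW.
have E i : gconv f x ord0 i = \int[mu]_(y in cball n (r + d)) (f y * dot (dmoll d (x - y)) (delta_mx ord0 i)).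
  rewrite [LHS]mxE [RHS]Rintegral_mkcond; apply: eq_Rintegral => y _.
  rewrite patchE dot_delta; case: ifPn => // /negP yr.
  rewrite dmoll_out ?mxE ?mulr0// leNgt; apply/negP => xy; apply: yr; rewrite inE.
  apply/cballE => //; rewrite -(subrK x y) addrC (le_trans (ler_normD _ _))// lerD//.
    exact/cballE.
  by rewrite -normrN opprB (le_trans (norm_le_enorm _))// ltW.
have iE i := integrable_dot_gconv x (delta_mx ord0 i) hf rd0.
transitivity (\sum_i \int[mu]_(y in cball n (r + d)) (a ord0 i * (f y * dot (dmoll d (x - y)) (delta_mx ord0 i)))).
  by apply: eq_bigr => i _; rewrite E mulrC (RintegralZl _ (mb _) (iE i)).
rewrite -Rintegral_sum//; last by move=> i _; exact: (integrableZlR _ (mb _) (iE i)).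
apply: eq_Rintegral => y _; rewrite [dot _ a]/dot mulr_sumr; apply: eq_bigr => i _.
by rewrite dot_delta mulrCA [a _ _ * _]mulrC.
Qed.

Lemma dot_gconv_le f x a r : L1loc f -> 0 <= r -> cball n r x ->
  `|dot (gconv f x) a| <= @moll_lip R n d * enorm a * \int[mu]_(y in cball n (r + d)) `|f y|.
Proof.
move=> hf r0 xr; have rd0 : 0 <= r + d by rewrite addr_ge0// ltW.
rewrite (dot_gconv a hf r0 xr); apply: normr_Rintegral_weight_le => //.
- exact: L1loc_integrable.
- by apply: measurable_funTS; exact: measurable_dot_dmoll_sub.
- by move=> y _; exact: dmoll_le.
Qed.

Lemma dot_gconv_sub_le f g x a r : L1loc f -> L1loc g -> 0 <= r -> cball n r x ->
  `|dot (gconv f x) a - dot (gconv g x) a| <=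
  @moll_lip R n d * enorm a * \int[mu]_(y in cball n (r + d)) `|f y - g y|.
Proof.
move=> hf hg r0 xr; have rd0 : 0 <= r + d by rewrite addr_ge0// ltW.
rewrite (dot_gconv a hf r0 xr) (dot_gconv a hg r0 xr).
rewrite -RintegralB//; [|exact: integrable_dot_gconv..].
under [in leLHS]eq_Rintegral do rewrite -mulrBl.
apply: normr_Rintegral_weight_le => //.
- by apply: integrableBR => //; exact: L1loc_integrable.
- by apply: measurable_funTS; exact: measurable_dot_dmoll_sub.
- by move=> y _; exact: dmoll_le.
Qed.

Lemma dot_gconv_lipschitz f x x' a r : L1loc f -> 0 <= r -> cball n r x -> cball n r x' ->
  `|dot (gconv f x) a - dot (gconv f x') a| <=
  6 * @moll_C2 R n d * enorm (x - x') * enorm a * \int[mu]_(y in cball n (r + d)) `|f y|.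
Proof.
move=> hf r0 xr xr'; have rd0 : 0 <= r + d by rewrite addr_ge0// ltW.
rewrite (dot_gconv a hf r0 xr) (dot_gconv a hf r0 xr').
rewrite -RintegralB//; [|exact: integrable_dot_gconv..].
under [in leLHS]eq_Rintegral do rewrite -mulrBr -dotBl.
apply: normr_Rintegral_weight_le => //.
- exact: L1loc_integrable.
- apply: measurable_funTS; under eq_fun do rewrite dotBl.
  by apply: measurable_funB; exact: measurable_dot_dmoll_sub.
- move=> y _; have := dmoll_lipschitz d0 (x - y) (x' - y) a.
  by rewrite opprB addrA subrK.
Qed.

Lemma conv_quadratic f x k r : L1loc f -> 0 <= r -> cball n r x -> cball n r (x + k) ->
  `|conv d f (x + k) - conv d f x - dot (gconv f x) k| <=
  @moll_C2 R n d * dot k k * \int[mu]_(y in cball n (r + d)) `|f y|.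
Proof.
move=> hf r0 xr xr'; have rd0 : 0 <= r + d by rewrite addr_ge0// ltW.
rewrite (dot_gconv k hf r0 xr) (conv_local f d0 xr r0) (conv_local f d0 xr' r0).
have i1 := integrable_conv (x + k) d0 hf rd0; have i2 := integrable_conv x d0 hf rd0.
have i3 := integrable_dot_gconv x k hf rd0.
rewrite -(RintegralB (mb _) i1 i2) -RintegralB//; last exact: integrableBR.
under [in leLHS]eq_Rintegral do rewrite -mulrBr -mulrBr.
apply: normr_Rintegral_weight_le => //.
- exact: L1loc_integrable.
- apply: measurable_funTS; apply: measurable_funB; last exact: measurable_dot_dmoll_sub.
  apply: measurable_funB; apply: (measurableT_comp (measurable_moll d)).
    exact: (@measurable_subrV2 R n _ _ (cst (x + k))).
  exact: (@measurable_subrV2 R n _ _ (cst x)).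
- move=> y _; have := moll_quadratic d0 (x - y) k.
  by have -> : x + k - y = x - y + k by rewrite addrAC.
Qed.

End gradient_of_mollification.

(** * Sign functions adapted to a direction *)

Section oriented_test.
Context {R : realType} {n : nat}.
Local Notation mu := (lebesgue_rV R n.+1).
Local Notation V := ('rV[R]_n.+1).
Implicit Types (a z w : V) (O : 'M[R]_n.+1).

Lemma dot_mx11 a w : a *m w^T = (dot a w)%:M.
Proof. by rewrite dotE [LHS]mx11_scalar. Qed.

(* The Householder reflection exchanging the first basis vector and a / |a|. *)
Lemma frame_along a : exists O, O *m O^T = 1%:M /\ a = enorm a *: (delta_mx ord0 ord0 *m O).
Proof.
have [->|a0] := eqVneq a 0.
  by exists 1%:M; rewrite trmx1 mulmx1 enorm0 scale0r.
pose e : V := delta_mx ord0 ord0; pose u := (enorm a)^-1 *: a.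
have na : enorm a != 0 by rewrite enorm_eq0.
have au : a = enorm a *: u by rewrite /u scalerA divff// scale1r.
have uu : dot u u = 1.
  by rewrite -sqr_enorm /u enormZ ger0_norm ?invr_ge0 ?enorm_ge0// mulVf// expr1n.
have ee : dot e e = 1 by rewrite dot_delta /e mxE !eqxx.
(* The reflection degenerates when [u] is already the first basis vector; the identity serves
   then. *)
have [ue|ue] := eqVneq (e - u) 0.
  exists 1%:M; rewrite trmx1 mulmx1; split => //; rewrite mulmx1 {1}au; congr (_ *: _).
  by apply/eqP; rewrite eq_sym -subr_eq0 -/e ue.
pose v := e - u; pose c := dot v v.
have c0 : c != 0 by rewrite /c dot_eq0.
(* For unit vectors the coefficient [2 / c] times [dot v e] is 1, so the reflection takes exactly
   [v] off [e] and leaves [u]. *)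
have cE : c = 2 * (1 - dot e u).
  by rewrite /c /v !dotBl ![dot _ (_ - _)]dotC !dotBl ee uu (dotC u e); ring.
pose O : 'M[R]_n.+1 := 1%:M - (2 / c) *: (v^T *m v).
have OT : O^T = O by rewrite /O linearB/= linearZ/= trmx1 trmx_mul trmxK.
exists O; split.
  pose P := v^T *m v; pose t := 2 / c.
  have PP : P *m P = c *: P.
    by rewrite /P mulmxA -(mulmxA v^T) dot_mx11 mul_mx_scalar -scalemxAl.
  rewrite OT /O -/P -/t mulmxBr mulmx1 mulmxBl mul1mx -scalemxAl -scalemxAr PP !scalerA.
  have -> : t * t * c = t + t by rewrite /t; field.
  have -> : t *: P - (t + t) *: P = - (t *: P) by rewrite -scalerBl opprD addrA subrr sub0r scaleNr.
  by rewrite opprK subrK.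
rewrite {1}au; congr (_ *: _); rewrite -/e /O mulmxBr mulmx1 -scalemxAr mulmxA dot_mx11.
rewrite mul_scalar_mx scalerA {1}/v dotC dotBl ee (dotC u e) cE.
have -> : 2 / (2 * (1 - dot e u)) * (1 - dot e u) = 1.
  by field; apply: contraNneq c0 => H; rewrite cE H mulr0.
by rewrite scale1r /v opprB addrC subrK.
Qed.

(** The components of [b] other than the first integrate to 0 by symmetry in the remaining
    coordinates; the first one meets the absolute moment along an edge, the extremal value. *)
Lemma Rintegral_sgr_coord0_dot (h : R) (b : V) : 0 < h ->
  \int[mu]_(v in ucube n.+1 h) (Num.sg (v ord0 ord0) * dot b v) =
  b ord0 ord0 * ((2 * h) ^+ n.+1 * (h / 2)).
Proof.
move=> h0; have mU := @measurable_ucube R n.+1 h.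
have cid : continuous (@id R) by move=> x; exact: cvg_id.
have msg : measurable_fun setT (fun v : V => Num.sg (v ord0 ord0)).
  exact: (measurableT_comp measurable_sgr (@measurable_coord R n.+1 ord0)).
have mf : measurable_fun setT (fun v : V => Num.sg (v ord0 ord0) * dot b v).
  by apply: measurable_funM => //; exact: (measurable_comp_dot b cid).
have fC (v : V) : ucube n.+1 h v -> `|Num.sg (v ord0 ord0) * dot b v| <= 1 * (enorm b * (n.+1%:R * h)).
  move=> uv; rewrite normrM ler_pM//; last by apply: dot_ucube_bounded => //; exact: ltW.
  by rewrite normr_sg lern1 leq_b1.
have mf2 : measurable_fun setT (fun v : V => `|v ord0 ord0|).
  exact: (measurableT_comp (@normr_measurable R setT) (@measurable_coord R n.+1 ord0)).
have fC2 (v : V) : ucube n.+1 h v -> `| `|v ord0 ord0| | <= h.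
  by move=> /(_ ord0) /andP[v1 v2]; rewrite normr_id ler_norml !ltW.
have i2 : mu.-integrable (ucube n.+1 h) (EFin \o (fun v : V => `|v ord0 ord0|)).
  apply: (bounded_integrable (C := h)) => //; last exact: measurable_funTS.
  exact: lebesgue_ucube_lty.
rewrite -Rintegral_normr_coord0// -(RintegralZl _ mU i2).
have mf3 : measurable_fun setT (fun v : V => b ord0 ord0 * `|v ord0 ord0|) by apply: measurable_funM.
have fC3 (v : V) : ucube n.+1 h v -> `|b ord0 ord0 * `|v ord0 ord0| | <= `|b ord0 ord0| * h.
  by move=> uv; rewrite normrM ler_wpM2l// fC2.
rewrite (Rintegral_ucube h0 mf fC) (Rintegral_ucube h0 mf3 fC3).
apply: eq_Rintegral => t _.
have mU' := @measurable_ucube R n h.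
have i1 := integrable_comp_dot (rV_behead b) h0 cid.
have D0 : \int[lebesgue_rV R n]_(v in ucube n h) dot (rV_behead b) v = 0.
  have := @Rintegral_ucubeN R n h (dot (rV_behead b)).
  move/(_ (measurable_funTS (measurable_comp_dot _ cid))).
  under eq_Rintegral do rewrite dotNr -mulN1r.
  rewrite RintegralZl//.
  by move: (Rintegral _ _ _) => J; lra.
transitivity (\int[lebesgue_rV R n]_(v in ucube n h) (Num.sg t * (b ord0 ord0 * t) + Num.sg t * dot (rV_behead b) v)).
  by apply: eq_Rintegral => v _; rewrite rV_cons0 dot_cons mulrDr.
have ic c : (lebesgue_rV R n).-integrable (ucube n h) (EFin \o (fun=> c : R)).
  by apply: (bounded_integrable (C := `|c|)) => //; exact: lebesgue_ucube_lty.
rewrite (RintegralD mU' (ic _) (integrableZlR _ mU' i1)) (RintegralZl _ mU' i1) D0 mulr0 addr0.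
by apply: eq_Rintegral => v _; rewrite rV_cons0 /= mulrCA -normrEsg.
Qed.

Lemma Rintegral_sgr_coord0 (h : R) : 0 < h ->
  \int[mu]_(v in ucube n.+1 h) Num.sg (v ord0 ord0) = 0.
Proof.
move=> h0; have mU := @measurable_ucube R n.+1 h.
have msg : measurable_fun setT (fun v : V => Num.sg (v ord0 ord0)).
  exact: (measurableT_comp measurable_sgr (@measurable_coord R n.+1 ord0)).
have i1 : mu.-integrable (ucube n.+1 h) (EFin \o (fun v : V => Num.sg (v ord0 ord0))).
  apply: (bounded_integrable (C := 1)) => //; [exact: lebesgue_ucube_lty|exact: measurable_funTS|].
  by move=> v _; rewrite normr_sg lern1 leq_b1.
have := @Rintegral_ucubeN R n.+1 h (fun v => Num.sg (v ord0 ord0)) (measurable_funTS msg).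
under eq_Rintegral do rewrite mxE sgrN -mulN1r.
rewrite (RintegralZl _ mU i1).
by move: (Rintegral _ _ _) => J; lra.
Qed.

(** In row-vector convention the first row of [O] is an edge direction of the cube. When [a] is
    [enorm a] times that row, the first moment of this function is a multiple of [a]; the amplitude
    keeps it an admissible test as soon as [a] has norm at most 1. *)
Definition oriented_sign z O a w : R := enorm a * Num.sg (((w - z) *m O^T) ord0 ord0).

Lemma measurable_oriented_sign z O a : measurable_fun setT (oriented_sign z O a).
Proof.
apply: measurable_funM => //; apply: (measurableT_comp measurable_sgr).
apply: (measurableT_comp (@measurable_coord R n.+1 ord0)).
apply: (measurableT_comp (@measurable_mulmx R n.+1 O^T)).
exact: measurable_addrV.
Qed.

Lemma oriented_sign_le z O a w : `|oriented_sign z O a w| <= enorm a.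
Proof.
by rewrite normrM (ger0_norm (enorm_ge0 a)) ler_piMr ?enorm_ge0// normr_sg lern1 leq_b1.
Qed.

Lemma oriented_signE z O a v : O *m O^T = 1%:M ->
  oriented_sign z O a (z + v *m O) = enorm a * Num.sg (v ord0 ord0).
Proof. by move=> OO; rewrite /oriented_sign (addrC z) addrK -mulmxA OO mulmx1. Qed.

Lemma Rintegral_oriented_sign z O a h : 0 < h -> O *m O^T = 1%:M ->
  \int[mu]_(w in ocube z O h) oriented_sign z O a w = 0.
Proof.
move=> h0 OO; rewrite Rintegral_ocube//; last by apply: measurable_funTS; exact: measurable_oriented_sign.
under eq_Rintegral do rewrite oriented_signE//.
rewrite RintegralZl ?Rintegral_sgr_coord0 ?mulr0//; first exact: measurable_ucube.
apply: (bounded_integrable (C := 1)).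
- exact: measurable_ucube.
- exact: lebesgue_ucube_lty.
- apply: measurable_funTS.
  exact: (measurableT_comp measurable_sgr (@measurable_coord R n.+1 ord0)).
- by move=> v _; rewrite normr_sg lern1 leq_b1.
Qed.

(** The mollification is linearised at the centre. The constant is killed by the zero mean, the
    linear part gives exactly [h / 2 * dot g a] times the volume because [a] lies along an edge, and
    the remainder is the quadratic one at distance [n.+1 * h]. *)
Lemma oriented_sign_conv_ge (d h r : R) (F : V -> R) z O a : 0 < d -> 0 < h -> 0 <= r ->
  L1loc F -> O *m O^T = 1%:M -> a = enorm a *: (delta_mx ord0 ord0 *m O) ->
  cball n.+1 r z -> ocube z O h `<=` cball n.+1 r ->
  (2 * h) ^+ n.+1 * (h / 2 * dot (gconv d F z) a -
    enorm a * (@moll_C2 R n.+1 d * (n.+1%:R * h) ^+ 2 * \int[mu]_(y in cball n.+1 (r + d)) `|F y|)) <=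
  \int[mu]_(w in ocube z O h) (oriented_sign z O a w * conv d F w).
Proof.
move=> d0 h0 r0 hF OO aO zr Qr; set Q := ocube z O h; set g := gconv d F z.
set E := moll_C2 d * _ * _.
have mQ : measurable Q by exact: measurable_ocube.
have qE : fine (mu Q) = (2 * h) ^+ n.+1 by rewrite lebesgue_ocube.
have Qoo : (mu Q < +oo)%E by rewrite /Q lebesgue_ocube// ltry.
have ms := measurable_oriented_sign z O a.
have md : measurable_fun setT (fun w => dot g (w - z)).
  apply: (measurableT_comp (f := dot g)); last exact: measurable_addrV.
  by apply: continuous_measurable_rV; exact: continuous_dotl.
pose q w := oriented_sign z O a w * (conv d F z + dot g (w - z)).
have mq : measurable_fun setT q by apply: measurable_funM => //; apply: measurable_funD.
have dist w : Q w -> enorm (w - z) <= n.+1%:R * h by apply: ocube_dist => //; exact: ltW.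
have iq : mu.-integrable Q (EFin \o q).
  apply: (bounded_integrable (C := enorm a * (`|conv d F z| + enorm g * (n.+1%:R * h)))) => //.
    exact: measurable_funTS.
  move=> w Qw; rewrite normrM ler_pM//; first exact: oriented_sign_le.
  rewrite (le_trans (ler_normD _ _))// lerD2l (le_trans (normr_dot_le _ _))//.
  by rewrite ler_wpM2l ?enorm_ge0// dist.
have hc := L1loc_conv d0 hF.
have ic : mu.-integrable Q (EFin \o conv d F) by exact: L1loc_integrable_ocube.
have isc : mu.-integrable Q (EFin \o (fun w => oriented_sign z O a w * conv d F w)).
  have := integrableM_bounded mQ ic (measurable_funTS ms) (fun w _ => oriented_sign_le z O a w).
  by apply: eq_integrable => // w _ /=; rewrite mulrC.
have iE : mu.-integrable Q (EFin \o (fun=> enorm a * E)).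
  by apply: (bounded_integrable (C := `|enorm a * E|)).
have qI : \int[mu]_(w in Q) q w = (2 * h) ^+ n.+1 * (h / 2 * dot g a).
  rewrite /Q Rintegral_ocube//; last exact: measurable_funTS.
  have mU := @measurable_ucube R n.+1 h.
  have msg : measurable_fun setT (fun v : V => Num.sg (v ord0 ord0)).
    exact: (measurableT_comp measurable_sgr (@measurable_coord R n.+1 ord0)).
  have s1 (v : V) : `|Num.sg (v ord0 ord0) : R| <= 1 by rewrite normr_sg lern1 leq_b1.
  have is1 : mu.-integrable (ucube n.+1 h) (EFin \o (fun v : V => Num.sg (v ord0 ord0))).
    by apply: (bounded_integrable (C := 1)) => //; [exact: lebesgue_ucube_lty|exact: measurable_funTS].
  have cid : continuous (@id R) by move=> x; exact: cvg_id.
  have is2 : mu.-integrable (ucube n.+1 h) (EFin \o (fun v : V => Num.sg (v ord0 ord0) * dot (g *m O^T) v)).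
    have := integrableM_bounded mU (integrable_comp_dot (g *m O^T) h0 cid) (measurable_funTS msg) (fun v _ => s1 v).
    by apply: eq_integrable => // v _ /=; rewrite mulrC.
  transitivity (\int[mu]_(v in ucube n.+1 h) (enorm a * conv d F z * Num.sg (v ord0 ord0) +
       enorm a * (Num.sg (v ord0 ord0) * dot (g *m O^T) v))).
    apply: eq_Rintegral => v _; rewrite /q oriented_signE// (addrC z) addrK dot_mulmx; ring.
  rewrite (RintegralD mU (integrableZlR _ mU is1) (integrableZlR _ mU is2)).
  rewrite (RintegralZl _ mU is1) (RintegralZl _ mU is2) Rintegral_sgr_coord0// mulr0 add0r.
  have -> : dot g a = enorm a * (g *m O^T) ord0 ord0.
    by rewrite {1}aO dotC dotZl dotC dot_mulmx dot_delta.
  by rewrite Rintegral_sgr_coord0_dot//; ring.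
rewrite mulrBr -qI [X in _ - X]mulrC -qE -/Q -Rintegral_cst// -RintegralB//.
apply: le_Rintegral => //; first exact: integrableBR.
move=> w Qw; rewrite lerBlDr -lerBlDl /q -mulrBr (le_trans (ler_norm _))// normrM.
apply: ler_pM => //; first exact: oriented_sign_le.
have := @conv_quadratic R n.+1 d d0 F z (w - z) r hF r0 zr.
rewrite addrC subrK -sqr_enorm => /(_ (Qr _ Qw)) H.
rewrite distrC opprD addrA (le_trans H)// /E ler_wpM2r ?Rintegral_ge0//.
rewrite ler_wpM2l ?moll_C2_ge0// ler_pXn2r ?nnegrE ?enorm_ge0 ?dist//.
by rewrite mulr_ge0// ltW.
Qed.

End oriented_test.

(** * Packing boxes with oriented cubes *)

Section grid.
Context {R : realType} {n : nat}.
Local Notation mu := (lebesgue_rV R n).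
Local Notation V := ('rV[R]_n).
Variables (N : nat) (O : 'M[R]_n) (OO : O *m O^T = 1%:M) (s : R) (s0 : 0 < s).
Local Notation K := {ffun 'I_n -> 'I_(N + N)}.
Implicit Types (k : K) (x : V).

(** [k i] runs from 0 to [2N - 1]: subtracting [N] centres the grid at the origin, and 1/2 moves
    from a corner of the cell to its centre. *)
Definition grid_coord k : V := \row_i (s * ((k i)%:R - N%:R + 2^-1)).
Definition grid_center k : V := grid_coord k *m O.
(** Half-open, so that the cells cover and volumes can be compared; the open cubes about the grid
    centres are used for disjointness. *)
Definition grid_cell k : set V :=
  [set x | forall i, `[s * ((k i)%:R - N%:R), s * ((k i)%:R - N%:R + 1)[%classic ((x *m O^T) ord0 i)].

Let OtO : O^T *m O = 1%:M. Proof. exact: mulmx1C. Qed.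

Lemma grid_centerE x k i : ((x - grid_center k) *m O^T) ord0 i =
  (x *m O^T) ord0 i - s * ((k i)%:R - N%:R + 2^-1).
Proof. by rewrite mulmxBl /grid_center -mulmxA OO mulmx1 [LHS]mxE [in X in _ + X]mxE [in X in _ - X]mxE. Qed.

Lemma grid_cube_disjoint k k' x : ocube (grid_center k) O (s / 2) x ->
  ocube (grid_center k') O (s / 2) x -> k = k'.
Proof.
move=> xk xk'; apply/ffunP => i; apply/val_inj => /=.
have := xk i; have := xk' i; rewrite !grid_centerE => /andP[a1 a2] /andP[b1 b2].
have lt1 (a b : nat) : s * (a%:R - N%:R + 2^-1) < s * (b%:R - N%:R + 2^-1) + s -> (a <= b)%N.
  move=> H; rewrite -ltnS -(ltr_nat R) -natr1 -(ltr_pM2l s0).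
  by move: H; lra.
by apply/eqP; rewrite eqn_leq; apply/andP; split; apply: lt1; lra.
Qed.

Lemma grid_cell_cover x : enorm x < s * N%:R -> exists k, grid_cell k x.
Proof.
move=> xN; pose y := x *m O^T.
have yi i : - (s * N%:R) < y ord0 i < s * N%:R.
  rewrite -ltr_norml (le_lt_trans (coord_le_enorm _ _))// /y enorm_orth//.
  by rewrite trmxK.
pose m i := Num.truncn (y ord0 i / s + N%:R).
have ypos i : 0 <= y ord0 i / s + N%:R.
  have /andP[/ltW H _] := yi i; rewrite -(pmulr_rge0 _ s0) mulrDr mulrCA divff ?gt_eqF// mulr1.
  by move: H; lra.
have mi i := truncn_itv (ypos i).
have mN i : (m i < N + N)%N.
  rewrite -(ltr_nat R); have /andP[H _] := mi i; apply: (le_lt_trans H).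
  have /andP[_ H2] := yi i; rewrite natrD ltrD2r ltr_pdivrMr//.
  by rewrite mulrC.
exists [ffun i => Ordinal (mN i)] => i /=; rewrite in_itv/= ffunE/= -/y.
have /andP[H1 H2] := mi i; have sy : y ord0 i = s * (y ord0 i / s) by rewrite mulrCA divff ?mulr1// gt_eqF.
rewrite sy ler_pM2l// ltr_pM2l//; apply/andP; split; first by move: H1; rewrite -/(m i); lra.
by move: H2; rewrite -/(m i) -natr1; lra.
Qed.

Lemma measurable_grid_cell k : measurable (grid_cell k).
Proof.
apply: (measurable_preimage (f := fun x : V => x *m O^T)
  (B := [set v : V | forall i, `[s * ((k i)%:R - N%:R), s * ((k i)%:R - N%:R + 1)[%classic (v ord0 i)])).
  exact: measurable_mulmx.
apply: (@measurable_rV_box R n (fun i => `[s * ((k i)%:R - N%:R), s * ((k i)%:R - N%:R + 1)[%classic)) => i.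
  exact: measurable_itv.
Qed.

Lemma lebesgue_grid_cell k : mu (grid_cell k) = (s ^+ n)%:E.
Proof.
have mB : measurable [set v : V | forall i, `[s * ((k i)%:R - N%:R), s * ((k i)%:R - N%:R + 1)[%classic (v ord0 i)].
  apply: (@measurable_rV_box R n (fun i => `[s * ((k i)%:R - N%:R), s * ((k i)%:R - N%:R + 1)[%classic)) => i.
  exact: measurable_itv.
rewrite (@lebesgue_rV_orth R n O^T _ _ mB); last by rewrite trmxK.
rewrite [LHS](@lebesgue_rV_box R n (fun i => `[s * ((k i)%:R - N%:R), s * ((k i)%:R - N%:R + 1)[%classic)); last first.
  by move=> i; exact: measurable_itv.
under eq_bigr => i _.
  rewrite lebesgue_measure_itv/= lte_fin ltr_pM2l// ltrDl ltr01.
  rewrite -EFinB -mulrBr (addrC _ 1) addrK mulr1; over.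
by rewrite prodEFin prodr_const card_ord.
Qed.

Lemma grid_cell_near k x w : grid_cell k x -> ocube (grid_center k) O (s / 2) w ->
  enorm (w - x) <= n%:R * s.
Proof.
move=> xk wk; rewrite -(enorm_orth _ (_ : O^T *m O^T^T = 1%:M)); last by rewrite trmxK.
rewrite (le_trans (enorm_le_norm _))// ler_wpM2l// -[leRHS](ger0_norm (ltW s0)).
rewrite ger0_norm ?(ltW s0)// rV_normP ?(ltW s0)//; apply/forallP => i.
have := wk i; rewrite grid_centerE => /andP[w1 w2]; have := xk i; rewrite /= in_itv/= => /andP[x1 x2].
rewrite mulmxBl [X in `|X|]mxE [in X in _ + X]mxE ler_norml.
by move: w1 w2 x1 x2; rewrite !mulrDr !mulrN mulr1 => *; apply/andP; split; lra.
Qed.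

(** A volume comparison. The cells that meet the box shrunk by [n s] on each side cover it, and
    their cubes stay within [n s] of it, hence inside the box; so the kept cubes have at least the
    volume of the shrunken box. *)
Lemma grid_in_box (p : V) (r : R) : 2 * n%:R * s < r ->
  (forall x, ocube p 1%:M (r / 2) x -> enorm x < s * N%:R) ->
  (r - 2 * n%:R * s) ^+ n <= \sum_(k | `[< ocube (grid_center k) O (s / 2) `<=` ocube p 1%:M (r / 2) >]) s ^+ n.
Proof.
move=> sr PN; pose P := ocube p 1%:M (r / 2).
have h0 : 0 < r / 2 - n%:R * s by move: sr; lra.
pose P' := ocube p 1%:M (r / 2 - n%:R * s).
have I1 : 1%:M *m (1%:M)^T = 1%:M :> 'M[R]_n by rewrite trmx1 mulmx1.
have PE (h : R) x : ocube p 1%:M h x <-> forall i, - h < (x - p) ord0 i < h.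
  by rewrite /ocube/= trmx1 mulmx1.
have keep k x : P' x -> grid_cell k x -> ocube (grid_center k) O (s / 2) `<=` P.
  move=> /PE Px kx w wk; apply/PE => i; have /andP[p1 p2] := Px i.
  have := grid_cell_near kx wk; have := coord_le_enorm (w - x) i.
  rewrite ler_norml => /andP[q1 q2] q3; move: p1 p2 q1 q2; rewrite !mxE => p1 p2 q1 q2.
  by apply/andP; split; lra.
have P'P x : P' x -> P x.
  move=> /PE H; apply/PE => i; have /andP[a b] := H i.
  have ns0 : 0 <= n%:R * s by rewrite mulr_ge0// ltW.
  by apply/andP; split; lra.
have sub : P' `<=` \big[setU/set0]_(k | `[< ocube (grid_center k) O (s / 2) `<=` P >]) grid_cell k.
  move=> x Px; have [k kx] := grid_cell_cover (PN x (P'P x Px)).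
  rewrite (bigD1 k)/=; [by left|].
  by apply/asboolP; exact: keep Px kx.
have mP' : measurable P' by exact: measurable_ocube.
have : (mu P' <= \sum_(k | `[< ocube (grid_center k) O (s / 2) `<=` P >]) mu (grid_cell k))%E.
  apply: (@le_trans _ _ (mu (\big[setU/set0]_(k | `[< ocube (grid_center k) O (s / 2) `<=` P >]) grid_cell k))).
    apply: le_measure; rewrite ?inE//.
    by apply: bigsetU_measurable => k _; exact: measurable_grid_cell.
  suff [] : measurable (\big[setU/set0]_(k | `[< ocube (grid_center k) O (s / 2) `<=` P >]) grid_cell k) /\
    (mu (\big[setU/set0]_(k | `[< ocube (grid_center k) O (s / 2) `<=` P >]) grid_cell k) <=
     \sum_(k | `[< ocube (grid_center k) O (s / 2) `<=` P >]) mu (grid_cell k))%E by [].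
  elim/big_rec2: _ => [|k A m _ [mA Am]]; first by rewrite measure0.
  have mk := measurable_grid_cell k; split; first exact: measurableU.
  by apply: (le_trans (@measureU2 _ _ _ mu _ _ mk mA)); exact: leeD2l.
under eq_bigr do rewrite lebesgue_grid_cell.
rewrite sumEFin /P' lebesgue_ocube// lee_fin.
by rewrite mulrBr mulrCA divff// mulr1 mulrA.
Qed.

End grid.

Section packing.
Context {R : realType} {n : nat}.
Local Notation mu := (lebesgue_rV R n).
Local Notation V := ('rV[R]_n).
Variables (N : nat) (N0 : (0 < N)%N) (rho : R) (rho0 : 0 < rho).
Local Notation J := {ffun 'I_n -> 'I_(N + N)}.

Definition box_side : R := rho / N%:R.
Definition box_center (j : J) : V := grid_center 1%:M box_side j.
Definition box (j : J) : set V := ocube (box_center j) 1%:M (box_side / 2).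

Let I1 : 1%:M *m (1%:M)^T = 1%:M :> 'M[R]_n. Proof. by rewrite trmx1 mulmx1. Qed.
Let NR : 0 < N%:R :> R. Proof. by rewrite ltr0n. Qed.
Let r0 : 0 < box_side. Proof. exact: divr_gt0. Qed.

Lemma box_disjoint j j' x : box j x -> box j' x -> j = j'.
Proof. exact: grid_cube_disjoint. Qed.

Lemma box_sub_cball j : box j `<=` cball n rho.
Proof.
move=> x jx; apply/cballE; first exact: ltW.
rewrite rV_normP ?(ltW rho0)//; apply/forallP => i.
have := jx i; rewrite grid_centerE// trmx1 mulmx1 => /andP[H1 H2].
have rE : box_side * N%:R = rho by rewrite /box_side divfK// gt_eqF.
have j0 : 0 <= box_side * (j i)%:R by rewrite mulr_ge0// ltW.
have jN : box_side * (j i)%:R + box_side <= box_side * N%:R + box_side * N%:R.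
  rewrite -mulrDr -[X in _ + X]mulr1 -mulrDr ler_pM2l// natr1 -natrD ler_nat.
  exact: ltn_ord.
by rewrite ler_norml -rE; apply/andP; split; move: H1 H2; lra.
Qed.

(** Each coarse box is filled by a fine grid in its own orientation; a box loses a margin [n s] on
    each side. Summed over the [(2N)^n] boxes of side [rho / N], the volume [(rho / N - 2 n s)^n]
    gives the stated power. *)
Lemma packing (s : R) (O : J -> 'M[R]_n) : 0 < s -> 2 * n%:R * s < box_side ->
  (forall j, O j *m (O j)^T = 1%:M) ->
  exists t : seq (J * V), [/\ uniq t,
    forall i, i \in t -> ocube i.2 (O i.1) (s / 2) `<=` box i.1,
    forall i i' x, i \in t -> i' \in t -> ocube i.2 (O i.1) (s / 2) x -> ocube i'.2 (O i'.1) (s / 2) x -> i = i' &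
    (2 * rho - 4 * n%:R * N%:R * s) ^+ n <= \sum_(i <- t) s ^+ n].
Proof.
move=> s0 sr OO.
(* So many cells per direction that each rotated grid covers the ball of radius [n rho], which
   contains all the boxes. *)
pose M := (Num.truncn ((n%:R * rho + 1) / s)).+1.
have sM : n%:R * rho < s * M%:R.
  have H : 0 <= (n%:R * rho + 1) / s by rewrite divr_ge0 ?(ltW s0)// addr_ge0// mulr_ge0// ltW.
  have /andP[_ H2] := truncn_itv H.
  by move: H2; rewrite -/M ltr_pdivrMr// => H2; rewrite [s * _]mulrC; apply: lt_trans H2; rewrite ltrDl.
pose K := {ffun 'I_n -> 'I_(M + M)}.
pose keep (j : J) (k : K) := `[< ocube (grid_center (O j) s k) (O j) (s / 2) `<=` box j >].
pose g (p : J * K) : J * V := (p.1, grid_center (O p.1) s p.2).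
pose t0 : seq (J * K) := [seq p <- enum [set: J * K]%SET | keep p.1 p.2].
have cin j (k : K) : ocube (grid_center (O j) s k) (O j) (s / 2) (grid_center (O j) s k).
  apply/(ocubeP _ _ _ (OO j)); exists 0; rewrite ?mul0mx ?addr0// => i; rewrite mxE.
  by apply/andP; split; lra.
have dis (p p' : J * K) x : p \in t0 -> p' \in t0 -> ocube (g p).2 (O (g p).1) (s / 2) x ->
    ocube (g p').2 (O (g p').1) (s / 2) x -> p = p'.
  case: p => j k; case: p' => j' k'; rewrite !mem_filter /= => /andP[/asboolP kj _] /andP[/asboolP kj' _] x1 x2.
  have jj : j = j' by exact: (box_disjoint (kj _ x1) (kj' _ x2)).
  subst j'; congr (_, _); exact: (grid_cube_disjoint (OO j) s0 x1 x2).
exists (map g t0); split.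
- rewrite map_inj_in_uniq; first by rewrite filter_uniq// enum_uniq.
  move=> p p' pt p't gp; apply: (dis p p' (g p).2 pt p't); first exact: cin.
  by rewrite gp; exact: cin.
- by move=> i /mapP[p]; rewrite mem_filter => /andP[/asboolP H _] ->.
- by move=> i i' x /mapP[p pt ->] /mapP[p' p't ->] x1 x2; congr g; exact: dis x1 x2.
rewrite big_map big_filter.
rewrite big_enum_cond/=.
rewrite (eq_bigl (fun p : J * K => true && keep p.1 p.2)); last by move=> p; rewrite inE.
rewrite -(pair_big_dep xpredT keep (fun _ _ => s ^+ n))/=.
apply: (@le_trans _ _ (\sum_(j : J) (box_side - 2 * n%:R * s) ^+ n)).
  have cJ : #|[pred _ : J | true]| = ((N + N) ^ n)%N by rewrite -[n in RHS]card_ord -[(N + N)%N in RHS]card_ord -card_ffun; apply: eq_card.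
  rewrite sumr_const cJ -[leRHS]mulr_natl natrX -exprMn.
  rewrite le_eqVlt; apply/orP; left; apply/eqP; congr (_ ^+ _).
  by rewrite natrD /box_side; field; rewrite gt_eqF.
apply: ler_sum => j _; apply: grid_in_box => //.
move=> x xj; apply: (le_lt_trans (enorm_le_norm _)); apply: le_lt_trans sM.
by rewrite ler_wpM2l//; apply/(cballE _ (ltW rho0)); exact: box_sub_cball xj.
Qed.

End packing.

(** * Integration by parts *)

Section test_fields.
Context {R : realType} {n : nat}.
Local Notation mu := (lebesgue_rV R n).
Local Notation V := ('rV[R]_n).
Implicit Types (phi : V -> V) (x k v : V).

Lemma derive_line phi x k (t : R) i : derivable phi (x + t *: k) k ->
  is_derive (t : R^o) (1 : R^o) (fun t : R => phi (x + t *: k) ord0 i : R^o)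
    (('D_k phi (x + t *: k)) ord0 i).
Proof.
move=> dphi; have /derivable_mxP/(_ ord0 i) di := dphi; rewrite (derive_mx dphi).
have -> : (\matrix_(i0, j) 'D_k (fun y => phi y i0 j) (x + t *: k)) ord0 i = 'D_k (fun y => phi y ord0 i) (x + t *: k) by rewrite mxE.
have E : (fun h : R => h^-1 *: (((fun t : R => phi (x + t *: k) ord0 i : R^o) \o shift (t : R^o)) (h *: (1 : R^o)) -
      phi (x + t *: k) ord0 i) : R^o) =
    (fun h : R => h^-1 *: (((fun y => phi y ord0 i : R^o) \o shift (x + t *: k)) (h *: k) - phi (x + t *: k) ord0 i) : R^o).
  apply/funext => h /=; congr (_ *: (phi _ _ _ - _)).
  have -> : (h *: (1 : R^o) : R^o) = h by rewrite /GRing.scale/= mulr1.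
  by rewrite scalerDl addrCA.
by apply: DeriveDef; rewrite /derivable /derive E.
Qed.

Lemma derive_outside phi r x v : 0 <= r -> (forall x, ~ cball n r x -> phi x = 0) ->
  ~ cball n r x -> 'D_v phi x = 0.
Proof.
move=> r0 phi0 xr; rewrite (@near_eq_derive _ _ _ phi (cst 0)); first exact: derive_cst.
have oC : open (~` (cball n r : set V)) by apply: closed_openC; exact: closed_cball.
have : nbhs x (~` (cball n r : set V)) by exact: open_nbhs_nbhs.
by apply: filterS => y; exact: phi0.
Qed.

Lemma C1c_derive_bounded phi v : C1c phi -> exists2 C, 0 <= C & forall x, `|'D_v phi x| <= C.
Proof.
move=> hphi; have [r r0 phi0] := C1c_support hphi; have [_ cphi _] := hphi.
have [M [_ HM]] := compact_bounded (continuous_compact (continuous_subspaceT (cphi v)) (compact_cball (ltW r0))).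
exists (`|M| + 1); first by rewrite addr_ge0.
move=> x; have [xr|xr] := pselect (cball n r x).
  apply: (HM (`|M| + 1)); last by exists x.
  by rewrite (le_lt_trans (ler_norm _))// ltrDl.
by rewrite (derive_outside _ (ltW r0) phi0)// normr0 addr_ge0.
Qed.

(** The mean value theorem along the segment, with partial derivatives that are bounded since they
    are continuous and vanish off a compact set. *)
Lemma C1c_lipschitz phi : C1c phi -> exists2 L, 0 <= L &
  forall x k i, `|phi (x + k) ord0 i - phi x ord0 i| <= L * `|k|.
Proof.
move=> hphi; have [dphi _ _] := hphi.
have W j : exists c, 0 <= c /\ forall x, `|'D_(delta_mx ord0 j) phi x| <= c.
  by have [c c0 cP] := C1c_derive_bounded (delta_mx ord0 j) hphi; exists c.
have [C CP] := choice W.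
exists (\sum_j C j); first by apply: sumr_ge0 => j _; exact: (CP j).1.
move=> x k i.
have Dk y : `|'D_k phi y ord0 i| <= (\sum_j C j) * `|k|.
  have -> : 'D_k phi y = \sum_j k ord0 j *: 'D_(delta_mx ord0 j) phi y.
    rewrite deriveE// {1}(row_sum_delta k) linear_sum; apply: eq_bigr => j _.
    by rewrite linearZ deriveE.
  rewrite summxE (le_trans (ler_norm_sum _ _ _))// mulr_suml; apply: ler_sum => j _.
  rewrite [X in `|X|]mxE normrM mulrC ler_pM//.
    by rewrite (le_trans (rV_norm_coord _ _))//; exact: (CP j).2.
  exact: rV_norm_coord.
pose g (t : R) : R := phi (x + t *: k) ord0 i.
have dg (t : R) : is_derive (t : R^o) (1 : R^o) (g : R -> R^o) ('D_k phi (x + t *: k) ord0 i).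
  by apply: derive_line; exact: C1c_derivable.
have cg : {within `[0, 1], continuous g}.
  apply: continuous_subspaceT => t; apply: differentiable_continuous.
  by apply/derivable1_diffP; have [] := dg t.
have [t _] := @MVT R g (fun t => 'D_k phi (x + t *: k) ord0 i) 0 1 ltr01 (fun t _ => dg t) cg.
by rewrite /g scale1r scale0r addr0 subr0 mulr1 => ->; exact: Dk.
Qed.

Lemma C1c_continuous phi : C1c phi -> continuous phi.
Proof. by move=> [dphi _ _] x; exact: differentiable_continuous. Qed.

End test_fields.

Section integration_by_parts.
Context {R : realType} {n : nat}.
Local Notation mu := (lebesgue_rV R n).
Local Notation V := ('rV[R]_n).
Implicit Types (G u : V -> R) (r : R).

Lemma integrable_supported G u r C : L1loc G -> 0 <= r -> measurable_fun setT u ->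
  (forall x, `|u x| <= C) -> (forall x, ~ cball n r x -> u x = 0) ->
  mu.-integrable setT (EFin \o (fun x => G x * u x)).
Proof.
move=> hG r0 mu' uC u0; have mb : measurable (cball n r : set V) by exact: measurable_cball.
have -> : (fun x => G x * u x) = (fun x => G x * u x) \_ (cball n r).
  apply/funext => x; rewrite patchE; case: ifPn => // /negP xr.
  by rewrite u0 ?mulr0// => xx; apply: xr; rewrite inE.
rewrite -restrict_EFin -integrable_mkcond//.
by apply: (integrableM_bounded mb (L1loc_integrable hG r0) (measurable_funTS mu')) => x _; exact: uC.
Qed.

Lemma Rintegral_shift G (y : V) : measurable_fun setT G -> \int[mu]_x G (x + y) = \int[mu]_x G x.
Proof.
move=> mG; have mshift (A : set V) : measurable A -> mu ((fun x => x + y) @^-1` A) = mu A.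
  by move=> mA; rewrite -(lebesgue_rV_shift y mA).
have := Rintegral_preserving (measurable_addrV y) mshift measurableT mG.
by rewrite preimage_setT.
Qed.

Lemma Rintegral_dominated_cvg (f_ : nat -> V -> R) (f g : V -> R) :
  (forall k, measurable_fun setT (f_ k)) -> (forall x, f_ k x @[k --> \oo] --> f x) ->
  mu.-integrable setT (EFin \o g) -> (forall k x, `|f_ k x| <= g x) ->
  \int[mu]_x f_ k x @[k --> \oo] --> \int[mu]_x f x.
Proof.
move=> mf cf ig fg.
have H := @dominated_cvg _ V R mu setT measurableT (fun k => EFin \o f_ k) (EFin \o f) (EFin \o g).
apply: fine_cvg.
have fi : mu.-integrable setT (EFin \o f).
  apply: (le_integrable measurableT _ _ ig).
    apply/measurable_EFinP; exact: (measurable_fun_cvg mf (fun x _ => cf x)).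
  move=> x _ /=; rewrite lee_fin (le_trans _ (ler_norm _))//.
  apply/ler_addgt0Pr => e e0.
  have /cvgrPdist_le/(_ e e0)[k _ /(_ k (leqnn k)) Hk] := cf x.
  rewrite -(subrK (f_ k x) (f x)) addrC (le_trans (ler_normD _ _))// lerD//.
rewrite fineK; last by exact: integrable_fin_num.
apply: H => //.
- by move=> k; apply/measurable_EFinP.
- by move=> x _; apply: cvg_EFin; [near=> k|exact: cf].
- by move=> k x _; rewrite /= lee_fin.
Unshelve. all: by end_near.
Qed.

Lemma L1loc_continuous G : continuous G -> L1loc G.
Proof.
move=> cG; have mG := continuous_measurable_rV cG; apply: L1loc_cball => // r r0.
have [M [_ HM]] := compact_bounded (continuous_compact (continuous_subspaceT cG) (compact_cball (ltW r0))).
apply: (bounded_integrable (C := `|M| + 1)).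
- exact: measurable_cball.
- exact/lebesgue_cball_lty/ltW.
- exact: measurable_funTS.
- move=> x xr; apply: (HM (`|M| + 1)); last by exists x.
  by rewrite (le_lt_trans (ler_norm _))// ltrDl.
Qed.

Variables (d : R) (d0 : 0 < d).

Lemma continuous_dot_gconv (f : V -> R) a : L1loc f -> continuous (fun x => dot (gconv d f x) a).
Proof.
move=> hf x; pose r := `|x| + 1; have r0 : 0 <= r by rewrite addr_ge0.
have xr : cball n r x by apply/cballE => //; rewrite lerDl.
pose J := \int[mu]_(y in cball n (r + d)) `|f y|.
apply: (@local_lipschitz_continuous _ _ _ _ _ 1 (6 * @moll_C2 R n d * n%:R * enorm a * J)) => // y xy.
have yr : cball n r y.
  by apply/cballE => //; rewrite -(subrK x y) addrC (le_trans (ler_normD _ _))// lerD2l distrC.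
apply: (le_trans (dot_gconv_lipschitz d0 a hf r0 xr yr)); rewrite -/J.
have C0 := @moll_C2_ge0 R n d d0; have J0 : 0 <= J by exact: Rintegral_ge0.
apply: (@le_trans _ _ (6 * @moll_C2 R n d * (n%:R * `|x - y|) * enorm a * J)); last first.
  by apply: eq_ler; move: `|x - y| (enorm a) (@moll_C2 R n d) => A B C; ring.
apply: ler_wpM2r => //; apply: ler_wpM2r; first exact: enorm_ge0.
apply: ler_wpM2l; [exact: mulr_ge0|exact: enorm_le_norm].
Qed.

(** Integration by parts for difference quotients is translation invariance. The step [1/(k+1)] then
    tends to 0 on both sides: by dominated convergence where the quotient falls on [u], and by the
    uniform quadratic remainder where it falls on the mollification. *)
Lemma conv_ibp_coord (f u : V -> R) (Du : V -> R) (L r : R) i : L1loc f -> 0 <= r -> 0 <= L ->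
  measurable_fun setT u ->
  (forall x, ~ cball n r x -> u x = 0) ->
  (forall x k, `|u (x + k) - u x| <= L * `|k|) ->
  (forall x, h^-1 * (u (x + h *: delta_mx ord0 i) - u x) @[h --> 0^'] --> Du x) ->
  \int[mu]_x (conv d f x * Du x) = - \int[mu]_x (gconv d f x ord0 i * u x).
Proof.
move=> hf r0 L0 mu' u0 uL uD; pose e : V := delta_mx ord0 i; pose G := conv d f.
have e1 : `|e| <= 1.
  rewrite rV_normP//; apply/forallP => j; rewrite mxE eqxx/=.
  by case: eqP; rewrite ?normr1// normr0.
have hG := L1loc_conv d0 hf.
have mG : measurable_fun setT G := hG.1.
have r10 : 0 <= r + 1 by rewrite addr_ge0.
have [C uC] : exists C : R, forall x, `|u x| <= C.
  (* A move of [2 r + 1] along [e] leaves the support from any of its points, so the Lipschitz bound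
     over that distance bounds [u]. *)
  exists (L * (r + r + 1)) => x.
  have [xr|xr] := pselect (cball n r x); last first.
    by rewrite u0// normr0 mulr_ge0// addr_ge0// addr_ge0.
  have out : ~ cball n r (x + (r + r + 1) *: e).
    move=> /(_ i); rewrite /= in_itv/= !mxE !eqxx mulr1 => /andP[_ xe].
    by have := xr i; rewrite /= in_itv/= => /andP[xe2 _]; move: xe xe2; lra.
  have := uL x ((r + r + 1) *: e); rewrite u0// sub0r normrN => H; apply: (le_trans H).
  by rewrite ler_wpM2l// normrZ ger0_norm ?ler_piMr// addr_ge0// addr_ge0.
pose t k : R := k.+1%:R^-1.
have t0 k : 0 < t k by rewrite invr_gt0.
have t1 k : t k <= 1 by rewrite invf_le1// ler1n.
pose q k x := (t k)^-1 * (u (x + t k *: e) - u x).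
have mush y : measurable_fun setT (fun x : V => u (x + y)).
  by apply: (measurableT_comp mu'); exact: measurable_addrV.
have mq k : measurable_fun setT (q k).
  by apply: measurable_funM => //; apply: measurable_funB.
have tke k : `|t k *: e| <= t k.
  by rewrite normrZ gtr0_norm// ler_piMr// ltW.
have qL k x : `|q k x| <= L.
  rewrite normrM gtr0_norm ?invr_gt0// ler_pdivrMl// mulrC.
  by rewrite (le_trans (uL _ _))// ler_wpM2l.
have ush0 k x : ~ cball n (r + 1) x -> u (x + t k *: e) = 0.
  move=> xr; apply: u0 => xk; apply: xr; apply/cballE => //.
  rewrite -(addrK (t k *: e) x) (le_trans (ler_normB _ _))// lerD//; first exact/cballE.
  exact: le_trans (t1 k).
have u01 x : ~ cball n (r + 1) x -> u x = 0.
  by move=> xr; apply: u0 => xx; apply: xr; apply: sub_cball xx => //; rewrite lerDl.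
have q0 k x : ~ cball n (r + 1) x -> q k x = 0.
  by move=> xr; rewrite /q ush0// u01// subrr mulr0.
have tcv : t k @[k --> \oo] --> (0 : R)^'.
  move=> A [eps /= eps0 HA]; suff : \forall k \near \oo, A (t k) by [].
  have [m _ Hm] := (cvgrPdist_lt _ _).1 (@cvg_harmonic R) eps eps0; exists m => // k /= /Hm Hk.
  by apply: HA => //; exact: lt0r_neq0 (t0 k).
have qD x : q k x @[k --> \oo] --> Du x.
  exact: (cvg_comp _ _ tcv (uD x)).
have iGL : mu.-integrable setT (EFin \o (fun x => `|G x| * (L * \1_(cball n (r + 1)) x))).
  apply: (integrable_supported (r := r + 1) (C := L)) => //.
  - exact: L1loc_norm.
  - by apply: measurable_funM => //; apply: measurable_indic; exact: measurable_cball.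
  - move=> x; rewrite normrM (ger0_norm L0) ler_piMr// indicE ger0_norm ?ler0n//.
    by case: (x \in _).
  - by move=> x xr; rewrite indicE memNset// mulr0.
have lim1 : \int[mu]_x (G x * q k x) @[k --> \oo] --> \int[mu]_x (G x * Du x).
  apply: (Rintegral_dominated_cvg (g := fun x => `|G x| * (L * \1_(cball n (r + 1)) x))) => //.
  - by move=> k; apply: measurable_funM.
  - by move=> x; apply: cvgMr; exact: qD.
  - move=> k x; rewrite normrM ler_wpM2l// indicE; case: (boolP (x \in _)) => xr.
      by rewrite mulr1.
    by rewrite q0 ?normr0 ?mulr0// => xx; move/negP: xr; apply; rewrite inE.
have iGu : mu.-integrable setT (EFin \o (fun x => G x * u x)).
  exact: (integrable_supported hG r0 mu' uC u0).
have iGush k : mu.-integrable setT (EFin \o (fun x => G x * u (x + t k *: e))).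
  by apply: (integrable_supported (r := r + 1) (C := C)) => //; exact: ush0.
have hGsh k : L1loc (fun x => G (x - t k *: e)).
  apply: L1loc_continuous => x; apply: (@continuous_comp _ _ _ (fun x : V => x - t k *: e) G).
    by apply: (@lipschitz_continuous _ V V _ 1) => y z; rewrite mul1r opprB addrA subrK.
  exact: continuous_conv.
have iGshu k : mu.-integrable setT (EFin \o (fun x => G (x - t k *: e) * u x)).
  exact: (integrable_supported (hGsh k) r0 mu' uC u0).
(* The substitution of [x - t k *: e] for [x] moves the quotient from [u] to [G]. *)
have E k : \int[mu]_x (G x * q k x) = \int[mu]_x ((t k)^-1 * (G (x - t k *: e) - G x) * u x).
  have -> : \int[mu]_x (G x * q k x) = (t k)^-1 * (\int[mu]_x (G x * u (x + t k *: e)) - \int[mu]_x (G x * u x)).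
    rewrite -RintegralB// -RintegralZl//; last exact: integrableBR.
    by apply: eq_Rintegral => x _; rewrite /q; ring.
  have -> : \int[mu]_x ((t k)^-1 * (G (x - t k *: e) - G x) * u x) =
      (t k)^-1 * (\int[mu]_x (G (x - t k *: e) * u x) - \int[mu]_x (G x * u x)).
    rewrite -RintegralB// -RintegralZl//; last exact: integrableBR.
    by apply: eq_Rintegral => x _; ring.
  congr (_ * (_ - _)); rewrite -[RHS](@Rintegral_shift _ (t k *: e)).
    by apply: eq_Rintegral => x _; rewrite addrK.
  by apply: measurable_funM => //; exact: (hGsh k).1.
pose N1 := \int[mu]_(y in cball n (r + 1 + d)) `|f y|.
have gE x : gconv d f x ord0 i = dot (gconv d f x) e by rewrite dot_delta.
(* The opposite step turns the quotient of [G] into minus the gradient component, with an error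
   linear in the step and uniform on the support of [u]. *)
have near_gconv k x : cball n r x ->
    `|(t k)^-1 * (G (x - t k *: e) - G x) + gconv d f x ord0 i| <= t k * (@moll_C2 R n d * N1).
  move=> xr; have xr1 : cball n (r + 1) x by apply: sub_cball xr => //; rewrite lerDl.
  have xr2 : cball n (r + 1) (x + - (t k *: e)).
    apply/cballE => //; rewrite (le_trans (ler_normB _ _))// lerD//; first exact/cballE.
    exact: le_trans (t1 k).
  have := conv_quadratic d0 hf r10 xr1 xr2; rewrite -/N1 -/G dotNr dotC dotZl dotC -gE opprK.
  rewrite dotNl dotNr opprK dotZl dotC dotZl dot_delta /e [delta_mx _ _ _ _]mxE !eqxx mulr1 -/e => H.
  rewrite (_ : _ + _ = (t k)^-1 * (G (x - t k *: e) - G x + t k * gconv d f x ord0 i)); last first.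
    by rewrite [RHS]mulrDr mulKf// gt_eqF.
  rewrite normrM gtr0_norm ?invr_gt0// ler_pdivrMl//; apply: (le_trans H).
  by rewrite le_eqVlt; apply/orP; left; apply/eqP; ring.
have hg : L1loc (fun x => gconv d f x ord0 i).
  by under eq_fun do rewrite gE; apply: L1loc_continuous; exact: continuous_dot_gconv.
have igu := integrable_supported hg r0 mu' uC u0.
have C20 := @moll_C2_ge0 R n d d0; have N10 : 0 <= N1 by exact: Rintegral_ge0.
have iu : mu.-integrable setT (EFin \o (fun x => `|u x|)).
  have h1 : L1loc (fun _ : V => 1 : R) by apply: L1loc_continuous; exact: cst_continuous.
  have := integrable_supported h1 r0 mu' uC u0 => /integrable_abse; apply: eq_integrable => // x _ /=.
  by rewrite mul1r.
pose U := \int[mu]_x `|u x|; have U0 : 0 <= U by exact: Rintegral_ge0.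
have idq k : mu.-integrable setT (EFin \o (fun x => (t k)^-1 * (G (x - t k *: e) - G x) * u x)).
  have := integrableZlR (t k)^-1 measurableT (integrableBR measurableT (iGshu k) iGu).
  by apply: eq_integrable => // x _ /=; congr EFin; ring.
have lim2 : \int[mu]_x (G x * q k x) @[k --> \oo] --> - \int[mu]_x (gconv d f x ord0 i * u x).
  apply/cvgrPdist_le => eps eps0; near=> k.
  rewrite E -normrN opprB opprK -RintegralD//.
  have ik := integrableDR measurableT (idq k) igu.
  apply: (le_trans (le_normr_Rintegral measurableT ik)).
  apply: (@le_trans _ _ (\int[mu]_x (t k * (@moll_C2 R n d * N1) * `|u x|))).
    apply: le_Rintegral => //.
    - by have := integrable_abse ik; apply: eq_integrable.
    - exact: integrableZlR.
    - move=> x _; have [xr|xr] := pselect (cball n r x).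
        by rewrite -mulrDl normrM ler_wpM2r//; exact: near_gconv.
      by rewrite u0// !mulr0 addr0 normr0 mulr0.
  rewrite RintegralZl// -/U -mulrA.
  near: k; have [K0|K0] := eqVneq (@moll_C2 R n d * N1 * U) 0.
    by near=> k; rewrite K0 mulr0 ltW.
  have Kp : 0 < @moll_C2 R n d * N1 * U by rewrite lt_def K0 mulr_ge0// mulr_ge0.
  near=> k; rewrite -ler_pdivlMr//.
  have : `|0 - harmonic k| <= eps / (@moll_C2 R n d * N1 * U).
    by near: k; apply: cvgr_dist_le; [exact: cvg_harmonic|exact: divr_gt0].
  by rewrite sub0r normrN ger0_norm// ltW.
exact: (cvg_unique _ lim1 lim2).
Unshelve. all: by end_near.
Qed.

Lemma conv_ibp (f : V -> R) (phi : V -> V) : L1loc f -> C1c phi ->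
  \int[mu]_x (conv d f x * divergence phi x) = - \int[mu]_x dot (gconv d f x) (phi x).
Proof.
move=> hf hphi; have [r r0 phi0] := C1c_support hphi.
have [L L0 HL] := C1c_lipschitz hphi; have hG := L1loc_conv d0 hf.
have cphi := C1c_continuous hphi; have [dphi cD _] := hphi.
have mphi i : measurable_fun setT (fun x => phi x ord0 i).
  by apply: continuous_measurable_rV; exact: continuous_coordV.
have ccD i : continuous (fun x => 'D_(delta_mx ord0 i) phi x ord0 i) by apply: continuous_coordV; exact: cD.
have bphi i : exists C, forall x, `|phi x ord0 i| <= C.
  have [M [_ HM]] := compact_bounded (continuous_compact (continuous_subspaceT cphi) (compact_cball (ltW r0))).
  exists (`|M| + 1) => x; have [xr|xr] := pselect (cball n r x); last by rewrite phi0// mxE normr0 addr_ge0.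
  rewrite (le_trans (rV_norm_coord _ _))//; apply: (HM (`|M| + 1)); last by exists x.
  by rewrite (le_lt_trans (ler_norm _))// ltrDl.
have i1 i : mu.-integrable setT (EFin \o (fun x => conv d f x * 'D_(delta_mx ord0 i) phi x ord0 i)).
  have [C C0 HC] := C1c_derive_bounded (delta_mx ord0 i) hphi.
  apply: (integrable_supported (r := r) (C := C) hG (ltW r0)).
  - exact: continuous_measurable_rV.
  - by move=> x; rewrite (le_trans (rV_norm_coord _ _)).
  - by move=> x xr; rewrite (derive_outside _ (ltW r0) phi0)// mxE.
have i2 i : mu.-integrable setT (EFin \o (fun x => gconv d f x ord0 i * phi x ord0 i)).
  have [C HC] := bphi i.
  apply: (integrable_supported (r := r) (C := C) _ (ltW r0)) => //.
  - apply: L1loc_continuous; under eq_fun do rewrite -dot_delta.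
    exact: continuous_dot_gconv.
  - by move=> x xr; rewrite phi0// mxE.
transitivity (\sum_i \int[mu]_x (conv d f x * 'D_(delta_mx ord0 i) phi x ord0 i)).
  by rewrite -Rintegral_sum//; apply: eq_Rintegral => x _; rewrite /divergence mulr_sumr.
transitivity (\sum_i - \int[mu]_x (gconv d f x ord0 i * phi x ord0 i)).
  apply: eq_bigr => i _; apply: (conv_ibp_coord (u := fun x => phi x ord0 i)
      (Du := fun x => 'D_(delta_mx ord0 i) phi x ord0 i) hf (ltW r0) L0) => //.
  - by move=> x xr; rewrite phi0// mxE.
  - move=> x; have dx := @C1c_derivable R n phi x (delta_mx ord0 i) hphi.
    have /derivable_mxP/(_ ord0 i) di := dx; rewrite (derive_mx dx).
    have -> : (\matrix_(i0, j) 'D_(delta_mx ord0 i) (fun y => phi y i0 j) x) ord0 i = 'D_(delta_mx ord0 i) (fun y => phi y ord0 i) x by rewrite mxE.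
    move: di; rewrite /derivable /derive => di.
    rewrite (_ : (fun h : R => _) = (fun h : R => h^-1 *: (((fun y => phi y ord0 i : R^o) \o shift x) (h *: delta_mx ord0 i) - phi x ord0 i) : R^o)) //.
    apply/funext => h /=; congr (_ * (phi _ _ _ - _)); exact: addrC.
by rewrite sumrN -Rintegral_sum.
Qed.

End integration_by_parts.

(** * The Gamma-limit *)

Section lower_bound.
Context {R : realType} {n : nat}.
Local Notation mu := (lebesgue_rV R n.+1).
Local Notation V := ('rV[R]_n.+1).
Local Notation m := (n.+1%:R : R).

(** All errors are explicit: the volume the cubes leave uncovered, the variation of the gradient
    over a cube, the variation of [phi] over a box, the replacement of [F] by [f] in the gradient,
    and the quadratic remainder. Only the one due to [phi] depends on the boxes alone and not on
    [eps] or on [F - f]. *)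
Lemma Kfun_lower (f F : V -> R) (phi : V -> V) (d rho L C eps : R) (N : nat) :
  0 < d -> L1loc f -> L1loc F -> C1c phi -> (forall x, enorm (phi x) <= 1) ->
  0 < rho -> (forall x, ~ cball n.+1 rho x -> phi x = 0) ->
  0 <= L -> (forall x k i, `|phi (x + k) ord0 i - phi x ord0 i| <= L * `|k|) ->
  (0 < N)%N -> 0 < eps -> 2 * m * eps < rho / N%:R -> (Kfun eps F <= C%:E)%E ->
  let Af := \int[mu]_(y in cball n.+1 (rho + d)) `|f y| in
  let Df := \int[mu]_(y in cball n.+1 (rho + d)) `|F y - f y| in
  let lip := @moll_lip R n.+1 d in let C2 := @moll_C2 R n.+1 d in
  \int[mu]_x (conv d f x * divergence phi x) <=
  4 * C + lip * Af * ((2 * rho) ^+ n.+1 - (2 * rho - 4 * m * N%:R * eps) ^+ n.+1) +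
  (2 * rho) ^+ n.+1 * (6 * C2 * (m * (eps / 2)) * Af + lip * (m * (L * (rho / N%:R / 2))) * Af + lip * Df +
     C2 * m ^+ 2 * eps * (Af + Df)).
Proof.
move=> d0 hf hF hphi phi1 rho0 phi0 L0 HL N0 e0 eN KC; cbv zeta.
set Af := \int[mu]_(y in cball n.+1 (rho + d)) `|f y|.
set Df := \int[mu]_(y in cball n.+1 (rho + d)) `|F y - f y|.
set lip := moll_lip d; set C2 := moll_C2 d.
have h0 : 0 < eps / 2 by rewrite divr_gt0.
have e2 : 2 * (eps / 2) = eps by rewrite mulrC divfK.
have rd0 : 0 <= rho + d by rewrite addr_ge0// ltW.
have lip0 : 0 <= lip by exact: moll_lip_ge0.
have C20 : 0 <= C2 by exact: moll_C2_ge0.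
have Af0 : 0 <= Af by exact: Rintegral_ge0.
have Df0 : 0 <= Df by exact: Rintegral_ge0.
pose p j := @box_center R n.+1 N rho j.
(* The minus sign is that of the integration by parts. *)
pose a j : V := - phi (p j).
have a1 j : enorm (a j) <= 1 by rewrite enormN.
have [ O OP] := choice (fun j => frame_along (a j)).
have OO j := (OP j).1.
have [t [ut tbox tdis tsum]] := packing N0 rho0 e0 eN OO.
pose z (i : {ffun 'I_n.+1 -> 'I_(N + N)} * V) := i.2.
pose Q i := ocube (z i) (O i.1) (eps / 2).
pose S : R := \sum_(i <- t) eps ^+ n.+1.
have mQ i : measurable (Q i) by exact: measurable_ocube.
have qE i : fine (mu (Q i)) = eps ^+ n.+1 by rewrite lebesgue_ocube//= e2.
have Qoo i : (mu (Q i) < +oo)%E by rewrite lebesgue_ocube// ltry.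
have Qrho i : i \in t -> Q i `<=` cball n.+1 rho.
  by move=> it; apply: subset_trans (tbox _ it) _; exact: box_sub_cball.
have zQ i : Q i (z i).
  by apply/(ocubeP _ _ _ (OO i.1)); exists 0; rewrite ?mul0mx ?addr0// => j; rewrite mxE; apply/andP; split; lra.
have mD : measurable (cball n.+1 rho : set V) by exact: measurable_cball.
have Doo : (mu (cball n.+1 rho) < +oo)%E by exact/lebesgue_cball_lty/ltW.
have DE : fine (mu (cball n.+1 rho)) = (2 * rho) ^+ n.+1 by rewrite lebesgue_cball// ltW.
have S0 : 0 <= S by apply: sumr_ge0 => i _; rewrite exprn_ge0// ltW.
have i1 (A : set V) c : measurable A -> (mu A < +oo)%E -> mu.-integrable A (EFin \o (fun=> c : R)).
  by move=> mA Aoo; apply: (bounded_integrable (C := `|c|)).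
have SD : S <= (2 * rho) ^+ n.+1.
  have := @sum_Rintegral_disjoint_le _ _ _ mu _ t Q (cball n.+1 rho) (fun=> 1) ut mD (fun i _ => mQ i) Qrho tdis (fun _ _ => ler01) (i1 _ _ mD Doo).
  rewrite Rintegral_cst// mul1r DE; under eq_bigr do rewrite Rintegral_cst// mul1r qE.
  by [].
pose u w := - dot (gconv d f w) (phi w).
pose B := lip * Af.
have B0 : 0 <= B by exact: mulr_ge0.
have uB w : cball n.+1 rho w -> `|u w| <= B.
  move=> wr; rewrite normrN; apply: (le_trans (dot_gconv_le d0 _ hf (ltW rho0) wr)).
  by rewrite -/Af -/lip /B ler_wpM2r// ler_piMr.
pose v w := dot (gconv d f w) (phi w).
have mv : measurable_fun setT v.
  apply: measurable_sum => i; apply: measurable_funM.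
    apply: continuous_measurable_rV; under eq_fun do rewrite -dot_delta.
    exact: continuous_dot_gconv.
  by apply: continuous_measurable_rV; apply: continuous_coordV; exact: C1c_continuous.
have uv w : u w = -1 * v w by rewrite mulN1r.
have mu_u : measurable_fun setT u.
  by rewrite (funext uv); apply: measurable_funM => //; exact: measurable_cst.
have iuD : mu.-integrable (cball n.+1 rho) (EFin \o u).
  by apply: (bounded_integrable (C := B)) => //; exact: measurable_funTS.
have iuQ i : i \in t -> mu.-integrable (Q i) (EFin \o u).
  by move=> it; apply: (integrableS mD (mQ i) (Qrho _ it)).
have ibp : \int[mu]_x (conv d f x * divergence phi x) = \int[mu]_(w in cball n.+1 rho) u w.
  have ivD : mu.-integrable (cball n.+1 rho) (EFin \o v).
    apply: (bounded_integrable (C := B)) => //; first exact: measurable_funTS.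
    by move=> w wr; rewrite -normrN -mulN1r -uv uB.
  rewrite (conv_ibp d0 hf hphi) -mulN1r -/v; under [RHS]eq_Rintegral do rewrite uv.
  rewrite (RintegralZl _ mD ivD); congr (_ * _); rewrite [RHS]Rintegral_mkcond.
  apply: eq_Rintegral => w _; rewrite patchE; case: ifPn => // /negP wr.
  by rewrite phi0 ?dot0r// => wr'; apply: wr; rewrite inE.
(* [B - u] is nonnegative, so its integral over the cubes is at most that over the whole support; in
   terms of [u], the missing part costs [B] per unit of uncovered volume. *)
have disc : \int[mu]_(w in cball n.+1 rho) u w <= \sum_(i <- t) \int[mu]_(w in Q i) u w + B * ((2 * rho) ^+ n.+1 - S).
  have G0 w : cball n.+1 rho w -> 0 <= B - u w.
    by move=> wr; rewrite subr_ge0 (le_trans (ler_norm _))// uB.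
  have iG : mu.-integrable (cball n.+1 rho) (EFin \o (fun w => B - u w)).
    by apply: integrableBR => //; exact: i1.
  have := @sum_Rintegral_disjoint_le _ _ _ mu _ t Q (cball n.+1 rho) (fun w => B - u w) ut mD (fun i _ => mQ i) Qrho tdis G0 iG.
  rewrite RintegralB//; last exact: i1.
  rewrite Rintegral_cst// DE big_seq.
  rewrite (eq_bigr (fun i => B * eps ^+ n.+1 - \int[mu]_(w in Q i) u w)); last first.
    by move=> i it; rewrite RintegralB ?Rintegral_cst ?qE//; [exact: i1|exact: iuQ].
  rewrite -big_seq sumrB -mulr_sumr -/S.
  by move: (Rintegral _ _ _) (\sum_(i <- t) _) => X Y; lra.
pose err1 := 6 * C2 * (m * (eps / 2)) * Af + lip * (m * (L * (rho / N%:R / 2))) * Af.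
have cube1 i : i \in t -> \int[mu]_(w in Q i) u w <= eps ^+ n.+1 * (dot (gconv d f (z i)) (a i.1) + err1).
  move=> it; rewrite -(qE i) mulrC -Rintegral_cst//.
  apply: le_Rintegral => //; [exact: iuQ|exact: i1|move=> w Qw].
  have wr := Qrho _ it _ Qw; have zr := Qrho _ it _ (zQ i).
  have dist : enorm (w - z i) <= m * (eps / 2) by apply: ocube_dist Qw => //; exact: ltW.
  have H1 : dot (gconv d f w) (a i.1) - dot (gconv d f (z i)) (a i.1) <= 6 * C2 * (m * (eps / 2)) * Af.
    apply: (le_trans (ler_norm _)); apply: (le_trans (dot_gconv_lipschitz d0 _ hf (ltW rho0) wr zr)).
    rewrite -/Af -/C2; apply: ler_wpM2r => //.
    apply: (@le_trans _ _ (6 * C2 * enorm (w - z i))).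
      by rewrite ler_piMr// mulr_ge0 ?enorm_ge0// mulr_ge0.
    by rewrite ler_wpM2l// mulr_ge0.
  have H2 : dot (gconv d f w) (- phi w - a i.1) <= lip * (m * (L * (rho / N%:R / 2))) * Af.
    apply: (le_trans (ler_norm _)); apply: (le_trans (dot_gconv_le d0 _ hf (ltW rho0) wr)).
    rewrite -/Af -/lip; apply: ler_wpM2r => //; apply: ler_wpM2l => //.
    apply: (le_trans (enorm_le_norm _)); rewrite ler_wpM2l//.
    have r20 : 0 <= rho / N%:R / 2 by rewrite divr_ge0// divr_ge0// ltW.
    have wp : `|w - p i.1| <= rho / N%:R / 2.
      have := tbox _ it _ Qw; rewrite /box /ocube/= trmx1 mulmx1 => wb.
      exact: ucube_norm wb.
    have Lr0 : 0 <= L * (rho / N%:R / 2) by exact: mulr_ge0.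
    rewrite (rV_normP _ Lr0); apply/forallP => j.
    have -> : (- phi w - a i.1) ord0 j = - (phi w ord0 j - phi (p i.1) ord0 j).
      by rewrite /a !mxE opprK opprB addrC.
    rewrite normrN; have := HL (p i.1) (w - p i.1) j; rewrite (addrC (p i.1)) subrK => H.
    by apply: (le_trans H); rewrite ler_wpM2l.
  have E12 : dot (gconv d f w) (- phi w - a i.1) = u w - dot (gconv d f w) (a i.1).
    by rewrite dotC dotBl dotNl (dotC (phi w)) (dotC (a i.1)).
  rewrite E12 in H2; rewrite -[leLHS](subrK (dot (gconv d f w) (a i.1))).
  rewrite -[X in _ + X](subrK (dot (gconv d f (z i)) (a i.1))) addrA [leRHS]addrC.
  by rewrite lerD2r /err1 addrC lerD.
pose A := \int[mu]_(y in cball n.+1 (rho + d)) `|F y|.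
have AE : A <= Af + Df.
  have hD : L1loc (fun y => F y - f y).
    by have := L1loc_lin (-1) hf hF; congr L1loc; apply/funext => y; rewrite mulN1r addrC.
  have iF := L1loc_integrable (L1loc_norm hF) rd0; have i_f := L1loc_integrable (L1loc_norm hf) rd0.
  have iD := L1loc_integrable (L1loc_norm hD) rd0.
  have mBd : measurable (cball n.+1 (rho + d) : set V) by exact: measurable_cball.
  rewrite /Af /Df -(RintegralD mBd i_f iD); apply: le_Rintegral => //; first exact: integrableDR.
  by move=> y _; rewrite (le_trans _ (ler_normD _ _))// addrC subrK.
(* With half-side [eps / 2], the factor [h / 2] becomes [eps / 4]: the constant of the limit appears
   here. *)
have cube2 i : i \in t -> eps ^+ n.+1 * (eps / 4) * (dot (gconv d f (z i)) (a i.1) - lip * Df - C2 * m ^+ 2 * eps * (Af + Df)) <=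
    \int[mu]_(w in Q i) (oriented_sign (z i) (O i.1) (a i.1) w * conv d F w).
  move=> it; have zr := Qrho _ it _ (zQ i).
  have H := oriented_sign_conv_ge d0 h0 (ltW rho0) hF (OO i.1) (OP i.1).2 zr (Qrho _ it).
  apply: le_trans H; rewrite e2 -/A -/C2 -[leLHS]mulrA.
  apply: ler_wpM2l; first by rewrite exprn_ge0// ltW.
  have H2 := dot_gconv_sub_le d0 (a i.1) hF hf (ltW rho0) zr.
  have H3 : dot (gconv d f (z i)) (a i.1) - dot (gconv d F (z i)) (a i.1) <= lip * Df.
    rewrite -opprB; apply: (le_trans (ler_norm _)); rewrite normrN; apply: (le_trans H2).
    by rewrite -/lip -/Df ler_wpM2r// ler_piMr.
  have H4 : enorm (a i.1) * (C2 * (m * (eps / 2)) ^+ 2 * A) <= C2 * (m * (eps / 2)) ^+ 2 * (Af + Df).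
    have X0 : 0 <= C2 * (m * (eps / 2)) ^+ 2 by rewrite mulr_ge0// sqr_ge0.
    apply: (@le_trans _ _ (C2 * (m * (eps / 2)) ^+ 2 * A)).
      by rewrite ler_piMl// mulr_ge0//; exact: Rintegral_ge0.
    exact: ler_wpM2l.
  have H5 := ler_wpM2l (ltW (divr_gt0 e0 (ltr0n R 4))) H3.
  move: H4 H5; move: (dot _ _) (dot _ _) => X Y.
  set Z := enorm _ * _; move=> H4 H5.
  have E4 : C2 * (m * (eps / 2)) ^+ 2 * (Af + Df) = eps / 4 * (C2 * m ^+ 2 * eps * (Af + Df)) by field.
  rewrite E4 in H4; move: H4 H5.
  by rewrite !mulrBr; lra.
have test := @Kfun_test_conv R n.+1 d eps C F _ t z (fun i => O i.1) (fun i => oriented_sign (z i) (O i.1) (a i.1))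
  d0 e0 isT hF KC ut (fun i => OO i.1) tdis (fun i => measurable_oriented_sign _ _ _)
  (fun i x => le_trans (oriented_sign_le _ _ _ _) (a1 i.1)) (fun i => Rintegral_oriented_sign _ _ h0 (OO i.1)).
have sum2 : \sum_(i <- t) (eps ^+ n.+1 * (eps / 4) * (dot (gconv d f (z i)) (a i.1) - lip * Df - C2 * m ^+ 2 * eps * (Af + Df))) <= eps * C.
  apply: le_trans test; rewrite big_seq [leRHS]big_seq; apply: ler_sum => i it; exact: cube2.
have sum1 : \sum_(i <- t) \int[mu]_(w in Q i) u w <= \sum_(i <- t) (eps ^+ n.+1 * (dot (gconv d f (z i)) (a i.1) + err1)).
  by rewrite big_seq [leRHS]big_seq; apply: ler_sum => i it; exact: cube1.
pose T := \sum_(i <- t) (eps ^+ n.+1 * dot (gconv d f (z i)) (a i.1)).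
have E1 : \sum_(i <- t) (eps ^+ n.+1 * (dot (gconv d f (z i)) (a i.1) + err1)) = T + S * err1.
  by rewrite /S mulr_suml -big_split/=; apply: eq_bigr => i _; rewrite mulrDr.
have E2 : \sum_(i <- t) (eps ^+ n.+1 * (eps / 4) * (dot (gconv d f (z i)) (a i.1) - lip * Df - C2 * m ^+ 2 * eps * (Af + Df))) =
   eps * ((T - S * (lip * Df + C2 * m ^+ 2 * eps * (Af + Df))) / 4).
  rewrite /T /S mulr_suml -sumrB mulr_suml mulr_sumr; apply: eq_bigr => i _; by field.
rewrite E2 ler_pM2l// in sum2; rewrite E1 in sum1.
rewrite ibp; apply: (le_trans disc).
have tS : (2 * rho - 4 * m * N%:R * eps) ^+ n.+1 <= S by exact: tsum.
have BS := ler_wpM2l B0 tS.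
have err0 : 0 <= err1 + lip * Df + C2 * m ^+ 2 * eps * (Af + Df).
  have hh := ltW h0; have ee := ltW e0.
  have r20 : 0 <= rho / N%:R / 2 by rewrite divr_ge0// divr_ge0// ltW.
  have m20 : 0 <= m ^+ 2 := sqr_ge0 _.
  have AD0 : 0 <= Af + Df by exact: addr_ge0.
  by rewrite /err1; do ![apply: addr_ge0]; do ![apply: mulr_ge0 => //].
have SE := ler_wpM2r err0 SD.
move: sum1 sum2 BS SE; rewrite -/err1 -/B -/lip -/C2.
move: (\sum_(i <- t) _) => X.
set e3 := C2 * _ * _ * _; set e4 := lip * Df.
move: ((2 * rho - _) ^+ _) ((2 * rho) ^+ _) => P1 P2.
lra.
Qed.

End lower_bound.

Section gamma_liminf.
Context {R : realType} {n : nat}.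
Local Notation mu := (lebesgue_rV R n.+1).
Local Notation V := ('rV[R]_n.+1).
Local Notation m := (n.+1%:R : R).
Implicit Types (f : V -> R) (phi : V -> V).

Lemma le_ereal_inf_lbound (S : set (\bar R)) (M : \bar R) : lbound S M -> (M <= ereal_inf S)%E.
Proof.
move=> SM; rewrite /ereal_inf leeNr; apply: ge_ereal_sup => _ [x Sx <-].
by rewrite leeN2; exact: SM.
Qed.

(** Testing against all finite upper bounds deals with an infinite [Kfun] at no cost: such a value
    has none. *)
Lemma le_ereal_bound (x : \bar R) (y : R) : (forall C : R, (x <= C%:E)%E -> y <= C) -> (y%:E <= x)%E.
Proof.
case: x => [r H|_|H]; [by rewrite lee_fin; exact: H|exact: leey|].
by have := H (y - 1) (leNye _); rewrite lerBrDr => H'; exfalso; move: H'; lra.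
Qed.

Lemma cvg_local_norm (F : R -> V -> R) f r : 0 <= r -> cvg_L1loc F f ->
  \int[mu]_(y in cball n.+1 r) `|F eps y - f y| @[eps --> 0^'+] --> 0.
Proof. by move=> r0 Ff; have /fine_cvgP[_] := Ff _ (compact_cball r0). Qed.

(** [d] and [phi] stay fixed. The number of boxes is chosen first, against the only error that does
    not vanish with [eps]; the remaining error [E] then tends to 0, as [Df] does by the L^1_loc
    convergence. *)
Lemma Kfun_conv_liminf (f : V -> R) (F : R -> V -> R) phi (d eta : R) :
  0 < d -> 0 < eta -> L1loc f -> (forall eps, 0 < eps -> L1loc (F eps)) -> cvg_L1loc F f ->
  C1c phi -> (forall x, enorm (phi x) <= 1) ->
  \forall eps \near 0^'+, forall C, (Kfun eps (F eps) <= C%:E)%E ->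
    \int[mu]_x (conv d f x * divergence phi x) - eta <= 4 * C.
Proof.
move=> d0 eta0 hf hF Ff hphi phi1.
have [rho rho0 phi0] := C1c_support hphi; have [L L0 HL] := C1c_lipschitz hphi.
have rd0 : 0 <= rho + d by rewrite addr_ge0// ltW.
pose Af := \int[mu]_(y in cball n.+1 (rho + d)) `|f y|.
pose lip := @moll_lip R n.+1 d; pose C2 := @moll_C2 R n.+1 d; pose P := (2 * rho) ^+ n.+1.
have lip0 : 0 <= lip by exact: moll_lip_ge0.
have Af0 : 0 <= Af by exact: Rintegral_ge0.
have P0 : 0 <= P by rewrite exprn_ge0// mulr_ge0// ltW.
pose K := P * (lip * (m * (L * (rho / 2))) * Af).
have K0 : 0 <= K.
  apply: mulr_ge0 => //; apply: mulr_ge0 => //; apply: mulr_ge0 => //; apply: mulr_ge0 => //.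
  by apply: mulr_ge0 => //; rewrite divr_ge0// ltW.
have eta2 : 0 < eta / 2 by rewrite divr_gt0.
(* [K / N] bounds the error from the variation of [phi] over a box of side [rho / N]. *)
pose N := (Num.truncn (K / (eta / 2))).+1.
have NR : 0 < N%:R :> R by rewrite ltr0n.
have KN : P * (lip * (m * (L * (rho / N%:R / 2))) * Af) <= eta / 2.
  have -> : P * (lip * (m * (L * (rho / N%:R / 2))) * Af) = K / N%:R.
    by rewrite /K; field; rewrite gt_eqF.
  have /andP[_ H] := truncn_itv (divr_ge0 K0 (ltW eta2)).
  by move: H; rewrite -/N ltr_pdivrMr// ler_pdivrMr// mulrC => /ltW.
pose Df eps := \int[mu]_(y in cball n.+1 (rho + d)) `|F eps y - f y|.
have Dc : Df eps @[eps --> 0^'+] --> 0 by exact: cvg_local_norm.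
have Ic : eps @[eps --> (0 : R)^'+] --> (0 : R) by apply: cvg_at_right_filter; exact: cvg_id.
pose E eps := lip * Af * (P - (2 * rho - 4 * m * N%:R * eps) ^+ n.+1) +
  P * (6 * C2 * m * Af / 2 * eps + lip * Df eps + C2 * m ^+ 2 * (eps * (Af + Df eps))).
have Ec : E eps @[eps --> 0^'+] --> 0.
  suff : E eps @[eps --> 0^'+] --> lip * Af * (P - (2 * rho - 4 * m * N%:R * 0) ^+ n.+1) +
      P * (6 * C2 * m * Af / 2 * 0 + lip * 0 + C2 * m ^+ 2 * (0 * (Af + 0))).
    by rewrite !(mulr0, mul0r, subr0, addr0) subrr mulr0.
  apply: cvgD; apply: cvgMr.
    apply: cvgB; first exact: cvg_cst.
    apply: (@cvg_comp _ _ _ (fun eps => 2 * rho - 4 * m * N%:R * eps) (fun y => y ^+ n.+1)); last first.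
      exact: exprn_continuous.
    apply: cvgB; [exact: cvg_cst|apply: cvgMr].
    exact: Ic.
  apply: cvgD; last by apply: cvgMr; apply: cvgM; [exact: Ic|apply: cvgD; [exact: cvg_cst|exact: Dc]].
  by apply: cvgD; apply: cvgMr; [exact: Ic|exact: Dc].
have sm0 : 0 < rho / N%:R / (2 * m) by rewrite divr_gt0// ?divr_gt0// mulr_gt0.
near=> eps => C KC.
have eps0 : 0 < eps by [].
have epsN : 2 * m * eps < rho / N%:R.
  have : eps < rho / N%:R / (2 * m) by near: eps; exact: nbhs_right_lt.
  by rewrite ltr_pdivlMr ?mulr_gt0// mulrC.
have EE : `|0 - E eps| <= eta / 2 by near: eps; exact: (cvgrPdist_le _ _).1 Ec _ eta2.
have := Kfun_lower d0 hf (hF _ eps0) hphi phi1 rho0 phi0 L0 HL (ltn0Sn _) eps0 epsN KC.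
cbv zeta; rewrite -/(Df eps) -/Af -/lip -/C2 -/P -/N => H.
rewrite lerBlDr; apply: (le_trans H).
move: EE; rewrite sub0r normrN => /(le_trans (ler_norm _)); rewrite /E; move: KN.
move: (Df eps) => D; set X := (_ - _) ^+ _.
have -> : 6 * C2 * (m * (eps / 2)) * Af = 6 * C2 * m * Af / 2 * eps by field.
have -> : C2 * m ^+ 2 * eps * (Af + D) = C2 * m ^+ 2 * (eps * (Af + D)) by ring.
set Y := lip * (m * _) * Af; set Z := 6 * C2 * m * Af / 2 * eps; set W := C2 * _ * _.
by rewrite !mulrDr; lra.
Unshelve. all: by end_near.
Qed.

Lemma integrable_divergence f phi : L1loc f -> C1c phi ->
  mu.-integrable setT (EFin \o (fun x => f x * divergence phi x)) /\
  exists2 r, 0 < r & exists2 C, 0 <= C & (forall x, ~ cball n.+1 r x -> divergence phi x = 0) /\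
    measurable_fun setT (divergence phi) /\ forall x, `|divergence phi x| <= C.
Proof.
move=> hf hphi; have [r r0 phi0] := C1c_support hphi; have [_ cD _] := hphi.
have W j : exists c, 0 <= c /\ forall x, `|'D_(delta_mx ord0 j) phi x| <= c.
  by have [c c0 cP] := C1c_derive_bounded (delta_mx ord0 j) hphi; exists c.
have [C CP] := choice W.
have C0 : 0 <= \sum_j C j by apply: sumr_ge0 => j _; exact: (CP j).1.
have md : measurable_fun setT (divergence phi).
  by apply: measurable_sum => i; apply: continuous_measurable_rV; apply: continuous_coordV; exact: cD.
have dC x : `|divergence phi x| <= \sum_j C j.
  rewrite (le_trans (ler_norm_sum _ _ _))//; apply: ler_sum => j _.
  by rewrite (le_trans (rV_norm_coord _ _))//; exact: (CP j).2.
have d0 x : ~ cball n.+1 r x -> divergence phi x = 0.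
  by move=> xr; rewrite /divergence big1// => i _; rewrite (derive_outside _ (ltW r0) phi0)// mxE.
split; first exact: (integrable_supported hf (ltW r0) md dC d0).
by exists r => //; exists (\sum_j C j).
Qed.

Lemma conv_divergence_approx f phi (e : R) : L1loc f -> C1c phi -> 0 < e ->
  exists2 d, 0 < d & \int[mu]_x (f x * divergence phi x) - e <= \int[mu]_x (conv d f x * divergence phi x).
Proof.
move=> hf hphi e0; have [i1 [r r0 [C C0 [d0 [md dC]]]]] := integrable_divergence hf hphi.
have [_ /(_ r (e / (C + 1)) (ltW r0))] := mollifiable_L1loc hf.
have C1 : 0 < C + 1 by rewrite ltr_wpDl.
case=> [|del del0 Hd]; first exact: divr_gt0.
have d20 : 0 < del / 2 by rewrite divr_gt0.
exists (del / 2) => //; have hc := L1loc_conv d20 hf.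
have := Hd _ d20; rewrite ltr_pdivrMr// ltr_pMr// ltr1n => /(_ isT) H.
have [i2 _] := integrable_divergence hc hphi.
have mD : measurable (cball n.+1 r : set V) by exact: measurable_cball.
have hD : L1loc (fun y => f y - conv (del / 2) f y).
  by have := L1loc_lin (-1) hc hf; congr L1loc; apply/funext => y; rewrite mulN1r addrC.
have iN := L1loc_integrable (L1loc_norm hD) (ltW r0).
rewrite lerBlDr -lerBlDl -RintegralB//.
have -> : \int[mu]_x (f x * divergence phi x - conv (del / 2) f x * divergence phi x) =
    \int[mu]_(x in cball n.+1 r) ((f x - conv (del / 2) f x) * divergence phi x).
  rewrite [RHS]Rintegral_mkcond; apply: eq_Rintegral => x _; rewrite -mulrBl patchE.
  by case: ifPn => // /negP xr; rewrite d0 ?mulr0// => xr'; apply: xr; rewrite inE.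
apply: (le_trans (ler_norm _)).
apply: (le_trans (normr_Rintegral_weight_le mD (L1loc_integrable hD (ltW r0)) (measurable_funTS md) (fun x _ => dC x))).
have H' : \int[mu]_(y in cball n.+1 r) `|f y - conv (del / 2) f y| <= e / (C + 1).
  by apply: le_trans H; apply: eq_ler; apply: eq_Rintegral => y _; rewrite distrC.
apply: (le_trans (ler_wpM2l C0 H')); rewrite mulrA ler_pdivrMr// mulrC.
by rewrite ler_pM2l// lerDl.
Qed.

Lemma gamma_liminf f (F : R -> V -> R) : L1loc f -> (forall eps, 0 < eps -> L1loc (F eps)) -> cvg_L1loc F f ->
  ((4^-1)%:E * ext_total_variation f <= limf_einf (fun eps : R => Kfun eps (F eps)) 0^'+)%E.
Proof.
move=> hf hF Ff; rewrite lee_pdivrMl//; apply: ge_ereal_sup => _ [phi [hphi phi1] <-].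
have [i1 _] := integrable_divergence hf hphi.
pose I := \int[mu]_x (f x * divergence phi x).
have -> : (\int[mu]_x (f x * divergence phi x)%:E = I%:E)%E.
  by rewrite /I /Rintegral fineK//; exact: integrable_fin_num.
rewrite -lee_pdivrMl//; apply/lee_addgt0Pr => e e0.
rewrite -leeBlDr// -EFinM -EFinB.
(* The tolerance is [2 e] twice, for mollifying [f] and for the limit in [eps]: together [4 e], that
   is [e] after division by 4. *)
have [d d0 Hd] := conv_divergence_approx hf hphi (mulr_gt0 (ltr0n R 2) e0).
have H := Kfun_conv_liminf d0 (mulr_gt0 (ltr0n R 2) e0) hf hF Ff hphi phi1.
rewrite limf_einfE; pose U := [set eps : R | forall C, (Kfun eps (F eps) <= C%:E)%E ->
  \int[mu]_x (conv d f x * divergence phi x) - 2 * e <= 4 * C].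
apply: (@le_trans _ _ (ereal_inf ((fun eps : R => Kfun eps (F eps)) @` U))).
  apply: le_ereal_inf_lbound => _ [eps Heps <-]; apply: le_ereal_bound => C KC.
  by have := Heps C KC; move: Hd; rewrite -/I; move: I (Rintegral _ _ _) => I J; lra.
by apply: ereal_sup_ubound; exists U.
Qed.

End gamma_liminf.

(** * The recovery family *)

Section gamma_limsup.
Context {R : realType} {n : nat}.
Local Notation V := ('rV[R]_n).

(** With [d] the square root of [eps], the half-side is of order [d^2], the Lipschitz constant
    [d^-(n+1)] and the volume [d^n], the radius being of order [d] because [eps <= d]. The product
    is of order [d] and tends to 0. *)
Lemma upper_factor_le (eps : R) : 0 < eps -> eps <= 1 ->
  @upper_factor R n (Num.sqrt eps) (eps / 2) <=
  4^-1 + 16 * n%:R ^+ 2 * n.+1%:R ^+ n * (2 * n.+1%:R) ^+ n * Num.sqrt eps.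
Proof.
move=> e0 e1; set d := Num.sqrt eps.
have d0 : 0 < d by rewrite sqrtr_gt0.
have eE : eps = d ^+ 2 by rewrite /d sqr_sqrtr// ltW.
have d1 : d <= 1 by rewrite /d -sqrtr1 ler_sqrt.
rewrite /upper_factor lerD2l /field_error.
have lipE := @moll_lip_le R n d d0.
have n0 : 0 <= n%:R :> R by [].
have pw : (2 * (d + 2 * n%:R * (eps / 2))) ^+ n <= (2 * n.+1%:R) ^+ n * d ^+ n.
  have dd : 0 <= d + 2 * n%:R * (eps / 2).
    by rewrite addr_ge0 ?(ltW d0)// !mulr_ge0// ?divr_ge0// ltW.
  rewrite -exprMn; apply: lerXn2r; rewrite ?nnegrE ?mulr_ge0 ?(ltW d0)//.
  have ed : eps <= d by rewrite eE expr2 ler_piMl// ltW.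
  have -> : n.+1%:R = n%:R + 1 :> R by rewrite natr1.
  by have := ler_wpM2l n0 ed; lra.
have dn0 : 0 < d ^+ n by rewrite exprn_gt0.
apply: (@le_trans _ _ (2 * n%:R ^+ 2 * (eps / 2) * (16 * n.+1%:R ^+ n / d ^+ n.+1) * ((2 * n.+1%:R) ^+ n * d ^+ n))).
  apply: ler_pM => //.
  - by rewrite mulr_ge0 ?moll_lip_ge0// mulr_ge0// ?divr_ge0 ?(ltW e0)// mulr_ge0// sqr_ge0.
  - by rewrite exprn_ge0// mulr_ge0// addr_ge0 ?(ltW d0)// !mulr_ge0// ?divr_ge0// ltW.
  - by rewrite ler_wpM2l// mulr_ge0// ?divr_ge0 ?(ltW e0)// mulr_ge0// sqr_ge0.
apply: eq_ler; rewrite [d ^+ n.+1]exprS eE; clearbody d.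
by field; rewrite !gt_eqF.
Qed.

Lemma gamma_limsup (f : V -> R) : (0 < n)%N -> L1loc f ->
  (limf_esup (fun eps : R => Kfun eps (conv (Num.sqrt eps) f)) 0^'+ <= (4^-1)%:E * ext_total_variation f)%E.
Proof.
move=> n0 hf.
have T0 : (0 <= ext_total_variation f)%E.
  apply: ereal_sup_ubound; exists (fun=> 0).
    by split; [exact: C1c0|move=> x; rewrite enorm0].
  by under eq_integral do rewrite divergence0 mulr0; rewrite integral0.
(* Infinite variation makes the claim trivial; nonnegativity of the variation, from the zero field,
   excludes the value [-oo]. *)
case TE : (ext_total_variation f) T0 => [C| |] // C0; last by rewrite gt0_muley// ?lte_fin// leey.
rewrite lee_fin in C0; have TC : (ext_total_variation f <= C%:E)%E by rewrite TE.
pose D : R := 16 * n%:R ^+ 2 * n.+1%:R ^+ n * (2 * n.+1%:R) ^+ n.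
have D0 : 0 <= D by rewrite /D !mulr_ge0// ?sqr_ge0// exprn_ge0// mulr_ge0.
rewrite -EFinM; apply/lee_addgt0Pr => e e0; rewrite limf_esupE.
(* The threshold makes the error [D * C * Num.sqrt eps] at most [e]; the added 1 keeps the quotient
   meaningful when [C = 0]. *)
have q0 : 0 < e / (D * C + 1) by rewrite divr_gt0// ltr_wpDl// mulr_ge0.
pose U := [set eps : R | 0 < eps /\ eps <= 1 /\ Num.sqrt eps <= e / (D * C + 1)].
apply: (@le_trans _ _ (ereal_sup ((fun eps : R => Kfun eps (conv (Num.sqrt eps) f)) @` U))).
  apply: ereal_inf_lbound; exists U => //; rewrite /U.
  near=> eps; split => //; split; first by near: eps; exact: nbhs_right_le.
  rewrite -[leRHS]gtr0_norm// -sqrtr_sqr ler_sqrt ?exprn_ge0 ?(ltW q0)//.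
  by near: eps; apply: nbhs_right_le; rewrite exprn_gt0.
apply: ge_ereal_sup => _ [eps [eps0 [eps1 epsq]] <-].
have d0 : 0 < Num.sqrt eps by rewrite sqrtr_gt0.
apply: (le_trans (Kfun_conv_le d0 eps0 n0 hf TC)); rewrite -EFinD lee_fin.
apply: (le_trans (ler_wpM2r C0 (upper_factor_le eps0 eps1))); rewrite -/D mulrDl lerD2l.
have DC1 : 0 < D * C + 1 by rewrite ltr_wpDl// mulr_ge0.
rewrite mulrAC; apply: (le_trans (ler_wpM2l (mulr_ge0 D0 C0) epsq)).
by rewrite mulrA ler_pdivrMr// mulrC ler_pM2l// lerDl.
Unshelve. all: by end_near.
Qed.

End gamma_limsup.

Theorem theorem1 (R : realType) (n : nat) (hn : (1 <= n)%N)
    (f : 'rV[R]_n -> R) (hf : L1loc f) :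
  (forall F : R -> 'rV[R]_n -> R,
     (forall eps : R, 0 < eps -> L1loc (F eps)) ->
     cvg_L1loc F f ->
     ((4^-1)%:E * ext_total_variation f
        <= limf_einf (fun eps : R => Kfun eps (F eps)) 0^'+)%E) /\
  (exists F : R -> 'rV[R]_n -> R,
     [/\ forall eps : R, 0 < eps -> L1loc (F eps),
         cvg_L1loc F f
       & (limf_esup (fun eps : R => Kfun eps (F eps)) 0^'+
            <= (4^-1)%:E * ext_total_variation f)%E]).
Proof.
split.
  (* The lower bound is developed in dimension [n.+1], where [ord0] names the edge direction of the
     cubes. *)
  by case: n hn f hf => // n _ f hf F; exact: gamma_liminf.
exists (fun eps => conv (Num.sqrt eps) f); split.
- by move=> eps eps0; apply: L1loc_conv => //; rewrite sqrtr_gt0.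
- exact: cvg_L1loc_conv.
- exact: gamma_limsup.
Qed.
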